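(* Let $\psi$ be a complex-valued measurable function defined a.e. on $(0,T)\times\mathbb{R}^d$. Let $u_0\in\mathcal{F}^{-1}L_{1,\mathrm{loc}}(\mathbb{R}^d)$ and $f\in\mathcal{X}_{1,1}(1)$. Suppose that for all $t\in(0,T)$ and $R\in(0,\infty)$ $$\int_{B_R}\exp\Big(\int_0^t\Re[\psi(r,\xi)]dr\Big)|\mathcal{F}[u_0](\xi)|\,d\xi+\int_{B_R}\int_0^t\exp\Big(\int_s^t\Re[\psi(r,\xi)]dr\Big)|\mathcal{F}[f(s,\cdot)](\xi)|\,ds\,d\xi<\infty.$$ Additionally, assume that for all $t\in(0,T)$ and $R\in(0,\infty)$ $$\int_{B_R}\int_0^t|\psi(\rho,\xi)|\exp\Big(\int_0^\rho\Re[\psi(r,\xi)]dr\Big)|\mathcal{F}[u_0](\xi)|\,d\rho\,d\xi+\int_{B_R}\int_0^t|\psi(\rho,\xi)|\int_0^\rho\exp\Big(\int_s^\rho\Re[\psi(r,\xi)]dr\Big)|\mathcal{F}[f(s,\cdot)](\xi)|\,ds\,d\rho\,d\xi<\infty.$$ Then there exists a unique Fourier-space weak solution $u\in\mathcal{X}_{\infty,1}(1)\cap\mathcal{X}_{1,1}(|\psi|)$ to the Cauchy problem $$\partial_tu(t,x)=\psi(t,-i\nabla)u(t,x)+f(t,x),\quad (t,x)\in(0,T)\times\mathbb{R}^d,\qquad u(0,x)=u_0,$$ which is given by $$\langle u(t,\cdot),\varphi\rangle=\int_{\mathbb{R}^d}\exp\Big(\int_0^t\psi(r,\xi)dr\Big)\mathcal{F}[u_0](\xi)\overline{\mathcal{F}[\varphi](\xi)}\,d\xi+\int_{\mathbb{R}^d}\Big(\int_0^t\exp\Big(\int_s^t\psi(r,\xi)dr\Big)\mathcal{F}[f(s,\cdot)](\xi)\,ds\Big)\overline{\mathcal{F}[\varphi](\xi)}\,d\xi$$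 for all $\varphi\in\mathcal{F}^{-1}\mathcal{D}(\mathbb{R}^d)$.
   Context: Fix $T\in(0,\infty]$ and $d\in\mathbb{N}$. All functions are complex-valued; $B_R=\{\xi\in\mathbb{R}^d:|\xi|<R\}$. $\mathcal{F}[f](\xi)=(2\pi)^{-d/2}\int e^{-i\xi\cdot x}f(x)dx$ and $\mathcal{F}^{-1}[f](x)=(2\pi)^{-d/2}\int e^{ix\cdot\xi}f(\xi)d\xi$, always in the space variable only. $\mathcal{D}(\mathbb{R}^d)$ denotes the smooth compactly supported functions, $\mathcal{S}(\mathbb{R}^d)$ the Schwartz space, and $\mathcal{F}^{-1}\mathcal{D}(\mathbb{R}^d)=\{\varphi\in\mathcal{S}(\mathbb{R}^d):\mathcal{F}[\varphi]\in\mathcal{D}(\mathbb{R}^d)\}$ with the subspace topology inherited from $\mathcal{S}(\mathbb{R}^d)$. Pairings are conjugate-linear in the test function; a locally integrable $v$ is identified with the distribution $\langle v,\varphi\rangle=\int v\overline{\varphi}$. $\mathcal{F}^{-1}\mathcal{D}'(\mathbb{R}^d)$ is the dual space of $\mathcal{F}^{-1}\mathcal{D}(\mathbb{R}^d)$, with the weak*-topology and its Borel sets. For $u\in\mathcal{F}^{-1}\mathcal{D}'(\mathbb{R}^d)$, $\mathcal{F}[u]\in\mathcal{D}'(\mathbb{R}^d)$ is defined by $\langle\mathcal{F}[u],\varphi\rangle:=\langle u,\mathcal{F}^{-1}[\varphi]\rangle$, $\varphi\in\mathcal{D}(\mathbb{R}^d)$. For $v\in\mathcal{D}'(\mathbb{R}^d)$,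 $\mathcal{F}^{-1}[v]$ is defined as an element of $\mathcal{F}^{-1}\mathcal{D}'(\mathbb{R}^d)$ by $\langle\mathcal{F}^{-1}[v],\varphi\rangle:=\langle v,\mathcal{F}[\varphi]\rangle$, $\varphi\in\mathcal{F}^{-1}\mathcal{D}(\mathbb{R}^d)$; in this way $\mathcal{F}^{-1}\mathcal{D}'(\mathbb{R}^d)$ is regarded as the space of all (inverse) Fourier transforms of distributions on $\mathbb{R}^d$. $\mathcal{F}[u]$ has a realization $v$ on an open set $U$ if $v$ is locally integrable on $U$ and $\langle\mathcal{F}[u],\varphi\rangle=\int v\overline{\varphi}$ for all $\varphi\in\mathcal{D}(U)$; then $\mathcal{F}[u]$ is identified with $v$ on $U$. $\mathcal{F}^{-1}L_{1,\mathrm{loc}}(\mathbb{R}^d)$ is the set of $u\in\mathcal{F}^{-1}\mathcal{D}'(\mathbb{R}^d)$ with $\mathcal{F}[u]\in L_{1,\mathrm{loc}}(\mathbb{R}^d)$. $L_0((0,T);\mathcal{F}^{-1}\mathcal{D}'(\mathbb{R}^d))$ is the set of Borel measurable $\mathcal{F}^{-1}\mathcal{D}'(\mathbb{R}^d)$-valued functions $u(t)=u(t,\cdot)$ defined a.e. on $(0,T)$ (identified if equal a.e.). For $p,q\in[1,\infty]$ and a nonnegative measurable $m$ on $(0,T)\times\mathbb{R}^d$, $\mathcal{X}_{p,q}(m)$ is the set of $u\in L_0((0,T);\mathcal{F}^{-1}\mathcal{D}'(\mathbb{R}^d))$ such that for each $t$ (where $u(t)$ is defined) $\mathcal{F}[u(t,\cdot)]$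 has a realization on an open set containing the support of $m(t,\cdot)$, and $\|m\,\mathcal{F}[u]\|_{L_p((0,t_1);L_q(B_R))}<\infty$ for all $t_1\in(0,T)$, $R\in(0,\infty)$, where $m\,\mathcal{F}[u]$ is measurable and set to $0$ outside these open sets. If $g\in\mathcal{F}^{-1}\mathcal{D}'(\mathbb{R}^d)$, $\mathcal{F}[g]$ has a realization on an open set containing the support of $\psi(t,\cdot)$ and $\psi(t,\cdot)\mathcal{F}[g]$ is locally integrable, then $\psi(t,-i\nabla)g\in\mathcal{F}^{-1}\mathcal{D}'(\mathbb{R}^d)$ is defined by $\langle\psi(t,-i\nabla)g,\varphi\rangle=\int\psi(t,\xi)\mathcal{F}[g](\xi)\overline{\mathcal{F}[\varphi](\xi)}d\xi$. A Fourier-space weak solution of the Cauchy problem is $u\in L_0((0,T);\mathcal{F}^{-1}\mathcal{D}'(\mathbb{R}^d))$ such that for every $\varphi\in\mathcal{F}^{-1}\mathcal{D}(\mathbb{R}^d)$, $$\langle u(t,\cdot),\varphi\rangle=\langle u_0,\varphi\rangle+\int_0^t\langle\psi(s,-i\nabla)u(s,\cdot),\varphi\rangle ds+\int_0^t\langle f(s,\cdot),\varphi\rangle ds\qquad\text{for a.e. }t\in(0,T).$$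
   Formalization: The dual of F^{-1}D is taken for the topology carried over from D by the Fourier transform, not that induced by S (false there: ψ=|ξ|^4, F[u_0]=1, f=0), and ∫_0^t|ψ(r,ξ)|dr<∞ for a.e. ξ and all t in (0,T) is assumed (for ψ=1/t uniqueness fails). *)

(* Defs.v *)
From HB Require Import structures.
From mathcomp Require Import all_boot all_order all_algebra.
From mathcomp Require Import all_classical all_reals all_analysis.
From mathcomp.real_closed Require Import complex.

Set Implicit Arguments.
Unset Strict Implicit.
Unset Printing Implicit Defensive.

Import Order.TTheory GRing.Theory Num.Theory.
Import numFieldNormedType.Exports.

Local Open Scope classical_set_scope.
Local Open Scope ring_scope.

(* The sigma-algebra of ['rV[T]_n] generated by the coordinates; for [T = R]
   it is the Borel sigma-algebra of R^n. *)
Definition measure_rV_display : measure_display -> measure_display.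
Proof. exact. Qed.

Section measurable_rV.
Context {disp} {T : sigmaRingType disp}.
Variable n : nat.

Let coors : 'I_n -> 'rV[T]_n -> T := fun i x => x ord0 i.

Let rV_set0 : g_sigma_preimage coors set0.
Proof. exact: sigma_algebra0. Qed.

Let rV_setC A : g_sigma_preimage coors A -> g_sigma_preimage coors (~` A).
Proof. exact: sigma_algebraC. Qed.

Let rV_bigcup (F : _^nat) : (forall i, g_sigma_preimage coors (F i)) ->
  g_sigma_preimage coors (\bigcup_i (F i)).
Proof. exact: sigma_algebra_bigcup. Qed.

HB.instance Definition _ := @isMeasurable.Build (measure_rV_display disp)
  'rV[T]_n (g_sigma_preimage coors) rV_set0 rV_setC rV_bigcup.

End measurable_rV.

Lemma measurable_rV_coord {disp} {T : sigmaRingType disp} {n} (i : 'I_n) :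
  measurable_fun [set: 'rV[T]_n] (fun x : 'rV[T]_n => x ord0 i).
Proof.
move=> _ Y mY; rewrite setTI; apply: sub_sigma_algebra => /=.
rewrite -bigcup_seq/=; exists i => /=; first by rewrite mem_index_enum.
by exists Y => //; rewrite setTI.
Qed.

Lemma measurable_fun_rV {d1 d2} {T1 : measurableType d1} {T2 : measurableType d2}
    {n} (f : T1 -> 'rV[T2]_n) :
  (forall i, measurable_fun setT (fun x => f x ord0 i)) -> measurable_fun setT f.
Proof.
move=> mf _ Y mY; rewrite setTI.
suff : preimage_set_system setT f measurable `<=` measurable.
  by apply; exists Y => //; rewrite setTI.
rewrite [X in preimage_set_system _ _ X](_ : _ =
  g_sigma_preimage (fun (i : 'I_n) (x : 'rV[T2]_n) => x ord0 i))//.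
rewrite -(g_sigma_preimage_comp (fun (i : 'I_n) (x : 'rV[T2]_n) => x ord0 i) f).
apply: smallest_sub; first exact: sigma_algebra_measurable.
move=> A; rewrite -bigcup_seq/= => -[i _] [B mB <-].
exact: mf.
Qed.

(* Lebesgue measure on ['rV[R]_n]: the image of [lebesgue_measure \x mu] under
   prepending a coordinate, iterated from the unit mass on R^0. *)
Section lebesgue_rV_step.
Context {R : realType} {n : nat}.
Variable mu : {sigma_finite_measure set 'rV[R]_n -> \bar R}.

Definition rV_cons (p : R * 'rV[R]_n) : 'rV[R]_n.+1 :=
  \row_i oapp (fun j => p.2 ord0 j) p.1 (unlift ord0 i).

Definition rV_uncons (v : 'rV[R]_n.+1) : R * 'rV[R]_n :=
  (v ord0 ord0, \row_j v ord0 (lift ord0 j)).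

Lemma rV_consK : cancel rV_cons rV_uncons.
Proof.
move=> [x v]; rewrite /rV_uncons !mxE unlift_none; congr pair.
by apply/rowP => j; rewrite !mxE liftK.
Qed.

Lemma measurable_rV_cons : measurable_fun setT rV_cons.
Proof.
apply: measurable_fun_rV => i; rewrite /rV_cons.
under eq_fun do rewrite mxE; case: (unlift ord0 i) => [j|] /=.
  exact: (measurableT_comp (measurable_rV_coord j) measurable_snd).
exact: measurable_fst.
Qed.

Lemma measurable_rV_uncons : measurable_fun setT rV_uncons.
Proof.
apply: measurable_fun_pair; first exact: measurable_rV_coord.
apply: measurable_fun_rV => i; under eq_fun do rewrite mxE.
exact: measurable_rV_coord.
Qed.

Definition lebesgue_rV_step : set 'rV[R]_n.+1 -> \bar R :=
  pushforward (lebesgue_measure \x mu)%E rV_cons.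

Let step0 : lebesgue_rV_step set0 = 0%E.
Proof. by rewrite /lebesgue_rV_step /pushforward preimage_set0 measure0. Qed.

Let step_ge0 A : (0 <= lebesgue_rV_step A)%E.
Proof. by rewrite /lebesgue_rV_step /pushforward measure_ge0. Qed.

Let step_sigma_additive : semi_sigma_additive lebesgue_rV_step.
Proof.
have mcons A : measurable A -> measurable (rV_cons @^-1` A).
  by move=> mA; rewrite -[X in measurable X]setTI; exact: measurable_rV_cons.
move=> F mF tF mUF; rewrite /lebesgue_rV_step /pushforward preimage_bigcup.
apply: measure_semi_sigma_additive.
- by move=> k; exact: mcons.
- apply/trivIsetP => /= i j _ _ ij; rewrite -preimage_setI.
  by move/trivIsetP : tF => /(_ _ _ _ _ ij) ->//; rewrite preimage_set0.
- by rewrite -preimage_bigcup; exact: mcons.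
Qed.

HB.instance Definition _ := isMeasure.Build _ _ _ lebesgue_rV_step
  step0 step_ge0 step_sigma_additive.

Let step_sigma_finite : sigma_finite setT lebesgue_rV_step.
Proof.
have /sigma_finiteP[F [TF ndF Foo]] := sigma_finiteT (@lebesgue_measure R).
have /sigma_finiteP[G [TG ndG Goo]] := sigma_finiteT mu.
exists (fun k => rV_uncons @^-1` (F k `*` G k)).
  rewrite -preimage_bigcup; apply/esym/seteqP; split=> // v _ /=.
  have [k _ Fk] : (\bigcup_k F k) (rV_uncons v).1 by rewrite -TF.
  have [l _ Gl] : (\bigcup_k G k) (rV_uncons v).2 by rewrite -TG.
  exists (maxn k l) => //; split.
  - by move: Fk; exact/subsetPset/ndF/leq_maxl.
  - by move: Gl; exact/subsetPset/ndG/leq_maxr.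
move=> k; have [mF Fk] := Foo k; have [mG Gk] := Goo k; split.
  rewrite -[X in measurable X]setTI; apply: measurable_rV_uncons => //.
  exact: measurableX.
rewrite /lebesgue_rV_step /pushforward -comp_preimage.
rewrite (_ : rV_uncons \o rV_cons = id); last exact/funext/rV_consK.
by rewrite preimage_id product_measure1E// lte_mul_pinfty// ge0_fin_numE.
Qed.

HB.instance Definition _ := Measure_isSigmaFinite.Build _ _ _ lebesgue_rV_step
  step_sigma_finite.

End lebesgue_rV_step.

Fixpoint lebesgue_rV (R : realType) (n : nat) :
    {sigma_finite_measure set 'rV[R]_n -> \bar R} :=
  match n with
  | 0 => \d_(0 : 'rV[R]_0)
  | m.+1 => lebesgue_rV_step (lebesgue_rV R m)
  end.

Local Notation Re := (@complex.Re _).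
Local Notation Im := (@complex.Im _).

Section complex_valued.
Context {R : realType}.
Local Notation C := R[i].

Definition cexp (z : C) : C :=
  Complex (expR (Re z) * cos (Im z)) (expR (Re z) * sin (Im z)).

Definition cmeasurable_fun {disp} {X : measurableType disp} (D : set X)
    (f : X -> C) :=
  measurable_fun D (Re \o f) /\ measurable_fun D (Im \o f).

Context {disp} {X : measurableType disp} (mu : {measure set X -> \bar R}).

Definition cintegrable (D : set X) (f : X -> C) :=
  mu.-integrable D (EFin \o (Re \o f)) /\ mu.-integrable D (EFin \o (Im \o f)).

Definition cintegral (D : set X) (f : X -> C) : C :=
  Complex (\int[mu]_(x in D) Re (f x)) (\int[mu]_(x in D) Im (f x)).

End complex_valued.

Section test_functions.
Context {R : realType} {d : nat}.
Local Notation C := R[i].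
Local Notation Rd := 'rV[R]_d.
Local Notation leb := (lebesgue_rV R d).

Definition dotp (x y : Rd) : R := \sum_(i < d) x ord0 i * y ord0 i.

(* The norm of ['rV[R]_d] in the library is the sup norm. *)
Definition enorm (x : Rd) : R := Num.sqrt (dotp x x).

Definition eball (r : R) : set Rd := [set x | enorm x < r].

Definition csupp (f : Rd -> C) : set Rd := closure [set x | f x != 0].

(* [s] lists the directions of successive differentiation, so that [size s]
   is the order |alpha| of the multi-index. *)
Definition partials (s : seq 'I_d) (g : Rd -> R) : Rd -> R :=
  foldr (fun i h => 'D_(delta_mx ord0 i) h) g s.

Definition cpartials (s : seq 'I_d) (f : Rd -> C) (x : Rd) : C :=
  Complex (partials s (Re \o f) x) (partials s (Im \o f) x).

Definition smooth (g : Rd -> R) := forall s : seq 'I_d,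
  continuous (partials s g) /\
  forall i x, derivable (partials s g) x (delta_mx ord0 i).

Definition csmooth (f : Rd -> C) := smooth (Re \o f) /\ smooth (Im \o f).

(* [test_fun U] is D(U); [invF_test] below is F^-1 D. *)
Definition test_fun (U : set Rd) (f : Rd -> C) :=
  [/\ csmooth f, compact (csupp f) & csupp f `<=` U].

Definition schwartz (f : Rd -> C) := csmooth f /\
  forall (s : seq 'I_d) (k : nat),
    exists M : R, forall x, enorm x ^+ k * Normc.normc (cpartials s f x) <= M.

Definition Fourier_cst : C := ((2 * pi) `^ (- (d%:R / 2)))%:C%C.

Definition Fourier (f : Rd -> C) (xi : Rd) : C :=
  Fourier_cst *
  cintegral leb setT (fun x => cexp (Complex 0 (- dotp xi x)) * f x).

Definition invFourier (f : Rd -> C) (x : Rd) : C :=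
  Fourier_cst *
  cintegral leb setT (fun xi => cexp (Complex 0 (dotp x xi)) * f xi).

Definition invF_test (phi : Rd -> C) :=
  schwartz phi /\ test_fun setT (Fourier phi).

Definition zero_ext (U : set Rd) (f : Rd -> C) : Rd -> C := patch (fun=> 0) U f.

Definition clocally_integrable (U : set Rd) (v : Rd -> C) :=
  [/\ open U, cmeasurable_fun U v &
      forall K, compact K -> K `<=` U ->
        (\int[leb]_(x in K) (Normc.normc (v x))%:E < +oo)%E].

End test_functions.

(* The dual space F^-1 D' of F^-1 D. An element [u] acts on F^-1 D and [act] is
   extended by 0 to all other functions, so that Leibniz equality of elements
   is equality of functionals. [act_cont] says that
   [phi |-> <F[u], phi> = <u, F^-1[phi]>] is a distribution: for every compact
   [K] it is bounded, on the test functions supported in [K], by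
   C max_(|alpha| <= N) sup |d^alpha phi|, the maximum being expressed through
   its upper bounds [M]. Equivalently, [u] is continuous for the topology of
   F^-1 D that makes the Fourier transform a homeomorphism onto D, so that
   F^-1 D' is the space of all inverse Fourier transforms of distributions.
   The topology induced by the Schwartz space would give tempered distributions
   only, which do not contain F^-1 L_{1,loc}. *)
Record invF_dual (R : realType) (d : nat) := InvFDual {
  act :> ('rV[R]_d -> R[i]) -> R[i] ;
  act_out : forall phi, ~ invF_test phi -> act phi = 0 ;
  act_conjlinear : forall (a : R[i]) (phi chi : 'rV[R]_d -> R[i]),
    invF_test phi -> invF_test chi ->
    act (fun x => a * phi x + chi x) = conjc a * act phi + act chi ;
  act_cont : forall K : set 'rV[R]_d, compact K ->
    exists (N : nat) (A : R), forall phi, invF_test phi ->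
      csupp (Fourier phi) `<=` K ->
      forall M : R,
        (forall s xi, (size s <= N)%N ->
          Normc.normc (cpartials s (Fourier phi) xi) <= M) ->
        Normc.normc (act phi) <= A * M }.

Section invF_dual_topology.
Context {R : realType} {d : nat}.
Local Notation V := (invF_dual R d).

HB.instance Definition _ := gen_eqMixin V.
HB.instance Definition _ := gen_choiceMixin V.

Lemma act0_cont (K : set 'rV[R]_d) : compact K ->
  exists (N : nat) (A : R), forall phi : 'rV[R]_d -> R[i], invF_test phi ->
    csupp (Fourier phi) `<=` K ->
    forall M : R,
      (forall s xi, (size s <= N)%N ->
        Normc.normc (cpartials s (Fourier phi) xi) <= M) ->
      Normc.normc (0 : R[i]) <= A * M.
Proof.
by move=> _; exists 0%N, 0 => phi _ _ M _; rewrite mul0r Normc.normc0.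
Qed.

Lemma act0_conjlinear (a : R[i]) (phi chi : 'rV[R]_d -> R[i]) :
  invF_test phi -> invF_test chi -> (0 : R[i]) = conjc a * 0 + 0.
Proof. by rewrite mulr0 addr0. Qed.

HB.instance Definition _ := isPointed.Build V
  (@InvFDual R d (fun=> 0) (fun _ _ => erefl) act0_conjlinear act0_cont).

Definition weak_star_subbase : set (set V) :=
  [set A | exists phi (z : R[i]) (e : R), [/\ invF_test phi, 0 < e &
    A = [set u : V | Normc.normc (u phi - z) < e]]].

HB.instance Definition _ := isSubBaseTopological.Build V weak_star_subbase id.

End invF_dual_topology.

Section pseudo_differential.
Context {R : realType} {d : nat}.
Local Notation C := R[i].
Local Notation Rd := 'rV[R]_d.
Local Notation V := (invF_dual R d).
Local Notation leb := (lebesgue_rV R d).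
Local Notation mu := (@lebesgue_measure R).

(* [F[u]] has the realization [v] on [U] *)
Definition realization (U : set Rd) (u : V) (v : Rd -> C) :=
  clocally_integrable U v /\
  forall phi, test_fun U phi ->
    u (invFourier phi) = cintegral leb U (fun xi => v xi * conjc (phi xi)).

(* [h = psi(-i nabla) g], for a symbol [psi] that depends on xi only *)
Definition symbol_op (psi : Rd -> C) (g h : V) :=
  exists (U : set Rd) (v : Rd -> C),
    [/\ csupp psi `<=` U, realization U g v,
        clocally_integrable setT (zero_ext U (fun xi => psi xi * v xi)) &
        forall phi, invF_test phi ->
          h phi = cintegral leb setT (fun xi =>
            zero_ext U (fun xi => psi xi * v xi) xi * conjc (Fourier phi xi))].

Variable T : \bar R.

Definition time_itv : set R := [set t | 0 < t /\ (t%:E < T)%E].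

(* An element of L_0((0,T); F^-1 D') is represented by an everywhere defined
   function; properties "for each t where u(t) is defined" accordingly become
   properties for almost every t. *)
Definition L0 (u : R -> V) :=
  measurable_fun time_itv (u : R -> g_sigma_algebraType (@open V)).

(* [g] is (a version of) the function [m F[u]] *)
Definition mul_Fourier (m : R -> Rd -> R) (u : R -> V) (g : R -> Rd -> C) :=
  cmeasurable_fun (time_itv `*` setT) (fun p : R * Rd => g p.1 p.2) /\
  {ae mu, forall t, time_itv t -> exists (U : set Rd) (v : Rd -> C),
    [/\ closure [set xi | m t xi != 0] `<=` U, realization U (u t) v &
        g t = zero_ext U (fun xi => (m t xi)%:C%C * v xi)]}.

(* the norm of L_p((0,t1); L_q(B_r)) *)
Definition mixed_norm (p q : \bar R) (t1 r : R) (g : R -> Rd -> C) : \bar R :=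
  Lnorm mu p (patch (fun=> 0%E) `]0, t1[ (fun t =>
    Lnorm leb q (patch (fun=> 0%E) (eball r) (fun xi =>
      (Normc.normc (g t xi))%:E)))).

Definition Xspace (p q : \bar R) (m : R -> Rd -> R) (u : R -> V) :=
  L0 u /\ exists g, mul_Fourier m u g /\
    forall t1 r, time_itv t1 -> 0 < r -> (mixed_norm p q t1 r g < +oo)%E.

Definition Fourier_weak_solution (psi : R -> Rd -> C) (u0 : V) (f u : R -> V) :=
  L0 u /\ exists w : R -> V,
    {ae mu, forall s, time_itv s -> symbol_op (psi s) (u s) (w s)} /\
    forall phi, invF_test phi ->
      (forall t, time_itv t -> cintegrable mu `]0, t[ (fun s => w s phi) /\
                               cintegrable mu `]0, t[ (fun s => f s phi)) /\
      {ae mu, forall t, time_itv t ->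
        u t phi = u0 phi + cintegral mu `]0, t[ (fun s => w s phi)
                         + cintegral mu `]0, t[ (fun s => f s phi)}.

(* exp (int_s^t Re psi(r,xi) dr) and exp (int_s^t psi(r,xi) dr) *)
Definition exp_Re_int (psi : R -> Rd -> C) (s t : R) (xi : Rd) : R :=
  expR (\int[mu]_(r in `]s, t[) Re (psi r xi)).

Definition exp_int (psi : R -> Rd -> C) (s t : R) (xi : Rd) : C :=
  cexp (cintegral mu `]s, t[ (fun r => psi r xi)).

End pseudo_differential.

(* Main.v *)
(* On the Fourier side the problem is, for almost every frequency xi, the scalar
   linear equation y' = psi y + fh, solved by variation of constants; the
   integrability hypotheses allow Fubini, which turns its integrated form into
   the weak formulation, and the resulting u is weakly* continuous, hence Borel.

   For uniqueness one needs that the conjugate Fourier transforms of elements of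
   F^-1 D exhaust D, which is a Fourier inversion theorem (proved with products
   of Poisson kernels, the damping factor being exp(-e|xi_i|) in each
   coordinate).  Testing the weak formulation against a countable family of bump
   functions then shows that the density of any solution satisfies the same
   integral equation for almost every (t, xi).  Multiplying by the integrating
   factor exp(-int_0^t psi) identifies it with the Duhamel formula; the product
   and chain rules for primitives of merely integrable functions come from
   increments being quadratic in a monotone continuous function. *)

Require Import Defs.
From mathcomp Require Import all_boot all_order all_algebra.
From mathcomp Require Import all_classical all_reals all_analysis.
From mathcomp.real_closed Require Import complex.
From mathcomp Require Import measurable_realfun ess_sup_inf ring lra.

Set Implicit Arguments.
Unset Strict Implicit.
Unset Printing Implicit Defensive.

Import Order.TTheory GRing.Theory Num.Theory.
Import numFieldNormedType.Exports.

Local Open Scope classical_set_scope.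
Local Open Scope ring_scope.

Local Notation Re := (@complex.Re _).
Local Notation Im := (@complex.Im _).
Local Notation normc := Normc.normc.

(** * Complex-valued integrals *)

Section complex_numbers.
Context {R : realType}.
Implicit Types z w : R[i].

(** The order of quantifiers shapes the argument. The weak formulation holds, for each test
    function, outside a null set of times that depends on it, whereas the scalar equation is solved
    for almost every xi and all t. Countable families (rational boxes, rational times, integer
    radii) merge null sets, and Tonelli exchanges almost every t and almost every xi, once before
    and once after the scalar equation is solved.

    Poisson kernels keep everything explicit: exp(-e|t|) cos(ut) has an elementary antiderivative,
    the mass of the kernel is an arctangent, and a product over the coordinates reduces integrals
    over R^d to integrals over the line.

    Inversion also serves existence. Realizations are tested with inverse transforms of functions in
    D, functionals act on F^-1 D; inversion identifies the two, so that a locally integrable density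
    defines a functional that it realizes.

    Solutions must be functionals at every time, measurable for the weak* Borel sets. Hence the
    default values at negligible times, and the detour through continuity of all pairings. *)

Lemma normc_sqrt z : normc z = Num.sqrt (Re z ^+ 2 + Im z ^+ 2).
Proof. by case: z. Qed.

Lemma normc_ge0 z : 0 <= normc z.
Proof. by rewrite normc_sqrt sqrtr_ge0. Qed.

Lemma normr_Re_le z : `|Re z| <= normc z.
Proof. by rewrite normc_sqrt -sqrtr_sqr ler_sqrt ?lerDl ?addr_ge0 ?sqr_ge0. Qed.

Lemma normr_Im_le z : `|Im z| <= normc z.
Proof. by rewrite normc_sqrt -sqrtr_sqr ler_sqrt ?lerDr ?addr_ge0 ?sqr_ge0. Qed.

Lemma normc_le_ReIm z : normc z <= `|Re z| + `|Im z|.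
Proof.
rewrite normc_sqrt -[leRHS]ger0_norm ?addr_ge0// -sqrtr_sqr ler_sqrt ?sqr_ge0//.
rewrite sqrrD !real_normK ?num_real// -subr_ge0.
rewrite (_ : _ - _ = `|Re z| * `|Im z| *+ 2); last by ring.
by rewrite mulrn_wge0// mulr_ge0.
Qed.

Lemma normc_real (r : R) : normc r%:C%C = `|r|.
Proof. by rewrite normc_sqrt/= expr0n addr0 sqrtr_sqr. Qed.

Lemma normc_eq0 z : (normc z == 0) = (z == 0).
Proof.
apply/eqP/eqP => [/Normc.eq0_normc//|->]; exact: Normc.normc0.
Qed.

Lemma normc_conj z : normc (conjc z) = normc z.
Proof. by case: z => a b /=; rewrite sqrrN. Qed.

Lemma cReM z w : Re (z * w) = Re z * Re w - Im z * Im w.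
Proof. by case: z; case: w. Qed.

Lemma cImM z w : Im (z * w) = Re z * Im w + Im z * Re w.
Proof. by case: z; case: w. Qed.

Lemma cReD z w : Re (z + w) = Re z + Re w. Proof. by case: z; case: w. Qed.
Lemma cImD z w : Im (z + w) = Im z + Im w. Proof. by case: z; case: w. Qed.
Lemma cReN z : Re (- z) = - Re z. Proof. by case: z. Qed.
Lemma cImN z : Im (- z) = - Im z. Proof. by case: z. Qed.
Lemma cRe_conj z : Re (conjc z) = Re z. Proof. by case: z. Qed.
Lemma cIm_conj z : Im (conjc z) = - Im z. Proof. by case: z. Qed.

Lemma complex_ext z w : Re z = Re w -> Im z = Im w -> z = w.
Proof. by case: z; case: w => /= ? ? ? ? -> ->. Qed.

Definition ReIm_simp := (cReM, cImM, cReD, cImD, cReN, cImN, cRe_conj, cIm_conj).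

Lemma cexpD z w : cexp (z + w) = cexp z * cexp w.
Proof.
apply: complex_ext; rewrite !ReIm_simp/= !ReIm_simp expRD.
  by rewrite cosD; ring.
by rewrite sinD; ring.
Qed.

Lemma cexp0 : cexp (0 : R[i]) = 1.
Proof. by apply: complex_ext => /=; rewrite expR0 ?cos0 ?sin0; ring. Qed.

Lemma normc_cexp z : normc (cexp z) = expR (Re z).
Proof.
rewrite normc_sqrt /= !exprMn -mulrDr cos2Dsin2 mulr1 sqrtr_sqr.
by rewrite ger0_norm// expR_ge0.
Qed.

Lemma cexpN z : cexp z * cexp (- z) = 1.
Proof. by rewrite -cexpD subrr cexp0. Qed.

End complex_numbers.

Section complex_measurable.
Context {R : realType} {disp} {X : measurableType disp}.
Implicit Types (D : set X) (f g : X -> R[i]).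

Lemma cmeasurable_cst D (c : R[i]) : cmeasurable_fun D (fun=> c).
Proof. by split; exact: measurable_cst. Qed.

Lemma cmeasurableD D f g : cmeasurable_fun D f -> cmeasurable_fun D g ->
  cmeasurable_fun D (fun x => f x + g x).
Proof.
move=> [f1 f2] [g1 g2]; split.
  rewrite (_ : _ \o _ = (Re \o f) \+ (Re \o g)); last first.
    by apply/funext => x /=; rewrite cReD.
  exact: measurable_funD.
rewrite (_ : _ \o _ = (Im \o f) \+ (Im \o g)); last first.
  by apply/funext => x /=; rewrite cImD.
exact: measurable_funD.
Qed.

Lemma cmeasurableN D f : cmeasurable_fun D f ->
  cmeasurable_fun D (fun x => - f x).
Proof.
move=> [f1 f2]; split.
  rewrite (_ : _ \o _ = \- (Re \o f)); last first.
    by apply/funext => x /=; rewrite cReN.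
  exact: measurable_funN.
rewrite (_ : _ \o _ = \- (Im \o f)); last first.
  by apply/funext => x /=; rewrite cImN.
exact: measurable_funN.
Qed.

Lemma cmeasurableM D f g : cmeasurable_fun D f -> cmeasurable_fun D g ->
  cmeasurable_fun D (fun x => f x * g x).
Proof.
move=> [f1 f2] [g1 g2]; split.
  rewrite (_ : _ \o _ = ((Re \o f) \* (Re \o g)) \- ((Im \o f) \* (Im \o g))).
    by apply: measurable_funB; exact: measurable_funM.
  by apply/funext => x /=; rewrite cReM.
rewrite (_ : _ \o _ = ((Re \o f) \* (Im \o g)) \+ ((Im \o f) \* (Re \o g))).
  by apply: measurable_funD; exact: measurable_funM.
by apply/funext => x /=; rewrite cImM.
Qed.

Lemma cmeasurable_conj D f : cmeasurable_fun D f ->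
  cmeasurable_fun D (fun x => conjc (f x)).
Proof.
move=> [f1 f2]; split.
  rewrite (_ : _ \o _ = Re \o f)//.
  by apply/funext => x /=; rewrite cRe_conj.
rewrite (_ : _ \o _ = \- (Im \o f)); last first.
  by apply/funext => x /=; rewrite cIm_conj.
exact: measurable_funN.
Qed.

Lemma cmeasurable_real D (h : X -> R) : measurable_fun D h ->
  cmeasurable_fun D (fun x => (h x)%:C%C).
Proof. by move=> mh; split => //; exact: measurable_cst. Qed.

Lemma measurable_normc D f : measurable D -> cmeasurable_fun D f ->
  measurable_fun D (fun x => normc (f x)).
Proof.
move=> mD [f1 f2].
rewrite (_ : (fun x => _) = (@Num.sqrt R) \o
  (fun x => Re (f x) ^+ 2 + Im (f x) ^+ 2)); last first.
  by apply/funext => x /=; rewrite normc_sqrt.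
apply: measurableT_comp; last first.
  by apply: measurable_funD; apply: measurable_funX.
apply: continuous_measurable_fun; exact: sqrt_continuous.
Qed.

Lemma cmeasurable_cexp D f : measurable D -> cmeasurable_fun D f ->
  cmeasurable_fun D (fun x => cexp (f x)).
Proof.
move=> mD [f1 f2]; split => /=; apply: measurable_funM.
- by apply: measurableT_comp => //; exact: measurable_expR.
- apply: measurableT_comp => //; apply: continuous_measurable_fun.
  exact: continuous_cos.
- by apply: measurableT_comp => //; exact: measurable_expR.
- apply: measurableT_comp => //; apply: continuous_measurable_fun.
  exact: continuous_sin.
Qed.

Lemma cmeasurable_comp {disp'} {Y : measurableType disp'} (E : set Y)
    (D : set X) f (h : Y -> X) :
  measurable D -> h @` E `<=` D -> cmeasurable_fun D f -> measurable_fun E h ->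
  cmeasurable_fun E (f \o h).
Proof.
by move=> mD ED [f1 f2] mh; split;
  [apply: (measurable_comp mD ED f1)|apply: (measurable_comp mD ED f2)].
Qed.

Lemma cmeasurableS D (E : set X) f : measurable E -> D `<=` E ->
  cmeasurable_fun E f -> cmeasurable_fun D f.
Proof.
by move=> mE DE [f1 f2]; split; exact: measurable_funS DE _.
Qed.

Lemma cmeasurable_patch D f : measurable D -> cmeasurable_fun D f <->
  cmeasurable_fun setT (patch (fun=> 0) D f).
Proof.
move=> mD.
have rE : Re \o patch (fun=> 0) D f = (Re \o f) \_ D.
  by apply/funext => x; rewrite /patch/=; case: ifP.
have iE : Im \o patch (fun=> 0) D f = (Im \o f) \_ D.
  by apply/funext => x; rewrite /patch/=; case: ifP.
rewrite /cmeasurable_fun rE iE.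
by split => -[h1 h2]; split; exact/(measurable_restrictT _ mD).
Qed.

Lemma eq_cmeasurable D f g : {in D, f =1 g} -> cmeasurable_fun D f ->
  cmeasurable_fun D g.
Proof.
move=> fg [f1 f2]; split.
  by apply: eq_measurable_fun f1 => x xD /=; rewrite fg.
by apply: eq_measurable_fun f2 => x xD /=; rewrite fg.
Qed.

End complex_measurable.

Section real_integrable.
Context {R : realType} {disp} {X : measurableType disp}.
Variables (mu : {measure set X -> \bar R}) (D : set X).
Hypothesis mD : measurable D.
Implicit Types f g : X -> R.

Lemma integrable_addR f g : mu.-integrable D (EFin \o f) ->
  mu.-integrable D (EFin \o g) -> mu.-integrable D (EFin \o (fun x => f x + g x)).
Proof. exact: integrableD. Qed.

Lemma integrable_subR f g : mu.-integrable D (EFin \o f) ->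
  mu.-integrable D (EFin \o g) -> mu.-integrable D (EFin \o (fun x => f x - g x)).
Proof. exact: integrableB. Qed.

Lemma integrable_scaleR c f : mu.-integrable D (EFin \o f) ->
  mu.-integrable D (EFin \o (fun x => c * f x)).
Proof. exact: integrableZl. Qed.

Lemma integrable_bounded_mul (M : R) f g : measurable_fun D f ->
  (forall x, D x -> `|f x| <= M) -> mu.-integrable D (EFin \o g) ->
  mu.-integrable D (EFin \o (fun x => f x * g x)).
Proof.
move=> mf fM ig; apply: (@integrableMr _ _ _ mu D mD f (EFin \o g)) => //.
exists M; split; first exact: num_real.
by move=> N MN x Dx /=; apply: le_trans (fM _ Dx) (ltW MN).
Qed.

Lemma integrable_patchR f : mu.-integrable D (EFin \o f) <->
  mu.-integrable setT (EFin \o (f \_ D)).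
Proof. by rewrite -restrict_EFin; exact: integrable_mkcond. Qed.

End real_integrable.

Section complex_integral.
Context {R : realType} {disp} {X : measurableType disp}.
Variable mu : {measure set X -> \bar R}.
Implicit Types (D : set X) (f g : X -> R[i]).

Lemma cintegrable_cmeasurable D f : cintegrable mu D f -> cmeasurable_fun D f.
Proof.
by move=> [] /measurable_int/measurable_EFinP f1 /measurable_int/measurable_EFinP.
Qed.

Lemma cintegrable_le D f (g : X -> R) : measurable D -> cmeasurable_fun D f ->
  mu.-integrable D (EFin \o g) -> (forall x, D x -> normc (f x) <= g x) ->
  cintegrable mu D f.
Proof.
move=> mD [f1 f2] ig fg; split; apply: (le_integrable mD _ _ ig).
- exact/measurable_EFinP.
- move=> x Dx /=; rewrite lee_fin (le_trans (normr_Re_le _))//.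
  by rewrite (le_trans (fg _ Dx))// ler_norm.
- exact/measurable_EFinP.
- move=> x Dx /=; rewrite lee_fin (le_trans (normr_Im_le _))//.
  by rewrite (le_trans (fg _ Dx))// ler_norm.
Qed.

Lemma cintegrable_normc D f : measurable D -> cintegrable mu D f ->
  mu.-integrable D (EFin \o (fun x => normc (f x))).
Proof.
move=> mD if_; have [mf1 mf2] := cintegrable_cmeasurable if_.
case: if_ => /integrable_norm f1 /integrable_norm f2.
apply: (le_integrable mD _ _ (integrableD mD f1 f2)).
  by apply/measurable_EFinP; exact: measurable_normc.
move=> x Dx /=; rewrite lee_fin ger0_norm ?normc_ge0//.
by rewrite (le_trans (normc_le_ReIm _))// ler_norm.
Qed.

Lemma cintegrableP D f : measurable D -> cintegrable mu D f <->
  cmeasurable_fun D f /\ (\int[mu]_(x in D) (normc (f x))%:E < +oo)%E.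
Proof.
move=> mD; split=> [if_|[mf foo]].
  split; first exact: cintegrable_cmeasurable.
  have /integrableP[_] := cintegrable_normc mD if_.
  apply: le_lt_trans; apply: ge0_le_integral => //.
  - by move=> x _; rewrite lee_fin normc_ge0.
  - apply/measurable_EFinP/measurable_normc => //.
    exact: cintegrable_cmeasurable if_.
  - apply/measurable_EFinP; apply: measurableT_comp => //.
    by apply: measurable_normc => //; exact: cintegrable_cmeasurable if_.
  - by move=> x _ /=; rewrite lee_fin ler_norm.
apply: (@cintegrable_le _ _ (fun x => normc (f x))) => //.
apply/integrableP; split.
  by apply/measurable_EFinP; exact: measurable_normc.
rewrite (eq_integral (fun x => (normc (f x))%:E))// => x _ /=.
by rewrite ger0_norm// normc_ge0.
Qed.

Lemma cintegrableD D f g : measurable D -> cintegrable mu D f ->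
  cintegrable mu D g -> cintegrable mu D (fun x => f x + g x).
Proof.
move=> mD if_ ig; apply: (@cintegrable_le _ _ (fun x => normc (f x) + normc (g x))) => //.
- by apply: cmeasurableD; exact: cintegrable_cmeasurable.
- by apply: (@integrableD _ _ _ mu D mD (EFin \o _) (EFin \o _)); exact: cintegrable_normc.
- by move=> x _; exact: le_normcD.
Qed.

Lemma cintegrableZ D f (c : R[i]) : measurable D -> cintegrable mu D f ->
  cintegrable mu D (fun x => c * f x).
Proof.
move=> mD if_; apply: (@cintegrable_le _ _ (fun x => normc c * normc (f x))) => //.
- by apply: cmeasurableM; [exact: cmeasurable_cst|exact: cintegrable_cmeasurable].
- rewrite (_ : EFin \o _ = (fun x => (normc c)%:E * (EFin \o (fun x => normc (f x))) x)%E).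
    by apply: integrableZl => //; exact: cintegrable_normc.
  by apply/funext => x /=; rewrite EFinM.
- by move=> x _; rewrite Normc.normcM.
Qed.

Lemma cintegralD D f g : measurable D -> cintegrable mu D f ->
  cintegrable mu D g ->
  cintegral mu D (fun x => f x + g x) = cintegral mu D f + cintegral mu D g.
Proof.
move=> mD [f1 f2] [g1 g2]; apply: complex_ext; rewrite !ReIm_simp /=.
  by rewrite -RintegralD//; apply: eq_Rintegral => x _; rewrite cReD.
by rewrite -RintegralD//; apply: eq_Rintegral => x _; rewrite cImD.
Qed.

Lemma cintegralZ D f (c : R[i]) : measurable D -> cintegrable mu D f ->
  cintegral mu D (fun x => c * f x) = c * cintegral mu D f.
Proof.
move=> mD [f1 f2].
have iZ (a : R) (h : X -> R) : mu.-integrable D (EFin \o h) ->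
    mu.-integrable D (EFin \o (fun x => a * h x)).
  move=> ih; rewrite (_ : EFin \o _ = (fun x => a%:E * (EFin \o h) x)%E).
    exact: integrableZl.
  by apply/funext.
apply: complex_ext; rewrite !ReIm_simp /=.
  rewrite -!RintegralZl// -RintegralB//; [|exact: iZ..].
  by apply: eq_Rintegral => x _; rewrite cReM.
rewrite -!RintegralZl// -RintegralD//; [|exact: iZ..].
by apply: eq_Rintegral => x _; rewrite cImM.
Qed.

Lemma cintegralN D f : measurable D -> cintegrable mu D f ->
  cintegral mu D (fun x => - f x) = - cintegral mu D f.
Proof.
move=> mD if_; rewrite -mulN1r -cintegralZ//.
by congr cintegral; apply/funext => x; rewrite mulN1r.
Qed.

Lemma cintegrableN D f : measurable D -> cintegrable mu D f ->
  cintegrable mu D (fun x => - f x).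
Proof.
move=> mD if_; rewrite (_ : (fun x => - f x) = (fun x => (-1) * f x)).
  exact: cintegrableZ.
by apply/funext => x; rewrite mulN1r.
Qed.

Lemma cintegralB D f g : measurable D -> cintegrable mu D f ->
  cintegrable mu D g ->
  cintegral mu D (fun x => f x - g x) = cintegral mu D f - cintegral mu D g.
Proof.
by move=> mD if_ ig; rewrite cintegralD// ?cintegralN//; exact: cintegrableN.
Qed.

Lemma eq_cintegral D f g : {in D, f =1 g} ->
  cintegral mu D f = cintegral mu D g.
Proof.
by move=> fg; apply: complex_ext => /=; apply: eq_Rintegral => x xD; rewrite fg.
Qed.

Lemma ae_eq_cintegral D f g : measurable D -> cmeasurable_fun D f ->
  cmeasurable_fun D g -> {ae mu, forall x, D x -> f x = g x} ->
  cintegral mu D f = cintegral mu D g.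
Proof.
move=> mD [f1 f2] [g1 g2] fg; apply: complex_ext => /=; rewrite /Rintegral;
  congr fine; apply: ae_eq_integral => //; try exact/measurable_EFinP;
  by apply: filterS fg => x /= fg Dx; rewrite fg.
Qed.

Lemma ae_eq_cintegrable D f g : measurable D -> cmeasurable_fun D g ->
  {ae mu, forall x, D x -> f x = g x} -> cintegrable mu D f ->
  cintegrable mu D g.
Proof.
move=> mD mg fg if_; have mf := cintegrable_cmeasurable if_.
move: if_ => /(cintegrableP _ mD)[_ foo].
apply/(cintegrableP _ mD); split => //.
rewrite (@ae_eq_integral _ _ _ mu D (fun x => (normc (f x))%:E))//.
- by apply/measurable_EFinP; exact: measurable_normc.
- by apply/measurable_EFinP; exact: measurable_normc.
- by apply: filterS fg => x /= fg Dx; rewrite fg.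
Qed.

Lemma cintegral_mkcond D f :
  cintegral mu D f = cintegral mu setT (patch (fun=> 0) D f).
Proof.
rewrite /cintegral; congr Complex; rewrite Rintegral_mkcond; congr Rintegral;
  apply/funext => x; rewrite /patch; by case: ifP.
Qed.

Lemma cintegrable_mkcond D f : measurable D ->
  cintegrable mu D f <-> cintegrable mu setT (patch (fun=> 0) D f).
Proof.
move=> mD; rewrite /cintegrable.
have rE : (EFin \o (Re \o patch (fun=> 0) D f)) = (EFin \o (Re \o f)) \_ D.
  by apply/funext => x; rewrite /patch/=; case: ifP.
have iE : (EFin \o (Im \o patch (fun=> 0) D f)) = (EFin \o (Im \o f)) \_ D.
  by apply/funext => x; rewrite /patch/=; case: ifP.
rewrite rE iE; split=> -[h1 h2]; split; try exact/(integrable_mkcond _ mD).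
Qed.

(* The factor 2 comes from treating real and imaginary parts separately; the
   sharp inequality is never needed. *)
Lemma le_normc_cintegral D f : measurable D -> cintegrable mu D f ->
  normc (cintegral mu D f) <= 2 * \int[mu]_(x in D) normc (f x).
Proof.
move=> mD if_; have := if_ => -[f1 f2].
rewrite (le_trans (normc_le_ReIm _))//= mulr_natl mulr2n lerD//.
  rewrite (le_trans (le_normr_Rintegral mD f1))//.
  apply: le_Rintegral => //; first exact: (integrable_norm f1).
    exact: cintegrable_normc.
  by move=> x _; exact: normr_Re_le.
rewrite (le_trans (le_normr_Rintegral mD f2))//.
apply: le_Rintegral => //; first exact: (integrable_norm f2).
  exact: cintegrable_normc.
by move=> x _; exact: normr_Im_le.
Qed.

Lemma le_normc_cintegral_le D f (h : X -> R) : measurable D ->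
  cmeasurable_fun D f -> mu.-integrable D (EFin \o h) ->
  (forall x, D x -> normc (f x) <= h x) ->
  normc (cintegral mu D f) <= 2 * \int[mu]_(x in D) h x.
Proof.
move=> mD mf ih fh; have if_ := cintegrable_le mD mf ih fh.
rewrite (le_trans (le_normc_cintegral mD if_))// ler_wpM2l//.
by apply: le_Rintegral => //; exact: cintegrable_normc.
Qed.

Lemma cintegrableS D (E : set X) f : measurable D -> measurable E -> D `<=` E ->
  cintegrable mu E f -> cintegrable mu D f.
Proof. by move=> mD mE DE [f1 f2]; split; exact: integrableS DE _. Qed.

End complex_integral.

Section complex_fubini.
Context {R : realType} {d1 d2} {X : measurableType d1} {Y : measurableType d2}.
Variables (m1 : {sigma_finite_measure set X -> \bar R})
  (m2 : {sigma_finite_measure set Y -> \bar R}).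
Variable F : X * Y -> R[i].
Hypothesis iF : cintegrable (m1 \x m2)%E setT F.

(** The inner integral is finite for almost every x only, and [Rintegral] sends infinite values to
    0; the real and the extended iterated integrals therefore have inner integrals that agree up to
    a null set. *)
Let real_prod12 (h : X * Y -> R) : (m1 \x m2)%E.-integrable setT (EFin \o h) ->
  \int[(m1 \x m2)%E]_z h z = \int[m1]_x \int[m2]_y h (x, y).
Proof.
move=> ih; rewrite /Rintegral -(integral12_prod_meas1 ih) /fubini_F.
congr fine; apply: ae_eq_integral => //.
- exact: (measurable_fubini_F ih).
- apply/measurable_EFinP; apply: (measurable_comp measurableT) => //.
  exact: (measurable_fubini_F ih).
- apply: filterS (ae_integrable1 ih) => x ix _ /=.
  by rewrite fineK//; exact: integrable_fin_num.
Qed.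

Let real_prod21 (h : X * Y -> R) : (m1 \x m2)%E.-integrable setT (EFin \o h) ->
  \int[(m1 \x m2)%E]_z h z = \int[m2]_y \int[m1]_x h (x, y).
Proof.
move=> ih; rewrite /Rintegral -(integral21_prod_meas1 ih) /fubini_G.
congr fine; apply: ae_eq_integral => //.
- exact: (measurable_fubini_G ih).
- apply/measurable_EFinP; apply: (measurable_comp measurableT) => //.
  exact: (measurable_fubini_G ih).
- apply: filterS (ae_integrable2 ih) => x ix _ /=.
  by rewrite fineK//; exact: integrable_fin_num.
Qed.

Lemma cintegral_prod12 : cintegral (m1 \x m2)%E setT F =
  cintegral m1 setT (fun x => cintegral m2 setT (fun y => F (x, y))).
Proof.
by have [F1 F2] := iF; apply: complex_ext => /=;
  [exact: (real_prod12 F1)|exact: (real_prod12 F2)].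
Qed.

Lemma cintegral_prod21 : cintegral (m1 \x m2)%E setT F =
  cintegral m2 setT (fun y => cintegral m1 setT (fun x => F (x, y))).
Proof.
by have [F1 F2] := iF; apply: complex_ext => /=;
  [exact: (real_prod21 F1)|exact: (real_prod21 F2)].
Qed.

Lemma cFubini : cintegral m1 setT (fun x => cintegral m2 setT (fun y => F (x, y)))
  = cintegral m2 setT (fun y => cintegral m1 setT (fun x => F (x, y))).
Proof. by rewrite -cintegral_prod12 cintegral_prod21. Qed.

Let real_int1 (h : X * Y -> R) : (m1 \x m2)%E.-integrable setT (EFin \o h) ->
  m1.-integrable setT (EFin \o (fun x => \int[m2]_y h (x, y))) .
Proof.
move=> ih; have := integrable_fubini_F ih; rewrite /fubini_F => iFF.
apply/integrableP; split.
  apply/measurable_EFinP; apply: (measurable_comp measurableT) => //.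
  exact: (measurable_fubini_F ih).
have /integrableP[_] := iFF; apply: le_lt_trans; apply: ge0_le_integral => //.
- apply/measurable_EFinP; apply: measurableT_comp => //.
  apply: (measurable_comp measurableT) => //.
  exact: (measurable_fubini_F ih).
- by apply: measurableT_comp => //; exact: (measurable_fubini_F ih).
- move=> x _; rewrite /Rintegral/=.
  by case: (\int[m2]_y _)%E => //=; rewrite ?normr0 ?leey.
Qed.

Let real_int2 (h : X * Y -> R) : (m1 \x m2)%E.-integrable setT (EFin \o h) ->
  m2.-integrable setT (EFin \o (fun y => \int[m1]_x h (x, y))) .
Proof.
move=> ih; have mG := measurable_fubini_G ih.
apply/integrableP; split.
  by apply/measurable_EFinP; exact: (measurable_comp measurableT).
have mh : measurable_fun setT (EFin \o h) := measurable_int _ ih.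
have := (@integrable21ltyP _ _ _ _ _ m1 m2 _ mh).1 ih; apply: le_lt_trans.
apply: ge0_le_integral => //.
- by apply/measurable_EFinP; do 2 apply: (measurable_comp measurableT) => //.
- apply: (@measurable_fun_fubini_tonelli_G _ _ _ _ _ m1 (abse \o (EFin \o h))).
    exact: measurableT_comp.
  by move=> z; exact: abse_ge0.
- move=> y _; apply: (@le_trans _ _ `|\int[m1]_x (h (x, y))%:E|%E).
    rewrite /Rintegral/=.
    by case: (\int[m1]_x _)%E => //=; rewrite ?normr0 ?leey.
  apply: le_abse_integral => //; apply: (measurableT_comp mh).
  by apply: measurable_fun_pair => //; exact: measurable_cst.
Qed.

Lemma cintegrable_section1 :
  cintegrable m1 setT (fun x => cintegral m2 setT (fun y => F (x, y))).
Proof. by have [F1 F2] := iF; split; [exact: (real_int1 F1)|exact: (real_int1 F2)]. Qed.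

Lemma cintegrable_section2 :
  cintegrable m2 setT (fun y => cintegral m1 setT (fun x => F (x, y))).
Proof. by have [F1 F2] := iF; split; [exact: (real_int2 F1)|exact: (real_int2 F2)]. Qed.

Lemma ae_cintegrable1 : {ae m1, forall x, cintegrable m2 setT (fun y => F (x, y))}.
Proof.
have [F1 F2] := iF; near=> x; split.
  by near: x; exact: (ae_integrable1 F1).
by near: x; exact: (ae_integrable1 F2).
Unshelve. all: by end_near. Qed.

Lemma ae_cintegrable2 : {ae m2, forall y, cintegrable m1 setT (fun x => F (x, y))}.
Proof.
have [F1 F2] := iF; near=> x; split.
  by near: x; exact: (ae_integrable2 F1).
by near: x; exact: (ae_integrable2 F2).
Unshelve. all: by end_near. Qed.

End complex_fubini.

Lemma cintegrable_prod {R : realType} {d1 d2} {X : measurableType d1}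
    {Y : measurableType d2} (m1 : {sigma_finite_measure set X -> \bar R})
    (m2 : {sigma_finite_measure set Y -> \bar R}) (F : X * Y -> R[i]) :
  cmeasurable_fun setT F ->
  (\int[m1]_x \int[m2]_y (normc (F (x, y)))%:E < +oo)%E ->
  cintegrable (m1 \x m2)%E setT F.
Proof.
move=> mF Foo; apply/cintegrableP => //; split => //.
rewrite fubini_tonelli1//.
- by apply/measurable_EFinP; exact: measurable_normc.
- by move=> z; rewrite lee_fin normc_ge0.
Qed.

(** * Lebesgue measure on row vectors *)

Section boxes.
Context {R : realType} {d : nat}.
Local Notation Rd := 'rV[R]_d.
Local Notation leb := (lebesgue_rV R d).

Lemma ball_rVE (x : Rd) (e : R) (y : Rd) : 0 < e ->
  ball x e y <-> forall i, `|x ord0 i - y ord0 i| < e.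
Proof.
move=> e0; split=> [[_ h] i|h]; first exact: h.
by split=> // i j; rewrite ord1; exact: h.
Qed.

Lemma coord_cts (i : 'I_d) : continuous (fun x : Rd => x ord0 i).
Proof. by move=> x; exact: coord_continuous. Qed.

Definition box (a b : Rd) : set Rd :=
  [set x | forall i, a ord0 i < x ord0 i < b ord0 i].

Definition cbox (a b : Rd) : set Rd :=
  [set x | forall i, a ord0 i <= x ord0 i <= b ord0 i].

Lemma box_sub_cbox a b : box a b `<=` cbox a b.
Proof. by move=> x xab i; have /andP[h1 h2] := xab i; rewrite !ltW. Qed.

Lemma compact_cbox a b : compact (cbox a b).
Proof.
rewrite (_ : cbox a b = [set v : Rd | forall i,
  (fun i => `[a ord0 i, b ord0 i]%classic) i (v ord0 i)]); last first.
  by apply/seteqP; split=> x h i; have := h i; rewrite /= in_itv.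
apply: (@rV_compact R d (fun i => `[a ord0 i, b ord0 i]%classic)) => i.
exact: segment_compact.
Qed.

Lemma closed_cbox a b : closed (cbox a b).
Proof. by apply: compact_closed; [exact: norm_hausdorff|exact: compact_cbox]. Qed.

Lemma measurable_prod_rV (A : 'I_d -> set R) : (forall i, measurable (A i)) ->
  measurable [set x : Rd | forall i, A i (x ord0 i)].
Proof.
move=> mA; rewrite (_ : mkset _ =
  \bigcap_(i in [set: 'I_d]) ((fun x : Rd => x ord0 i) @^-1` A i)); last first.
  by apply/seteqP; split=> x h i; [move=> _; exact: h|exact: h].
apply: fin_bigcap_measurable; first exact: finite_finset.
by move=> i _; rewrite -[X in measurable X]setTI; exact: measurable_rV_coord.
Qed.

Lemma boxE a b : box a b = [set x : Rd | forall i,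
  (fun i => `]a ord0 i, b ord0 i[%classic) i (x ord0 i)].
Proof. by apply/seteqP; split=> x h i; have := h i; rewrite /= in_itv. Qed.

Lemma cboxE a b : cbox a b = [set x : Rd | forall i,
  (fun i => `[a ord0 i, b ord0 i]%classic) i (x ord0 i)].
Proof. by apply/seteqP; split=> x h i; have := h i; rewrite /= in_itv. Qed.

Lemma measurable_box a b : measurable (box a b).
Proof. by rewrite boxE; apply: (measurable_prod_rV (A := fun i => `]a ord0 i, b ord0 i[%classic)). Qed.

Lemma measurable_cbox a b : measurable (cbox a b).
Proof. by rewrite cboxE; apply: (measurable_prod_rV (A := fun i => `[a ord0 i, b ord0 i]%classic)). Qed.

Local Notation Qbox := ('rV[rat]_d * 'rV[rat]_d)%type.

(** Boxes with rational corners form a countable base of the topology, over which almost-everywhere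
    statements can be merged. *)
Definition rlo (q : Qbox) : Rd := map_mx ratr q.1.
Definition rhi (q : Qbox) : Rd := map_mx ratr q.2.
Definition rbox (q : Qbox) : set Rd := box (rlo q) (rhi q).
Definition crbox (q : Qbox) : set Rd := cbox (rlo q) (rhi q).

Lemma rbox_nbhs (U : set Rd) x : nbhs x U ->
  exists q : Qbox, rbox q x /\ crbox q `<=` U.
Proof.
move=> /nbhs_ballP[e /= e0 xeU].
have [q1 q1P] : {q1 : 'I_d -> rat & forall i, ratr (q1 i) \in `](x ord0 i - e), (x ord0 i)[}.
  apply: (@choice _ _ (fun i q => ratr q \in `](x ord0 i - e), (x ord0 i)[)) => i.
  by apply: rat_in_itvoo; rewrite ltrBlDr ltrDl.
have [q2 q2P] : {q2 : 'I_d -> rat & forall i, ratr (q2 i) \in `](x ord0 i), (x ord0 i + e)[}.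
  apply: (@choice _ _ (fun i q => ratr q \in `](x ord0 i), (x ord0 i + e)[)) => i.
  by apply: rat_in_itvoo; rewrite ltrDl.
exists (\row_i q1 i, \row_i q2 i); split.
  move=> i; rewrite !mxE.
  by have := q1P i; have := q2P i; rewrite !in_itv/= => /andP[-> _] /andP[_ ->].
move=> y yq; apply: xeU; apply/ball_rVE => // i.
have := yq i; rewrite !mxE /= => /andP[h1 h2].
have := q1P i; have := q2P i; rewrite !in_itv/= => /andP[h3 h4] /andP[h5 h6].
by rewrite ltr_norml; apply/andP; split; lra.
Qed.

(** Only boxes whose closed box lies in U are taken: local integrability on U speaks of compact
    subsets, and a bump supported in such a box is a test function on U. *)
Lemma open_bigcup_rbox (U : set Rd) : open U ->
  U = \bigcup_(q in [set q | crbox q `<=` U]) rbox q.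
Proof.
move=> oU; apply/seteqP; split=> [x Ux|x [q /= qU qx]]; last first.
  exact/qU/box_sub_cbox.
have [q [qx qU]] : exists q : Qbox, rbox q x /\ crbox q `<=` U.
  by apply: rbox_nbhs; exact: open_nbhs_nbhs.
by exists q.
Qed.

Lemma bigcup_Qbox_measurable (P : set Qbox) (F : Qbox -> set Rd) :
  (forall q, measurable (F q)) -> measurable (\bigcup_(q in P) F q).
Proof.
move=> mF; rewrite bigcup_mkcond; apply: countable_bigcupT_measurable => //.
by move=> q; case: ifP => // _; exact: measurable0.
Qed.

(** The sigma-algebra on row vectors is generated by the coordinates; countability of the rational
    boxes is what puts open sets into it. *)
Lemma open_measurable_rV (U : set Rd) : open U -> measurable U.
Proof.
move=> oU; rewrite (open_bigcup_rbox oU); apply: bigcup_Qbox_measurable => q.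
exact: measurable_box.
Qed.

Lemma closed_measurable_rV (U : set Rd) : closed U -> measurable U.
Proof.
move=> cU; rewrite -[U]setCK; apply: measurableC; apply: open_measurable_rV.
exact: closed_openC.
Qed.

Lemma compact_measurable_rV (K : set Rd) : compact K -> measurable K.
Proof.
move=> cK; apply: closed_measurable_rV; exact: compact_closed.
Qed.

Lemma continuous_measurable_rV (g : Rd -> R) : continuous g ->
  measurable_fun setT g.
Proof.
move=> cg; apply: (measurability _ (RGenOpens.measurableE R)).
move=> _ [_ [a [b ->]] <-]; rewrite setTI; apply: open_measurable_rV.
by apply: open_comp; [move=> x _; exact: cg|exact: interval_open].
Qed.

Lemma compact_sub_cbox (K : set Rd) : compact K ->
  exists n : nat, K `<=` cbox (const_mx (- n%:R)) (const_mx n%:R).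
Proof.
move=> /compact_bounded[M [_ Mb]].
exists (Num.truncn (`|M| + 1)).+1 => x Kx i; rewrite !mxE -ler_norml.
have := Mb (`|M| + 1).
have : M < `|M| + 1 by rewrite (le_lt_trans (ler_norm _))// ltrDl.
move=> /[swap] /[apply] /(_ x Kx).
rewrite [X in X <= _ -> _]/Num.norm /= mx_normrE => /bigmax_leP[_ /(_ (ord0, i) isT) /= h].
by rewrite (le_trans h)// ltW// truncnS_gt.
Qed.

End boxes.
Arguments rbox R {d} q.
Arguments crbox R {d} q.

Section lebesgue_rV_integral.
Context {R : realType}.
Local Notation mu := (@lebesgue_measure R).

Lemma measurable_rV_consR n : measurable_fun [set: measurableTypeR R * 'rV[R]_n]
  (@rV_cons R n : measurableTypeR R * 'rV[R]_n -> 'rV[R]_n.+1).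
Proof. exact: measurable_rV_cons. Qed.

Lemma lebesgue_rVS n (A : set 'rV[R]_n.+1) :
  lebesgue_rV R n.+1 A = (mu \x lebesgue_rV R n)%E (rV_cons @^-1` A).
Proof. by []. Qed.

Lemma lebesgue_rV_prod n (A : 'I_n -> set R) (c : 'I_n -> R) :
  (forall i, measurable (A i)) -> (forall i, mu (A i) = (c i)%:E) ->
  lebesgue_rV R n [set x : 'rV[R]_n | forall i, A i (x ord0 i)] =
    (\prod_(i < n) c i)%:E.
Proof.
elim: n A c => [|n IH] A c mA muA.
  rewrite big_ord0 /lebesgue_rV/= /dirac indicE mem_set//=; by case.
rewrite lebesgue_rVS (_ : _ @^-1` _ = A ord0 `*`
    [set x : 'rV[R]_n | forall i, A (lift ord0 i) (x ord0 i)]); last first.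
  apply/seteqP; split=> [[x v] /= h|[x v] /= [h1 h2] i].
    split; first by have := h ord0; rewrite mxE unlift_none.
    by move=> i; have := h (lift ord0 i); rewrite mxE liftK.
  by rewrite mxE; have [j ->|->] := unliftP ord0 i.
rewrite product_measure1E; [|exact: mA|]; last first.
  exact: (@measurable_prod_rV _ n (fun i => A (lift ord0 i))).
rewrite [X in (_ * X)%E](IH (fun i => A (lift ord0 i)) (fun i => c (lift ord0 i)))//.
by rewrite [X in (X * _)%E]muA big_ord_recl -EFinM.
Qed.

Lemma lebesgue_cbox_lty n (a b : 'rV[R]_n) : (lebesgue_rV R n (cbox a b) < +oo)%E.
Proof.
rewrite cboxE (@lebesgue_rV_prod _ (fun i => `[a ord0 i, b ord0 i]%classic)
  (fun i => fine (mu `[a ord0 i, b ord0 i]%classic)))//.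
  by rewrite ltry.
move=> i; rewrite fineK//= lebesgue_measure_itv/=.
by case: ifP.
Qed.

Lemma compact_lebesgue_lty n (K : set 'rV[R]_n) : compact K ->
  (lebesgue_rV R n K < +oo)%E.
Proof.
move=> cK; have [N KN] := compact_sub_cbox cK.
apply: le_lt_trans (lebesgue_cbox_lty (const_mx (- N%:R)) (const_mx N%:R)).
apply: le_measure => //; rewrite inE; first exact: compact_measurable_rV.
exact: measurable_cbox.
Qed.

Lemma ge0_integral_rVS n (f : 'rV[R]_n.+1 -> \bar R) : measurable_fun setT f ->
  (forall x, 0 <= f x)%E ->
  (\int[lebesgue_rV R n.+1]_x f x =
   \int[mu]_x \int[lebesgue_rV R n]_v f (rV_cons (x, v)))%E.
Proof.
move=> mf f0.
transitivity (\int[pushforward (mu \x lebesgue_rV R n)%E (@rV_cons R n)]_x f x)%E.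
  by [].
rewrite (@ge0_integral_pushforward _ _ _ _ R _ (@measurable_rV_consR n)
  (mu \x lebesgue_rV R n)%E setT f measurableT mf (fun x _ => f0 x)).
rewrite preimage_setT fubini_tonelli1//.
  by apply: measurableT_comp => //; exact: measurable_rV_consR.
by move=> z /=; exact: f0.
Qed.

Lemma cintegrable_rVS n (f : 'rV[R]_n.+1 -> R[i]) :
  cintegrable (lebesgue_rV R n.+1) setT f ->
  cintegrable (mu \x lebesgue_rV R n)%E setT (f \o rV_cons).
Proof.
move=> /cintegrableP-/(_ measurableT)[mf foo].
have mfc : cmeasurable_fun setT (f \o @rV_cons R n).
  by apply: (cmeasurable_comp measurableT _ mf) => //; exact: measurable_rV_consR.
apply: cintegrable_prod => //.
move: foo; rewrite ge0_integral_rVS//.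
- by apply/measurable_EFinP; exact: measurable_normc.
- by move=> z; rewrite lee_fin normc_ge0.
Qed.

Lemma cintegral_rVS n (f : 'rV[R]_n.+1 -> R[i]) :
  cintegrable (lebesgue_rV R n.+1) setT f ->
  cintegral (lebesgue_rV R n.+1) setT f =
  cintegral (mu \x lebesgue_rV R n)%E setT (f \o rV_cons).
Proof.
move=> if_; have [f1 f2] := if_; have [g1 g2] := cintegrable_rVS if_.
have push (h : 'rV[R]_n.+1 -> R) :
    (lebesgue_rV R n.+1).-integrable setT (EFin \o h) ->
    (mu \x lebesgue_rV R n)%E.-integrable setT (EFin \o (h \o rV_cons)) ->
    \int[lebesgue_rV R n.+1]_x h x =
    \int[(mu \x lebesgue_rV R n)%E]_x (h \o rV_cons) x.
  move=> ih ihc; rewrite /Rintegral; congr fine.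
  transitivity (\int[pushforward (mu \x lebesgue_rV R n)%E (@rV_cons R n)]_x
    (h x)%:E)%E; first by [].
  exact: (@integral_pushforward _ _ _ _ R _ (@measurable_rV_consR n)
    (mu \x lebesgue_rV R n)%E setT _ (measurable_int _ ih) ihc measurableT).
by apply: complex_ext; [exact: (push (Re \o f))|exact: (push (Im \o f))].
Qed.

Lemma cintegral_rVS12 n (f : 'rV[R]_n.+1 -> R[i]) :
  cintegrable (lebesgue_rV R n.+1) setT f ->
  cintegral (lebesgue_rV R n.+1) setT f =
  cintegral mu setT (fun x => cintegral (lebesgue_rV R n) setT
    (fun v => f (rV_cons (x, v)))).
Proof.
move=> if_; rewrite cintegral_rVS//.
by rewrite (cintegral_prod12 (cintegrable_rVS if_)).
Qed.

Lemma cintegral_rVS21 n (f : 'rV[R]_n.+1 -> R[i]) :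
  cintegrable (lebesgue_rV R n.+1) setT f ->
  cintegral (lebesgue_rV R n.+1) setT f =
  cintegral (lebesgue_rV R n) setT (fun v => cintegral mu setT
    (fun x => f (rV_cons (x, v)))).
Proof.
move=> if_; rewrite cintegral_rVS//.
by rewrite (cintegral_prod21 (cintegrable_rVS if_)).
Qed.

Lemma rV_cons0 n (x : R) (v : 'rV[R]_n) : rV_cons (x, v) ord0 ord0 = x.
Proof. by rewrite mxE unlift_none. Qed.

Lemma rV_consS n (x : R) (v : 'rV[R]_n) i :
  rV_cons (x, v) ord0 (lift ord0 i) = v ord0 i.
Proof. by rewrite mxE liftK. Qed.

Lemma measurable_prodr n (k : 'I_n -> R -> R) :
  (forall i, measurable_fun [set: measurableTypeR R] (k i)) ->
  measurable_fun setT (fun x : 'rV[R]_n => \prod_(i < n) k i (x ord0 i)).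
Proof.
move=> mk; apply: measurable_prod => i _.
by apply: (measurableT_comp (mk i)); exact: (measurable_rV_coord i).
Qed.

(** Tonelli, one coordinate at a time. The one-dimensional integrals are taken to be real numbers,
    so that their product raises no question of zero times infinity. *)
Lemma integral_prod_rV n (k : 'I_n -> R -> R) (c : 'I_n -> R) :
  (forall i, measurable_fun [set: measurableTypeR R] (k i)) -> (forall i x, 0 <= k i x) ->
  (forall i, \int[mu]_x (k i x)%:E = (c i)%:E)%E ->
  (\int[lebesgue_rV R n]_x (\prod_(i < n) k i (x ord0 i))%:E =
    (\prod_(i < n) c i)%:E)%E.
Proof.
elim: n k c => [|n IH] k c mk k0 kc.
  rewrite big_ord0 [LHS](integral_dirac _ measurableT)//.
    by rewrite diracE mem_set// big_ord0 mul1e.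
  apply/measurable_EFinP.
  by apply: (measurable_prodr mk).
rewrite ge0_integral_rVS//; last 2 first.
- by apply/measurable_EFinP; exact: measurable_prodr.
- by move=> x; rewrite lee_fin prodr_ge0.
transitivity (\int[mu]_x ((\prod_(i < n) c (lift ord0 i))%:E * (k ord0 x)%:E))%E.
  apply: eq_integral => x _.
  rewrite -(IH (fun i => k (lift ord0 i)))//; [|by move=> *..].
  rewrite muleC -ge0_integralZl//.
  - apply: eq_integral => v _; rewrite -EFinM big_ord_recl rV_cons0.
    by congr (_ * _)%:E; apply: eq_bigr => i _; rewrite rV_consS.
  - apply/measurable_EFinP; apply: (@measurable_prodr n (fun i => k (lift ord0 i))) => i.
    exact: mk.
  - by move=> v _; rewrite lee_fin prodr_ge0.
  - by rewrite lee_fin.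
rewrite ge0_integralZl//.
- by rewrite kc -EFinM big_ord_recl mulrC.
- by apply/measurable_EFinP; exact: (mk ord0).
- by move=> x _; rewrite lee_fin.
- rewrite lee_fin prodr_ge0// => i _.
  by rewrite -lee_fin -kc integral_ge0// => x _; rewrite lee_fin.
Qed.

Lemma cmeasurable_prod n (k : 'I_n -> R -> R[i]) :
  (forall i, cmeasurable_fun setT (k i)) ->
  cmeasurable_fun setT (fun x : 'rV[R]_n => \prod_(i < n) k i (x ord0 i)).
Proof.
elim: n k => [|n IH] k mk.
  rewrite (_ : (fun x => _) = fun=> 1); first exact: cmeasurable_cst.
  by apply/funext => x; rewrite big_ord0.
rewrite (_ : (fun x => _) = (fun x : 'rV[R]_n.+1 => k ord0 (x ord0 ord0) *
    (\prod_(i < n) k (lift ord0 i) ((\row_j x ord0 (lift ord0 j)) ord0 i)))).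
  apply: cmeasurableM.
    by apply: (cmeasurable_comp measurableT _ (mk ord0)) => //; exact: measurable_rV_coord.
  apply: (cmeasurable_comp measurableT _
    (IH (fun i => k (lift ord0 i)) (fun i => mk (lift ord0 i)))) => //.
  apply: measurable_fun_rV => i; under eq_fun do rewrite mxE.
  exact: measurable_rV_coord.
apply/funext => x; rewrite big_ord_recl; congr (_ * _).
by apply: eq_bigr => i _; rewrite mxE.
Qed.

Lemma normc_prod n (k : 'I_n -> R[i]) :
  normc (\prod_(i < n) k i) = \prod_(i < n) normc (k i).
Proof.
elim: n k => [|n IH] k; first by rewrite !big_ord0 Normc.normc1.
by rewrite !big_ord_recl Normc.normcM IH.
Qed.

Lemma cintegrable_prod_rV n (k : 'I_n -> R -> R[i]) :
  (forall i, cintegrable mu setT (k i)) ->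
  cintegrable (lebesgue_rV R n) setT (fun x => \prod_(i < n) k i (x ord0 i)).
Proof.
move=> ik; apply/cintegrableP => //; split.
  by apply: cmeasurable_prod => i; exact: cintegrable_cmeasurable (ik i).
under eq_integral do rewrite normc_prod.
rewrite (@integral_prod_rV n (fun i x => normc (k i x))
  (fun i => \int[mu]_x normc (k i x))).
- by rewrite ltry.
- by move=> i; apply: measurable_normc => //; exact: cintegrable_cmeasurable (ik i).
- by move=> i x; exact: normc_ge0.
- move=> i; rewrite /Rintegral fineK//.
  by apply: integrable_fin_num => //; exact: cintegrable_normc.
Qed.

Lemma cintegral_prod_rV n (k : 'I_n -> R -> R[i]) :
  (forall i, cintegrable mu setT (k i)) ->
  cintegral (lebesgue_rV R n) setT (fun x => \prod_(i < n) k i (x ord0 i)) =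
  \prod_(i < n) cintegral mu setT (k i).
Proof.
elim: n k => [|n IH] k ik.
  rewrite big_ord0 /cintegral /Rintegral.
  rewrite [X in fine X](_ : _ = 1%E); last first.
    rewrite [LHS](integral_dirac _ measurableT)/=.
      by rewrite diracE mem_set// big_ord0 mul1e.
    apply/measurable_EFinP; apply: (cmeasurable_prod _).1.
    by case.
  rewrite [X in Complex _ (fine X)](_ : _ = 0%E)//.
  rewrite [LHS](integral_dirac _ measurableT)/=.
    by rewrite diracE mem_set// big_ord0 mule0.
  apply/measurable_EFinP; apply: (cmeasurable_prod _).2.
  by case.
rewrite cintegral_rVS12; last exact: cintegrable_prod_rV.
rewrite big_ord_recl -(IH (fun i => k (lift ord0 i)))// mulrC -cintegralZ//.
apply: eq_cintegral => x _; rewrite mulrC -cintegralZ//; last first.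
  exact: (@cintegrable_prod_rV n (fun i => k (lift ord0 i))).
apply: eq_cintegral => v _; rewrite big_ord_recl rV_cons0; congr (_ * _).
by apply: eq_bigr => i _; rewrite rV_consS.
Qed.

End lebesgue_rV_integral.

(** * Smooth bump functions *)

Lemma is_derive_conv {R : numFieldType} {V W : normedModType R} (f : V -> W)
  (x v : V) (l l' : W) : l = l' -> is_derive x v f l -> is_derive x v f l'.
Proof. by move=> ->. Qed.

Section flat_function.
Context {R : realType}.
Implicit Types (p : {poly R}) (y : R).

(* [flat p] for [p = 1] is the usual exp(-1/y); the family is closed under
   differentiation. *)
Definition flat p y : R := if 0 < y then p.[y^-1] * expR (- y^-1) else 0.

(** With u = 1/y one has u' = -u^2, hence (p(u) exp(-u))' = u^2 (p - p')(u) exp(-u). *)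
Definition flatD p : {poly R} := 'X^2 * (p - p^`()).

(** Induction along Horner's scheme: one half of the exponent bounds the lower-degree polynomial,
    the other half the extra factor u, by 1 + x <= exp x at x = e u / 2. This is the origin of the
    factor 2 / e. *)
Lemma poly_le_expR p (e : R) : 0 < e ->
  exists2 C, 0 <= C & forall u, 0 <= u -> `|p.[u]| <= C * expR (e * u).
Proof.
elim/poly_ind : p e => [|p c IH] e e0.
  by exists 0 => // u _; rewrite horner0 normr0 mul0r.
have e20 : 0 < e / 2 by rewrite divr_gt0.
have [C C0 pC] := IH _ e20.
exists (C * (2 / e) + `|c|).
  by rewrite addr_ge0// mulr_ge0// divr_ge0// ltW.
move=> u u0; rewrite hornerMXaddC (le_trans (ler_normD _ _))// mulrDl lerD//.
  rewrite normrM (ger0_norm u0).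
  have -> : e * u = e / 2 * u + e / 2 * u by field.
  rewrite expRD [leRHS](_ : _ = C * expR (e / 2 * u) * (2 / e * expR (e / 2 * u)));
    last by ring.
  apply: ler_pM => //; first exact: pC.
  rewrite [leLHS](_ : _ = 2 / e * (e / 2 * u)); last by field; rewrite gt_eqF.
  rewrite ler_wpM2l ?divr_ge0 ?ltW//.
  by have := expR_ge1Dx (e / 2 * u); lra.
by rewrite ler_peMr// -expR0 ler_expR mulr_ge0// ltW.
Qed.

(** The exponential bound is applied to p X^2 at 1/y. The quadratic bound makes the difference
    quotient at 0 tend to 0, which settles differentiability there. *)
Lemma flat_le_sqr p : exists C, forall y, `|flat p y| <= C * y ^+ 2.
Proof.
have [C C0 pC] := poly_le_expR (p * 'X^2) ltr01.
exists C => y; rewrite /flat; case: ifPn => [y0|_]; last first.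
  by rewrite normr0 mulr_ge0// sqr_ge0.
have y20 : 0 < y ^+ 2 by rewrite exprn_gt0.
have := pC y^-1; rewrite invr_ge0 ltW// => /(_ isT).
rewrite hornerM hornerXn mul1r normrM [X in _ * X]ger0_norm; last first.
  by rewrite exprn_ge0// invr_ge0 ltW.
rewrite exprVn ler_pdivrMr// mulrAC => h.
by rewrite normrM (gtr0_norm (expR_gt0 _)) expRN ler_pdivrMr ?expR_gt0.
Qed.

Lemma is_derive_flat p y : is_derive y 1 (flat p) (flat (flatD p) y).
Proof.
have [y0|y0|->] := ltgtP y 0.
- apply: (@near_eq_is_derive _ _ _ (cst 0)).
    near=> z; rewrite /flat ifF//; apply/negbTE; rewrite -leNgt ltW//.
    by near: z; exact: lt_nbhsl.
  rewrite [flat _ y](_ : _ = 0); first exact: is_derive_cst.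
  by rewrite /flat ifF//; apply/negbTE; rewrite -leNgt ltW.
- apply: (@near_eq_is_derive _ _ _ (fun z : R => (p.[z^-1] * expR (- z^-1) : R))).
    near=> z; rewrite /flat ifT//.
    by near: z; exact: lt_nbhsr.
  have yn0 : y != 0 by rewrite gt_eqF.
  have dV : is_derive y 1 (fun z : R => z^-1) (- y ^- 2).
    have := @is_deriveV R id y 1 1 yn0 (is_derive_id _ _).
    by apply: is_derive_conv; rewrite /GRing.scale/= mulr1.
  have dp : is_derive y 1 (fun z => p.[z^-1]) (p^`().[y^-1] * - y ^- 2).
    exact: (@is_derive1_comp R (horner p) (fun z => z^-1)).
  have dNV : is_derive y 1 (fun z : R => - z^-1) (y ^- 2).
    by have := is_deriveN dV; rewrite opprK.
  have de : is_derive y 1 (fun z => expR (- z^-1)) (expR (- y^-1) * y ^- 2).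
    exact: (@is_derive1_comp R expR (fun z => - z^-1)).
  have := @is_deriveM _ _ _ _ _ _ _ _ dp de.
  apply: is_derive_conv; rewrite /flat y0 /flatD.
  rewrite hornerM hornerXn hornerD hornerN /GRing.scale/= -exprVn; ring.
- have [C pC] := flat_le_sqr p.
  have f0 (q : {poly R}) : flat q 0 = 0 by rewrite /flat ltxx.
  have cv : (fun h => h^-1 *: ((flat p \o shift 0) (h *: 1) - flat p 0)) @ 0^' --> (0 : R).
    have C0 : 0 <= C by have := pC 1; rewrite expr1n mulr1; exact: le_trans.
    apply/cvgrPdist_le => e e0.
    near=> h; rewrite /= f0 subr0 addr0 sub0r normrN [_%:A]mulr1.
    have hn0 : h != 0 by near: h; exact: nbhs_dnbhs_neq.
    rewrite /GRing.scale/= normrM normfV.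
    rewrite ler_pdivrMl ?normr_gt0//.
    rewrite (le_trans (pC _))// -(real_normK (num_real h)) expr2 mulrCA.
    rewrite ler_wpM2l//.
    have : `|h| <= e / (C + 1).
      near: h; apply: (@dnbhs0_le _ R^o); rewrite divr_gt0//; lra.
    rewrite ler_pdivlMr; last lra.
    by apply: le_trans; rewrite mulrC ler_wpM2l//; lra.
  apply: DeriveDef; first by apply/cvg_ex; exists 0.
  by rewrite f0; apply/cvg_lim.
Unshelve. all: by end_near. Qed.

Lemma flat1_ge0 y : 0 <= flat 1 y.
Proof.
by rewrite /flat; case: ifP => // _; rewrite hornerE mul1r expR_ge0.
Qed.

Lemma flat1_le1 y : flat 1 y <= 1.
Proof.
rewrite /flat; case: ifP => // y0; rewrite hornerE mul1r -expR0 ler_expR.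
by rewrite oppr_le0 invr_ge0 ltW.
Qed.

Lemma flat1_cvg1 y : 0 < y -> flat 1 (n.+1%:R * y) @[n --> \oo] --> (1 : R).
Proof.
move=> y0.
rewrite (_ : (fun n => _) = (fun n => expR (- (n.+1%:R^-1 * y^-1)))); last first.
  apply/funext => n; rewrite /flat mulr_gt0// hornerE mul1r invfM//.
have h0 : - (n.+1%:R^-1 * y^-1) @[n --> \oo] --> (0 : R).
  by rewrite -oppr0 -(mul0r y^-1); apply: cvgN; apply: cvgMr_tmp; exact: cvg_harmonic.
by have := cvg_comp _ _ h0 (@continuous_expR R 0); rewrite expR0.
Qed.

End flat_function.

Section smooth_functions.
Context {R : realType} {d : nat}.
Local Notation Rd := 'rV[R]_d.
Local Notation ei i := (delta_mx ord0 i : Rd).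
Implicit Types g h : Rd -> R.

(** Coinduction for smoothness: [partials] applies the last direction of the list first, so peeling
    the list from the right replaces g by a first partial derivative, which stays in P. *)
Lemma smooth_coind (P : (Rd -> R) -> Prop) :
  (forall g, P g -> [/\ continuous g, forall i x, derivable g x (ei i) &
    forall i, P ('D_(ei i) g)]) ->
  forall g, P g -> smooth g.
Proof.
move=> PD g Pg s; elim/last_ind : s g Pg => [|s i IH] g Pg.
  by have [] := PD _ Pg.
rewrite /partials foldr_rcons; apply: IH.
by have [] := PD _ Pg.
Qed.

Lemma smooth_inv g : smooth g -> [/\ continuous g,
  forall i x, derivable g x (ei i) & forall i, smooth ('D_(ei i) g)].
Proof.
move=> sg; have [g1 g2] := sg [::]; split; [exact: g1|exact: g2|move=> i s].
by have := sg (rcons s i); rewrite /partials foldr_rcons.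
Qed.

Lemma smooth_cts g : smooth g -> continuous g.
Proof. by move=> /smooth_inv[]. Qed.

Lemma smooth_derivable g i x : smooth g -> derivable g x (ei i).
Proof. by move=> /smooth_inv[]. Qed.

Lemma smooth_D g i : smooth g -> smooth ('D_(ei i) g).
Proof. by move=> /smooth_inv[]. Qed.

(** Sums and products of smooth functions form a class that the Leibniz rule makes stable under
    partial derivatives, so that coinduction uses the product rule only for first derivatives. *)
Inductive smooth_alg : (Rd -> R) -> Prop :=
| smooth_alg_gen g : smooth g -> smooth_alg g
| smooth_algD g h : smooth_alg g -> smooth_alg h -> smooth_alg (g + h)
| smooth_algM g h : smooth_alg g -> smooth_alg h -> smooth_alg (g * h).

Lemma smooth_alg_smooth g : smooth_alg g -> smooth g.
Proof.
apply: smooth_coind => {}g; elim=> {g} [g sg|g h _ [g1 g2 g3] _ [h1 h2 h3]|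
    g h ag [g1 g2 g3] ah [h1 h2 h3]].
- have [g1 g2 g3] := smooth_inv sg.
  by split; [exact: g1|exact: g2|move=> i; apply: smooth_alg_gen; exact: g3].
- split=> [x|i x|i].
  + by apply: continuousD; [exact: g1|exact: h1].
  + exact: derivableD.
  + rewrite (_ : 'D__ _ = 'D_(ei i) g + 'D_(ei i) h); first exact: smooth_algD.
    by apply/funext => x; rewrite deriveD.
- split=> [x|i x|i].
  + by apply: continuousM; [exact: g1|exact: h1].
  + exact: derivableM.
  + rewrite (_ : 'D__ _ = g * 'D_(ei i) h + h * 'D_(ei i) g).
      by apply: smooth_algD; exact: smooth_algM.
    by apply/funext => x; rewrite deriveM.
Qed.

Lemma smoothD g h : smooth g -> smooth h -> smooth (fun x => g x + h x).
Proof.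
move=> sg sh; apply: (@smooth_alg_smooth (g + h)).
by apply: smooth_algD; exact: smooth_alg_gen.
Qed.

Lemma smoothM g h : smooth g -> smooth h -> smooth (fun x => g x * h x).
Proof.
move=> sg sh; apply: (@smooth_alg_smooth (g * h)).
by apply: smooth_algM; exact: smooth_alg_gen.
Qed.

Lemma smooth_cst c : smooth (fun _ : Rd => c).
Proof.
apply: (@smooth_coind (fun g => exists c, g = cst c)); last by exists c.
move=> _ [{}c ->]; split=> [|i x|i].
- exact: cst_continuous.
- exact: derivable_cst.
- by exists 0; apply/funext => x; rewrite derive_cst.
Qed.

Lemma smoothZ c g : smooth g -> smooth (fun x => c * g x).
Proof. by apply: smoothM; exact: smooth_cst. Qed.

Lemma smoothN g : smooth g -> smooth (fun x => - g x).
Proof.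
move=> sg; rewrite (_ : (fun x => - g x) = (fun x => (-1) * g x)).
  exact: smoothZ.
by apply/funext => x; rewrite mulN1r.
Qed.

Lemma smoothB g h : smooth g -> smooth h -> smooth (fun x => g x - h x).
Proof. by move=> sg sh; apply: smoothD; [exact: sg|exact: smoothN]. Qed.

Lemma smooth_prod n (g : 'I_n -> Rd -> R) : (forall i, smooth (g i)) ->
  smooth (fun x => \prod_(i < n) g i x).
Proof.
elim: n g => [|n IH] g sg.
  rewrite (_ : (fun x => _) = (fun=> 1)); first exact: smooth_cst.
  by apply/funext => x; rewrite big_ord0.
rewrite (_ : (fun x => _) = (fun x => g ord0 x * \prod_(i < n) g (lift ord0 i) x)).
  by apply: smoothM => //; exact: (IH (fun i => g (lift ord0 i))).
by apply/funext => x; rewrite big_ord_recl.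
Qed.

Lemma is_derive_along (g : Rd -> R) (x v : Rd) (l : R) :
  is_derive (0 : R) (1 : R) (fun t : R => g (t *: v + x)) l -> is_derive x v g l.
Proof.
move=> [d1 d2]; apply: DeriveDef; first exact/derivable1P.
rewrite -d2 /derive; apply: (congr1 (fun F : R -> R => lim (F @ 0^'))).
apply/funext => t /=.
by rewrite addr0 scale0r add0r [t%:A]mulr1.
Qed.

Lemma is_derive_comp_coord (phi : R -> R) (i j : 'I_d) (c b l : R) (x : Rd) :
  is_derive (c * x ord0 i + b) 1 phi l ->
  is_derive x (ei j) (fun x => phi (c * x ord0 i + b)) ((i == j)%:R * c * l).
Proof.
move=> dphi; apply: is_derive_along.
rewrite (_ : (fun t => _) = (fun t => phi ((i == j)%:R * c * t + (c * x ord0 i + b)))); last first.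
  by apply/funext => t; rewrite !mxE eqxx/=; congr phi; ring.
set k := (i == j)%:R * c; set y := c * x ord0 i + b.
have da : is_derive (0 : R) 1 (fun t => k * t + y) k.
  have : is_derive (0 : R) (1 : R) ((k *: (@id R)) + cst y : R -> R) (k *: 1 + 0).
    exact: is_deriveD.
  by rewrite addr0 /GRing.scale/= mulr1.
have dphi' : is_derive (k * 0 + y) 1 phi l by rewrite mulr0 add0r.
have := @is_derive1_comp R phi (fun t => k * t + y) 0 _ _ dphi' da.
by apply: is_derive_conv; rewrite mulrC.
Qed.

Lemma smooth_coord (i : 'I_d) : smooth (fun x : Rd => x ord0 i).
Proof.
apply: (@smooth_coind (fun g => smooth g \/ g = fun x => x ord0 i)); last by right.
move=> g [/smooth_inv[g1 g2 g3]|->]; first by split => // j; left.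
have D j x : is_derive x (ei j) (fun x : Rd => x ord0 i) (i == j)%:R.
  have := @is_derive_comp_coord id i j 1 0 1 x (is_derive_id _ _).
  rewrite !mulr1 (_ : (fun x => _) = (fun x : Rd => x ord0 i))//.
  by apply/funext => y; rewrite mul1r addr0.
split=> [x|j x|j].
- exact: coord_cts.
- exact: ex_derive.
- left; rewrite (_ : 'D__ _ = cst ((i == j)%:R : R)); first exact: smooth_cst.
  by apply/funext => x; rewrite derive_val.
Qed.

(** The functions k [flat p (c * x_i + b)] are stable under partial derivatives: each one multiplies
    k by c or by 0 and replaces p by [flatD p]. *)
Lemma smooth_flat (i : 'I_d) c b p : smooth (fun x : Rd => flat p (c * x ord0 i + b)).
Proof.
apply: (@smooth_coind (fun g => smooth g \/
  exists k p, g = fun x => k * flat p (c * x ord0 i + b))); last first.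
  by right; exists 1, p; apply/funext => x; rewrite mul1r.
move=> g [/smooth_inv[g1 g2 g3]|[k [{}p ->]]]; first by split => // j; left.
have D j x : is_derive x (ei j) (fun x : Rd => k * flat p (c * x ord0 i + b))
    (k * ((i == j)%:R * c * flat (flatD p) (c * x ord0 i + b))).
  apply: (@is_deriveZ _ _ _ _ k); apply: is_derive_comp_coord.
  exact: is_derive_flat.
have cf : continuous (flat p \o (fun x : Rd => c * x ord0 i + b)).
  move=> x; apply: continuous_comp; last first.
    apply: differentiable_continuous; apply/derivable1_diffP.
    by have [] := is_derive_flat p (c * x ord0 i + b).
  apply: (@smooth_cts (fun x => c * x ord0 i + b)).
  by apply: smoothD; [apply: smoothZ; exact: smooth_coord|exact: smooth_cst].
split=> [x|j x|j].
- exact: (@continuousM R Rd (cst k) _ x (@cst_continuous _ _ k x) (cf x)).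
- exact: ex_derive.
- right; exists (k * ((i == j)%:R * c)), (flatD p); apply/funext => x.
  by rewrite derive_val; ring.
Qed.

End smooth_functions.

Section bumps.
Context {R : realType} {d : nat}.
Local Notation Rd := 'rV[R]_d.

(** A factor is exp(-1 / ((n + 1) r)), r being the distance to a face; it tends to 1 inside the box
    as n grows and is 0 beyond the face. The bumps thus approximate the indicator of the open
    box. *)
Definition box_bump (a b : Rd) (n : nat) (x : Rd) : R :=
  \prod_(i < d) (flat 1 (n.+1%:R * (x ord0 i - a ord0 i)) *
                 flat 1 (n.+1%:R * (b ord0 i - x ord0 i))).

Lemma smooth_bump a b n : smooth (box_bump a b n).
Proof.
apply: (@smooth_prod _ _ d (fun i x => flat 1 (n.+1%:R * (x ord0 i - a ord0 i)) *
                 flat 1 (n.+1%:R * (b ord0 i - x ord0 i)))) => i.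
apply: smoothM.
  rewrite (_ : (fun x => _) = (fun x : Rd =>
    flat 1 (n.+1%:R * x ord0 i + - (n.+1%:R * a ord0 i)))); first exact: smooth_flat.
  by apply/funext => x; congr flat; ring.
rewrite (_ : (fun x => _) = (fun x : Rd =>
  flat 1 (- n.+1%:R * x ord0 i + n.+1%:R * b ord0 i))); first exact: smooth_flat.
by apply/funext => x; congr flat; ring.
Qed.

Lemma bump_ge0 a b n x : 0 <= box_bump a b n x.
Proof. by apply: prodr_ge0 => i _; rewrite mulr_ge0// flat1_ge0. Qed.

Lemma bump_le1 a b n x : box_bump a b n x <= 1.
Proof.
suff /andP[] : 0 <= box_bump a b n x <= 1 by [].
apply: (big_ind (fun r => 0 <= r <= 1)); first by rewrite ler01 lexx.
  by move=> u v /andP[u0 u1] /andP[v0 v1]; rewrite mulr_ge0// mulr_ile1.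
by move=> i _; rewrite mulr_ge0 ?flat1_ge0// mulr_ile1 ?flat1_ge0 ?flat1_le1.
Qed.

Lemma bump_out a b n x : ~ box a b x -> box_bump a b n x = 0.
Proof.
move=> xab; have [i hi] : exists i, ~~ (a ord0 i < x ord0 i < b ord0 i).
  apply: contrapT => h; apply: xab => i; apply/negPn/negP => hi.
  by apply: h; exists i.
rewrite /box_bump (bigD1 i)//=; move: hi; rewrite negb_and -!leNgt => /orP[h|h].
  rewrite [X in X * _ * _](_ : _ = 0) ?mul0r//.
  by rewrite /flat ifF//; apply/negbTE; rewrite -leNgt pmulr_rle0// subr_le0.
rewrite [X in _ * X * _](_ : _ = 0) ?mulr0 ?mul0r//.
by rewrite /flat ifF//; apply/negbTE; rewrite -leNgt pmulr_rle0// subr_le0.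
Qed.

Lemma cvg_prodr m (u : 'I_m -> nat -> R) (l : 'I_m -> R) :
  (forall i, u i n @[n --> \oo] --> l i) ->
  \prod_(i < m) u i n @[n --> \oo] --> \prod_(i < m) l i.
Proof.
elim: m u l => [|m IH] u l ul.
  rewrite big_ord0 (_ : (fun n => _) = fun=> 1); first exact: cvg_cst.
  by apply/funext => n; rewrite big_ord0.
rewrite big_ord_recl (_ : (fun n => _) = fun n =>
  u ord0 n * \prod_(i < m) u (lift ord0 i) n); last first.
  by apply/funext => n; rewrite big_ord_recl.
by apply: cvgM => //; exact: (IH (fun i => u (lift ord0 i))).
Qed.

Lemma bump_cvg a b x : box_bump a b n x @[n --> \oo] --> (\1_(box a b) x : R).
Proof.
have [xab|xab] := pselect (box a b x); last first.
  rewrite indicE memNset// (_ : (fun n => _) = fun=> 0); first exact: cvg_cst.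
  by apply/funext => n; rewrite bump_out.
rewrite indicE mem_set//=.
rewrite [X in _ --> X](_ : _ = \prod_(i < d) (1 * 1 : R)); last first.
  by rewrite mulr1 big1.
apply: cvg_prodr => i; have /andP[h1 h2] := xab i.
by apply: cvgM; apply: flat1_cvg1; rewrite subr_gt0.
Qed.

Lemma csupp_bump a b n c e : box a b `<=` box c e ->
  csupp (fun x => (box_bump a b n x)%:C%C) `<=` cbox c e.
Proof.
move=> sub; rewrite ((closure_id (cbox c e)).1 (@closed_cbox _ _ c e)).
apply: closureS => x /= xn0; apply/box_sub_cbox/sub.
apply: contrapT => xab; move: xn0; rewrite bump_out// => /eqP; exact.
Qed.

End bumps.

(** * The fundamental lemma of the calculus of variations *)

Lemma ae_countable {R : realType} {disp} {X : measurableType disp}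
    (m : {measure set X -> \bar R}) {T : countType} (P : T -> X -> Prop) :
  (forall q, {ae m, forall x, P q x}) -> {ae m, forall x, forall q, P q x}.
Proof.
move=> aeP.
have : {ae m, forall x, forall n : nat,
    if unpickle n is Some q then P q x else True}.
  apply/ae_foralln => n; case: (unpickle n) => [q|]; first exact: aeP.
  exact: aeW.
by apply: filterS => x h q; have := h (pickle q); rewrite pickleK.
Qed.

Section rational_boxes.
Context {R : realType} {d : nat}.
Local Notation Rd := 'rV[R]_d.
Local Notation leb := (lebesgue_rV R d).
Local Notation Qbox := ('rV[rat]_d * 'rV[rat]_d)%type.

(** Rational boxes are closed under intersection, the empty set occurring when a lower bound is not
    below the upper one; they are the pi-system to which Dynkin's theorem is applied. *)
Definition Qbox_meet (p q : Qbox) : Qbox :=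
  (\row_i Num.max (p.1 ord0 i) (q.1 ord0 i),
   \row_i Num.min (p.2 ord0 i) (q.2 ord0 i)).

Lemma rbox_meet p q : rbox R (Qbox_meet p q) = rbox R p `&` rbox R q.
Proof.
apply/seteqP; split=> [x h|x [h1 h2] i].
  by split=> i; have := h i; rewrite !mxE/= => /andP[h1 h2]; apply/andP; split;
    [apply: le_lt_trans h1|apply: (lt_le_trans h2)|
     apply: le_lt_trans h1|apply: (lt_le_trans h2)];
    rewrite ler_rat ?le_max ?ge_min lexx ?orbT.
have := h1 i; have := h2 i; rewrite !mxE/= => /andP[a1 a2] /andP[b1 b2].
by apply/andP; split; [case: (leP (p.1 ord0 i) (q.1 ord0 i))|
  case: (leP (p.2 ord0 i) (q.2 ord0 i))] => _.
Qed.

Lemma measurable_rbox q : measurable (rbox R q : set Rd).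
Proof. exact: measurable_box. Qed.

Lemma measurable_rV_rbox :
  @measurable _ Rd = <<s range (fun q : Qbox => rbox R q) >>.
Proof.
apply/seteqP; split; last first.
  apply: smallest_sub; first exact: sigma_algebra_measurable.
  by move=> _ [q _ <-]; exact: measurable_rbox.
pose G := range (fun q : Qbox => rbox R q : set Rd).
have openG (U : set Rd) : open U -> <<s G >> U.
  move=> oU.
  suff : (measurable : set (set (g_sigma_algebraType G))) U by [].
  rewrite (open_bigcup_rbox oU) bigcup_mkcond.
  apply: countable_bigcupT_measurable => // q; case: ifP => _.
    by apply: sub_sigma_algebra; exists q.
  exact: measurable0.
apply: smallest_sub; first exact: smallest_sigma_algebra.
move=> A; rewrite -bigcup_seq/= => -[i _] [B mB <-].
have mc : measurable_fun [set: g_sigma_algebraType G]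
    (fun x : g_sigma_algebraType G => (x : Rd) ord0 i).
  apply: (measurability _ (RGenOpens.measurableE R)).
  move=> _ [_ [a [b ->]] <-]; rewrite setTI; apply: openG.
  by apply: open_comp; [move=> x _; exact: coord_cts|exact: interval_open].
exact: (mc measurableT _ mB).
Qed.

Definition rbump (q : Qbox) (n : nat) : Rd -> R := box_bump (rlo q) (rhi q) n.

(** Bumps converge to indicators of boxes under the dominating function |h|, so h has integral 0
    over every rational sub-box. Rational boxes generate the sigma-algebra, and Dynkin induction
    extends this to all measurable subsets. *)
Lemma dbr_box_real (h : Rd -> R) (q0 : Qbox) :
  leb.-integrable (rbox R q0) (EFin \o h) ->
  (forall q n, rbox R q `<=` rbox R q0 ->
    \int[leb]_(x in rbox R q0) (h x * rbump q n x)%:E = 0)%E ->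
  {ae leb, forall x, rbox R q0 x -> h x = 0}.
Proof.
move=> ih hb; set Q := rbox R q0.
have mQ : measurable Q by exact: measurable_rbox.
have mh : measurable_fun Q (EFin \o h) by exact: measurable_int ih.
have intI (q : Qbox) : rbox R q `<=` Q ->
    (\int[leb]_(x in Q) (h x * \1_(rbox R q) x)%:E = 0)%E.
  move=> qQ.
  have mb n : measurable_fun Q (fun x => (h x * rbump q n x)%:E).
    apply/measurable_EFinP; apply: measurable_funM; first exact/measurable_EFinP.
    apply: (@measurable_funS _ _ _ _ setT) => //.
    by apply: continuous_measurable_rV; apply: smooth_cts; exact: smooth_bump.
  have [] := @dominated_convergence _ _ _ leb Q mQ
    (fun n x => (h x * rbump q n x)%:E) (fun x => (h x * \1_(rbox R q) x)%:E)
    (fun x => `|h x|%:E) mb.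
  - apply/measurable_EFinP; apply: measurable_funM; first exact/measurable_EFinP.
    by apply: measurable_indic; exact: measurable_rbox.
  - apply: aeW => x Qx; apply: cvg_EFin; first exact: nearW.
    by apply: cvgMl_tmp; exact: bump_cvg.
  - exact: (integrable_norm ih).
  - apply: aeW => x n Qx; rewrite lee_fin normrM ler_piMr//.
    by rewrite ger0_norm ?bump_ge0 ?bump_le1.
  move=> _ _ /cvg_lim <-//.
  rewrite [X in limn X](_ : _ = fun=> 0%E); first exact: lim_cst.
  by apply/funext => n; exact: hb.
have int0 (A : set Rd) : measurable A -> (\int[leb]_(x in Q `&` A) (h x)%:E = 0)%E.
  rewrite measurable_rV_rbox.
  apply: (dynkin_induction (P := fun A => (\int[leb]_(x in Q `&` A) (h x)%:E = 0)%E)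
    measurable_rV_rbox).
  - move=> _ _ [p _ <-] [q _ <-]; exists (Qbox_meet p q) => //.
    by rewrite rbox_meet.
  - rewrite setIT -[RHS](intI q0)//; apply: eq_integral => x xQ.
    by rewrite indicE xQ mulr1.
  - move=> _ [q _ <-] /=.
    rewrite -[RHS](intI (Qbox_meet q0 q)); last by rewrite rbox_meet; exact: subIsetl.
    rewrite integral_mkcond [RHS]integral_mkcond; apply: eq_integral => x _.
    rewrite /patch rbox_meet indicE in_setI -/Q.
    by case: (x \in Q) => //=; case: (x \in rbox R q); rewrite ?mulr1 ?mulr0.
  - move=> S mS; have iQ : (\int[leb]_(x in Q) (h x)%:E = 0)%E.
      by rewrite -[RHS](intI q0)//; apply: eq_integral => x xQ; rewrite indicE xQ mulr1.
    have E : (\int[leb]_(x in Q `&` S `|` Q `&` ~` S) (h x)%:E =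
        \int[leb]_(x in Q `&` S) (h x)%:E + \int[leb]_(x in Q `&` ~` S) (h x)%:E)%E.
      apply: integral_setU => //; first exact: measurableI.
      - by apply: measurableI => //; exact: measurableC.
      - by rewrite -setIUr setUCr setIT.
      - by apply/disj_setPS => x [[_ ?] [_ ?]].
    by move=> S0; move: E; rewrite -setIUr setUCr setIT iQ S0 add0e => <-.
  - move=> F mF tF F0; rewrite setI_bigcupr.
    rewrite integral_bigcup//=.
    + by rewrite eseries0// => n _ _; exact: F0.
    + by apply: trivIset_setIl.
    + by move=> n; exact: measurableI.
    + by apply: (integrableS mQ) => //;
        [apply: bigcup_measurable => n _; exact: measurableI|
         move=> x [n _ []]].
have ae0 : ae_eq leb Q (EFin \o h) (cst 0%E).
  apply: integral_ae_eq => //.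
  move=> E EQ mE; rewrite integral0 -(setIidr EQ); exact: int0.
by apply: filterS ae0 => x /= hx Qx; have := hx Qx; case.
Qed.

Lemma dbr_box (h : Rd -> R[i]) (q0 : Qbox) :
  cintegrable leb (rbox R q0) h ->
  (forall q n, rbox R q `<=` rbox R q0 ->
    cintegral leb (rbox R q0) (fun x => h x * (rbump q n x)%:C%C) = 0) ->
  {ae leb, forall x, rbox R q0 x -> h x = 0}.
Proof.
move=> [h1 h2] hb.
have mQ : measurable (rbox R q0 : set Rd) by exact: measurable_rbox.
have ib (k : Rd -> R) q n : leb.-integrable (rbox R q0) (EFin \o k) ->
    leb.-integrable (rbox R q0) (EFin \o (fun x => k x * rbump q n x)).
  move=> ik; rewrite (_ : (fun x => _) = (fun x => rbump q n x * k x)).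
    apply: (@integrable_bounded_mul _ _ _ _ _ mQ 1) => //.
      apply: (@measurable_funS _ _ _ _ setT) => //.
      by apply: continuous_measurable_rV; apply: smooth_cts; exact: smooth_bump.
    by move=> x _; rewrite ger0_norm ?bump_ge0 ?bump_le1.
  by apply/funext => x; rewrite mulrC.
have zero (k : Rd -> R) q n : leb.-integrable (rbox R q0) (EFin \o k) ->
    \int[leb]_(x in rbox R q0) (k x * rbump q n x) = 0 ->
    (\int[leb]_(x in rbox R q0) (k x * rbump q n x)%:E = 0)%E.
  move=> ik k0; rewrite -[LHS]fineK; first by congr (_%:E); exact: k0.
  by apply: integrable_fin_num => //; exact: ib.
have r1 : {ae leb, forall x, rbox R q0 x -> Re (h x) = 0}.
  apply: dbr_box_real => // q n qq; apply: zero => //.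
  have := congr1 Re (hb q n qq); rewrite /= => <-; apply: eq_Rintegral => x _.
  by rewrite cReM /= mulr0 subr0.
have r2 : {ae leb, forall x, rbox R q0 x -> Im (h x) = 0}.
  apply: dbr_box_real => // q n qq; apply: zero => //.
  have := congr1 Im (hb q n qq); rewrite /= => <-; apply: eq_Rintegral => x _.
  by rewrite cImM /= mulr0 add0r.
by apply: filterS2 r1 r2 => x h1' h2' Qx; apply: complex_ext; [exact: h1'|exact: h2'].
Qed.

End rational_boxes.

Section test_function_pairing.
Context {R : realType} {d : nat}.
Local Notation Rd := 'rV[R]_d.
Local Notation leb := (lebesgue_rV R d).
Local Notation Qbox := ('rV[rat]_d * 'rV[rat]_d)%type.
Implicit Types (U K : set Rd) (chi v : Rd -> R[i]).

Lemma csupp_out chi x : ~ csupp chi x -> chi x = 0.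
Proof.
move=> h; apply/eqP/negPn/negP => hx; apply: h.
exact: (@subset_closure _ [set x | chi x != 0]).
Qed.

Lemma csmooth_cmeasurable chi : csmooth chi -> cmeasurable_fun setT chi.
Proof.
by move=> [s1 s2]; split; apply: continuous_measurable_rV; exact: smooth_cts.
Qed.

Lemma test_fun_bounded U chi : test_fun U chi ->
  exists2 M, 0 <= M & forall x, normc (chi x) <= M.
Proof.
move=> [[s1 s2] cK _].
have bnd (g : Rd -> R) : continuous g ->
    exists2 M, 0 <= M & forall x, csupp chi x -> `|g x| <= M.
  move=> cg; have : compact (g @` csupp chi).
    by apply: continuous_compact => //; exact: continuous_subspaceT.
  move=> /compact_bounded[M [_ hM]]; exists (`|M| + 1); first by rewrite addr_ge0.
  move=> x sx; apply: (hM (`|M| + 1)); last by exists x.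
  by rewrite (le_lt_trans (ler_norm _))// ltrDl.
have [M1 M10 h1] := bnd _ (smooth_cts s1); have [M2 M20 h2] := bnd _ (smooth_cts s2).
exists (M1 + M2); first exact: addr_ge0.
move=> x; have [sx|/csupp_out ->] := pselect (csupp chi x); last first.
  by rewrite Normc.normc0 addr_ge0.
by rewrite (le_trans (normc_le_ReIm _))// lerD//; [exact: h1|exact: h2].
Qed.

Lemma clocally_integrableW U K v : clocally_integrable U v -> compact K ->
  K `<=` U -> cintegrable leb K v.
Proof.
move=> [oU mv vK] cK KU; apply/cintegrableP; first exact: compact_measurable_rV.
split; last exact: vK.
by apply: cmeasurableS mv => //; exact: open_measurable_rV.
Qed.

Lemma eq_cintegral_supp (A B : set Rd) v : A `<=` B -> (forall x, ~ A x -> v x = 0) ->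
  cintegral leb B v = cintegral leb A v.
Proof.
move=> AB v0; rewrite cintegral_mkcond [RHS]cintegral_mkcond; congr cintegral.
apply/funext => x; rewrite /patch.
have [xA|xA] := pselect (A x); first by rewrite !mem_set//; exact: AB.
by rewrite v0// (memNset xA); case: ifP.
Qed.

Lemma cintegrable_supp (A B : set Rd) v : measurable A -> measurable B ->
  A `<=` B -> (forall x, ~ A x -> v x = 0) ->
  cintegrable leb A v -> cintegrable leb B v.
Proof.
move=> mA mB AB v0 /(cintegrable_mkcond _ _ mA) iA.
apply/(cintegrable_mkcond _ _ mB).
rewrite (_ : patch _ B v = patch (fun=> 0) A v)//.
apply/funext => x; rewrite /patch.
have [xA|xA] := pselect (A x); first by rewrite !mem_set//; exact: AB.
by rewrite v0// (memNset xA); case: ifP.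
Qed.

Lemma cintegrable_bounded_mul (D : set Rd) (M : R) (f g : Rd -> R[i]) :
  measurable D -> cmeasurable_fun D g -> (forall x, D x -> normc (g x) <= M) ->
  cintegrable leb D f -> cintegrable leb D (fun x => f x * g x).
Proof.
move=> mD mg gM if_; apply: (@cintegrable_le _ _ _ _ _ _ (fun x => M * normc (f x))) => //.
- by apply: cmeasurableM => //; exact: cintegrable_cmeasurable if_.
- by apply: integrable_scaleR => //; exact: cintegrable_normc.
- by move=> x Dx; rewrite Normc.normcM mulrC ler_wpM2r ?normc_ge0// gM.
Qed.

Lemma cintegrable_pairing U v chi : clocally_integrable U v -> test_fun U chi ->
  cintegrable leb U (fun x => v x * conjc (chi x)).
Proof.
move=> lv tc; have [M M0 chiM] := test_fun_bounded tc; have [oU mv _] := lv.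
have [sc cK KU] := tc.
have mK : measurable (csupp chi) by exact: compact_measurable_rV.
apply: (cintegrable_supp mK _ KU); first exact: open_measurable_rV.
  by move=> x /csupp_out ->; rewrite rmorph0 mulr0.
apply: (@cintegrable_bounded_mul _ M) => //.
- apply: cmeasurable_conj; apply: (cmeasurableS _ _ (csmooth_cmeasurable sc)) => //.
- by move=> x _; rewrite normc_conj.
- exact: clocally_integrableW lv cK KU.
Qed.

Lemma test_funW U U' chi : U `<=` U' -> test_fun U chi -> test_fun U' chi.
Proof. by move=> UU [h1 h2 h3]; split => //; exact: subset_trans UU. Qed.

Lemma test_fun_rbump q q0 n U : rbox R q `<=` rbox R q0 -> crbox R q0 `<=` U ->
  test_fun U (fun x => (rbump q n x)%:C%C : R[i]).
Proof.
move=> qq qU; have sub := @csupp_bump R d _ _ n _ _ qq.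
split.
- split; first exact: smooth_bump.
  exact: smooth_cst.
- apply: (subclosed_compact _ (@compact_cbox _ _ _ _) sub); exact: closed_closure.
- exact: subset_trans qU.
Qed.

(** Only the countable family [rbump q n] is tested: in the uniqueness proof every test function has
    its own null set of times, and only countably many of these can be merged. *)
Lemma du_Bois_Reymond_rbump U v : clocally_integrable U v ->
  (forall q n, test_fun U (fun x => (rbump q n x)%:C%C : R[i]) ->
    cintegral leb U (fun x => v x * (rbump q n x)%:C%C) = 0) ->
  {ae leb, forall x, U x -> v x = 0}.
Proof.
move=> lv v0; have [oU mv _] := lv.
have : {ae leb, forall x, forall q : Qbox, crbox R q `<=` U -> rbox R q x -> v x = 0}.
  apply: ae_countable => q.
  have [qU|qU] := pselect (crbox R q `<=` U); last exact: aeW.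
  have iq : cintegrable leb (rbox R q) v.
    have ic := clocally_integrableW lv (@compact_cbox _ _ _ _) qU.
    apply: cintegrableS ic; [exact: measurable_rbox|exact: measurable_cbox|].
    exact: box_sub_cbox.
  have := dbr_box iq; move=> H.
  apply: (filterS _ (H _)) => [x hx _|q' n qq]; first exact: hx.
  have := v0 _ _ (test_fun_rbump n qq qU); rewrite (@eq_cintegral_supp (rbox R q)).
  - by [].
  - by apply: subset_trans qU; exact: box_sub_cbox.
  - by move=> x hx; rewrite /rbump bump_out ?mulr0// => hx'; exact/hx/qq.
apply: filterS => x h Ux; have := Ux; rewrite (open_bigcup_rbox oU) => -[q /= qU qx].
exact: h qx.
Qed.

Lemma du_Bois_Reymond U v : clocally_integrable U v ->
  (forall chi, test_fun U chi -> cintegral leb U (fun x => v x * conjc (chi x)) = 0) ->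
  {ae leb, forall x, U x -> v x = 0}.
Proof.
move=> lv v0; apply: du_Bois_Reymond_rbump => // q n /v0 <-.
by apply: eq_cintegral => x _; rewrite conjc_real.
Qed.

(** A test function on U is also one on the larger set U', so both densities have the same pairings
    with it, and the fundamental lemma applies to their difference on U. *)
Lemma realization_unique U U' (u : invF_dual R d) v v' : U `<=` U' ->
  realization U u v -> realization U' u v' ->
  {ae leb, forall x, U x -> v x = v' x}.
Proof.
move=> UU [lv hv] [lv' hv'].
have [oU mv vK] := lv; have [oU' mv' vK'] := lv'.
have mU := open_measurable_rV oU; have mU' := open_measurable_rV oU'.
have lv'U : clocally_integrable U v'.
  by split => //; [exact: cmeasurableS mv'|move=> K cK KU; apply: vK' => //; exact: subset_trans UU].
have lB : clocally_integrable U (fun x => v x - v' x).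
  split => //; first by apply: cmeasurableD => //; apply: cmeasurableN; exact: cmeasurableS mv'.
  move=> K cK KU.
  have mK := compact_measurable_rV cK.
  have i1 := clocally_integrableW lv cK KU; have i2 := clocally_integrableW lv'U cK KU.
  have i12 : cintegrable leb K (fun x => v x - v' x).
    by apply: cintegrableD => //; exact: cintegrableN.
  by have /(cintegrableP _ _ mK)[] := i12.
have := du_Bois_Reymond lB; move=> H.
apply: (filterS _ (H _)) => [x hx Ux|chi tc].
  by apply/eqP; rewrite -subr_eq0; apply/eqP; exact: hx.
have [sc cK KU] := tc.
have -> : (fun x => (v x - v' x) * conjc (chi x)) =
    (fun x => v x * conjc (chi x) - v' x * conjc (chi x)).
  by apply/funext => x; rewrite mulrBl.
rewrite cintegralB//; [|exact: cintegrable_pairing..].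
rewrite -hv// hv'; last exact: test_funW tc.
rewrite (@eq_cintegral_supp (csupp chi)) ?subrr//; last 2 first.
- exact: subset_trans UU.
- by move=> x /csupp_out ->; rewrite rmorph0 mulr0.
rewrite [X in _ - X](@eq_cintegral_supp (csupp chi)) ?subrr//.
by move=> x /csupp_out ->; rewrite rmorph0 mulr0.
Qed.

End test_function_pairing.

(** * Poisson kernels *)

Section poisson_kernel.
Context {R : realType}.
Local Notation mu := (@lebesgue_measure R).
Implicit Types (a u t x e : R).

(** The Poisson kernel of the upper half-plane at height e; 2 pi times it is the unnormalized
    Fourier transform of exp(-e|t|). *)
Definition pk e u : R := e / (pi * (e ^+ 2 + u ^+ 2)).

Lemma sqrDsqr_gt0 e u : e != 0 -> 0 < e ^+ 2 + u ^+ 2.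
Proof. by move=> e0; rewrite ltr_pwDl ?sqr_ge0// exprn_even_gt0. Qed.

Lemma pk_ge0 e u : 0 < e -> 0 <= pk e u.
Proof.
move=> e0; rewrite /pk divr_ge0 ?(ltW e0)// mulr_ge0 ?pi_ge0//.
by rewrite ltW// sqrDsqr_gt0 ?gt_eqF.
Qed.

Lemma is_derive_mull a t : is_derive t (1 : R) (fun t => a * t) a.
Proof.
have : is_derive t (1 : R) (a *: (@id R) : R -> R) (a *: 1) by exact: is_deriveZ.
by rewrite /GRing.scale/= mulr1.
Qed.

(** The antiderivative is the real part of (a - iu) exp((a + iu)t), whose derivative is (a^2 + u^2)
    exp((a + iu)t). The next lemma is the imaginary part. *)
Lemma is_derive_expcos a u t : is_derive t (1 : R)
  (fun t => expR (a * t) * (a * cos (u * t) + u * sin (u * t)))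
  ((a ^+ 2 + u ^+ 2) * (expR (a * t) * cos (u * t))).
Proof.
have dE : is_derive t (1 : R) (fun t => expR (a * t)) (expR (a * t) * a).
  exact: (@is_derive1_comp R expR (fun t => a * t) t _ _ _ (is_derive_mull a t)).
have dC : is_derive t (1 : R) (fun t => cos (u * t)) (- sin (u * t) * u).
  exact: (@is_derive1_comp R cos (fun t => u * t) t _ _ _ (is_derive_mull u t)).
have dS : is_derive t (1 : R) (fun t => sin (u * t)) (cos (u * t) * u).
  exact: (@is_derive1_comp R sin (fun t => u * t) t _ _ _ (is_derive_mull u t)).
have dA : is_derive t (1 : R) (fun t => a * cos (u * t)) (a * (- sin (u * t) * u)).
  exact: (@is_deriveZ _ _ _ _ a _ _ _ dC).
have dB : is_derive t (1 : R) (fun t => u * sin (u * t)) (u * (cos (u * t) * u)).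
  exact: (@is_deriveZ _ _ _ _ u _ _ _ dS).
have dAB : is_derive t (1 : R) (fun t => a * cos (u * t) + u * sin (u * t))
    (a * (- sin (u * t) * u) + u * (cos (u * t) * u)).
  exact: (is_deriveD dA dB).
have := @is_deriveM _ _ _ _ _ _ _ _ dE dAB.
apply: is_derive_conv; rewrite /GRing.scale/=; ring.
Qed.

Lemma is_derive_expsin a u t : is_derive t (1 : R)
  (fun t => expR (a * t) * (a * sin (u * t) - u * cos (u * t)))
  ((a ^+ 2 + u ^+ 2) * (expR (a * t) * sin (u * t))).
Proof.
have dE : is_derive t (1 : R) (fun t => expR (a * t)) (expR (a * t) * a).
  exact: (@is_derive1_comp R expR (fun t => a * t) t _ _ _ (is_derive_mull a t)).
have dC : is_derive t (1 : R) (fun t => cos (u * t)) (- sin (u * t) * u).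
  exact: (@is_derive1_comp R cos (fun t => u * t) t _ _ _ (is_derive_mull u t)).
have dS : is_derive t (1 : R) (fun t => sin (u * t)) (cos (u * t) * u).
  exact: (@is_derive1_comp R sin (fun t => u * t) t _ _ _ (is_derive_mull u t)).
have dA : is_derive t (1 : R) (fun t => a * sin (u * t)) (a * (cos (u * t) * u)).
  exact: (@is_deriveZ _ _ _ _ a _ _ _ dS).
have dB : is_derive t (1 : R) (fun t => u * cos (u * t)) (u * (- sin (u * t) * u)).
  exact: (@is_deriveZ _ _ _ _ u _ _ _ dC).
have dAB : is_derive t (1 : R) (fun t => a * sin (u * t) - u * cos (u * t))
    (a * (cos (u * t) * u) - u * (- sin (u * t) * u)).
  exact: (is_deriveB dA dB).
have := @is_deriveM _ _ _ _ _ _ _ _ dE dAB.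
apply: is_derive_conv; rewrite /GRing.scale/=; ring.
Qed.

Lemma is_derive_cts (F f : R -> R) : (forall t, is_derive t (1 : R) F (f t)) ->
  continuous F.
Proof.
move=> dF t; apply: differentiable_continuous; apply/derivable1_diffP.
by have [] := dF t.
Qed.

Lemma Rintegral_FTC2 (F f : R -> R) p q : p <= q -> continuous f ->
  (forall t, is_derive t (1 : R) F (f t)) ->
  \int[mu]_(t in `[p, q]) f t = F q - F p.
Proof.
move=> pq cf dF; have [->|npq] := eqVneq p q.
  by rewrite subrr set_itv1 Rintegral_set1.
have cF := is_derive_cts dF.
rewrite /Rintegral (@continuous_FTC2 _ f F)//.
- by rewrite lt_neqAle npq.
- exact: continuous_subspaceT.
- split.
  + by move=> t _; have [] := dF t.
  + by apply: cvg_at_right_filter; exact: cF.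
  + by apply: cvg_at_left_filter; exact: cF.
- by move=> t _; rewrite derive1E; have [_ ->] := dF t.
Qed.

Lemma continuous_expcos a u : continuous (fun t => expR (a * t) * cos (u * t)).
Proof.
move=> t; apply: cvgM.
  by apply: continuous_comp; [exact: mulrl_continuous|exact: continuous_expR].
by apply: continuous_comp; [exact: mulrl_continuous|exact: continuous_cos].
Qed.

Lemma continuous_expsin a u : continuous (fun t => expR (a * t) * sin (u * t)).
Proof.
move=> t; apply: cvgM.
  by apply: continuous_comp; [exact: mulrl_continuous|exact: continuous_expR].
by apply: continuous_comp; [exact: mulrl_continuous|exact: continuous_sin].
Qed.

Lemma Rintegral_expcos a u p q : a != 0 -> p <= q ->
  \int[mu]_(t in `[p, q]) (expR (a * t) * cos (u * t)) =
  (expR (a * q) * (a * cos (u * q) + u * sin (u * q)) -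
   expR (a * p) * (a * cos (u * p) + u * sin (u * p))) / (a ^+ 2 + u ^+ 2).
Proof.
move=> a0 pq; have q0 := sqrDsqr_gt0 u a0.
have h : continuous (fun t => (a ^+ 2 + u ^+ 2) * (expR (a * t) * cos (u * t))).
  by move=> t; apply: cvgMl_tmp; exact: continuous_expcos.
have := Rintegral_FTC2 pq h (is_derive_expcos a u); rewrite RintegralZl//.
  by move=> <-; rewrite mulrAC divff ?mul1r// gt_eqF.
apply: continuous_compact_integrable; first exact: segment_compact.
by apply: continuous_subspaceT; exact: continuous_expcos.
Qed.

Lemma Rintegral_expsin a u p q : a != 0 -> p <= q ->
  \int[mu]_(t in `[p, q]) (expR (a * t) * sin (u * t)) =
  (expR (a * q) * (a * sin (u * q) - u * cos (u * q)) -
   expR (a * p) * (a * sin (u * p) - u * cos (u * p))) / (a ^+ 2 + u ^+ 2).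
Proof.
move=> a0 pq; have q0 := sqrDsqr_gt0 u a0.
have h : continuous (fun t => (a ^+ 2 + u ^+ 2) * (expR (a * t) * sin (u * t))).
  by move=> t; apply: cvgMl_tmp; exact: continuous_expsin.
have := Rintegral_FTC2 pq h (is_derive_expsin a u); rewrite RintegralZl//.
  by move=> <-; rewrite mulrAC divff ?mul1r// gt_eqF.
apply: continuous_compact_integrable; first exact: segment_compact.
by apply: continuous_subspaceT; exact: continuous_expsin.
Qed.

Lemma cvg_Rintegral_symitv (g : R -> R) x : mu.-integrable setT (EFin \o g) ->
  \int[mu]_(t in `[x - n%:R, x + n%:R]) g t @[n --> \oo] --> \int[mu]_t g t.
Proof.
move=> ig; have mg : measurable_fun setT g.
  by apply/measurable_EFinP; exact: measurable_int ig.
pose h n t := (g t * \1_(`[x - n%:R, x + n%:R]%classic) t)%:E.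
have mh n : measurable_fun [set: measurableTypeR R] (h n).
  by apply/measurable_EFinP; apply: measurable_funM => //; exact: measurable_indic.
have [] := @dominated_convergence _ _ _ mu setT measurableT h (EFin \o g)
  (fun t => `|g t|%:E) mh.
- exact/measurable_EFinP.
- apply: aeW => t _; apply: cvg_EFin; first exact: nearW.
  rewrite -[X in _ --> X]mulr1; apply: cvgMl_tmp.
  apply: cvg_near_cst; near=> n.
  rewrite indicE mem_set//= in_itv/=.
  have : `|t - x| <= n%:R by near: n; exact: nbhs_infty_ger.
  by rewrite ler_norml => /andP[h1 h2]; apply/andP; split; lra.
- exact: (integrable_norm ig).
- apply: aeW => t n _; rewrite lee_fin normrM ler_piMr//.
  by rewrite indicE; case: (_ \in _); rewrite ?normr1 ?normr0.
move=> _ _ hcv.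
have E : (\int[mu]_t (EFin \o g) t = (\int[mu]_t g t)%:E)%E.
  by rewrite /Rintegral fineK//; exact: integrable_fin_num.
rewrite E in hcv; have := fine_cvg hcv.
rewrite (_ : fine \o _ = (fun n => \int[mu]_(t in `[x - n%:R, x + n%:R]) g t)).
  by apply.
apply/funext => n /=; rewrite /Rintegral; congr fine; rewrite [RHS]integral_mkcond; apply: eq_integral => t _.
by rewrite /h /patch indicE/=; case: (t \in _); rewrite ?mulr1 ?mulr0.
Unshelve. all: by end_near. Qed.

Lemma cvg_expRN e : 0 < e -> expR (- e * n%:R) @[n --> \oo] --> (0 : R).
Proof.
move=> e0; rewrite (_ : (fun n => _) = (fun n => expR (- e) ^+ n)).
  by apply: cvg_expr; rewrite ger0_norm ?expR_ge0// expR_lt1 oppr_lt0.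
by apply/funext => n; rewrite expRM_natr.
Qed.

Lemma integrable_expRNnorm e : 0 < e ->
  mu.-integrable setT (EFin \o (fun t => expR (- e * `|t|))).
Proof.
move=> e0; have en0 : - e != 0 by rewrite oppr_eq0 gt_eqF.
have cE : continuous (fun t => expR (- e * t)).
  by move=> t; apply: continuous_comp; [exact: mulrl_continuous|exact: continuous_expR].
have cA : continuous (fun t => expR (- e * `|t|)).
  move=> t; apply: (@continuous_comp _ _ _ (fun t : R => `|t|) (fun t => expR (- e * t))).
    exact: norm_continuous.
  exact: cE.
apply/integrableP; split.
  by apply/measurable_EFinP; exact: continuous_measurable_fun.
under eq_integral do rewrite /= ger0_norm ?expR_ge0//.
rewrite ge0_symfun_integralT//; last by move=> x /=; rewrite normrN.
rewrite (_ : \int[_]_(x in _) _ = (e^-1)%:E)%E; first by rewrite -EFinM ltry.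
transitivity (\int[mu]_(x in `[0%R, +oo[) (expR (- e * x))%:E)%E.
  rewrite -set_itvcy; apply: eq_integral => x; rewrite inE/= in_itv/= andbT => x0.
  by rewrite ger0_norm.
have dF t : is_derive t (1 : R) (fun t => - e^-1 * expR (- e * t)) (expR (- e * t)).
  have dE : is_derive t (1 : R) (fun t => expR (- e * t)) (expR (- e * t) * - e).
    exact: (@is_derive1_comp R expR (fun t => - e * t) t _ _ _ (is_derive_mull (- e) t)).
  have := @is_deriveZ _ _ _ _ (- e^-1) _ _ _ dE.
  by apply: is_derive_conv; rewrite /GRing.scale/=; field; rewrite gt_eqF.
have cF := is_derive_cts dF.
rewrite (@ge0_continuous_FTC2y _ _ (fun t => - e^-1 * expR (- e * t)) 0 0).
- by rewrite mulr0 expR0 mulr1 sub0e EFinN oppeK.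
- by move=> x _; exact: expR_ge0.
- exact: continuous_subspaceT.
- rewrite -[X in _ --> X](mulr0 (- e^-1)); apply: cvgMl_tmp.
  have -> : (fun t => expR (- e * t)) = (fun t => expR (- (e * t))).
    by apply/funext => t; rewrite mulNr.
  apply: (@cvg_comp _ _ _ (fun t => e * t) (fun t => expR (- t)) _ (pinfty_nbhs R)).
    by apply: gt0_cvgMry => //; exact: cvg_id.
  exact: cvgr_expR.
- by move=> x _; have [] := dF x.
- by apply: cvg_at_right_filter; exact: cF.
- by move=> x _; rewrite derive1E; have [_ ->] := dF x.
Qed.

Lemma normr_trig_le (a u t : R) : `|a * cos (u * t) + u * sin (u * t)| <= `|a| + `|u|.
Proof.
rewrite (le_trans (ler_normD _ _))// !normrM lerD// ler_piMr//.
  by rewrite ler_norml cos_geN1 cos_le1.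
by rewrite ler_norml sin_geN1 sin_le1.
Qed.

Lemma cvg_mul_bounded0 (a b : nat -> R) (M : R) : a n @[n --> \oo] --> (0 : R) ->
  (forall n, `|b n| <= M) -> a n * b n @[n --> \oo] --> (0 : R).
Proof.
move=> a0 bM; apply/norm_cvg0P.
have M0 : 0 <= M by exact: le_trans (bM 0%N).
apply: (@squeeze_cvgr _ _ _ _ (fun=> 0) (fun n => `|a n| * M)).
- by apply: nearW => n; rewrite normr_ge0 normrM ler_wpM2l.
- exact: cvg_cst.
- rewrite -(mul0r M); apply: cvgMr_tmp.
  by rewrite -(@normr0 _ R); apply: cvg_norm.
Qed.

Lemma Rintegral_itv_split0 (g : R -> R) n : mu.-integrable setT (EFin \o g) ->
  \int[mu]_(t in `[- n%:R, n%:R]) g t =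
  \int[mu]_(t in `[- n%:R, 0]) g t + \int[mu]_(t in `[0, n%:R]) g t.
Proof.
move=> ig.
have ic : mu.-integrable `[- n%:R, n%:R] (EFin \o g) by exact: integrableS ig.
have := @Rintegral_itvB R g (BLeft (- n%:R)) (BRight n%:R) 0 ic.
rewrite !bnd_simp oppr_le0 ler0n => /(_ isT isT) E.
rewrite -(@Rintegral_itv_obnd_cbnd _ 0); last by apply: integrableS ig.
by rewrite -E; ring.
Qed.

Lemma Rintegral_poisson_cos e u : 0 < e ->
  \int[mu]_t (expR (- e * `|t|) * cos (u * t)) = 2 * pi * pk e u.
Proof.
move=> e0; have en0 : e != 0 by rewrite gt_eqF.
have q0 := sqrDsqr_gt0 u en0.
have ig : mu.-integrable setT (EFin \o (fun t => expR (- e * `|t|) * cos (u * t))).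
  rewrite (_ : (fun t => _) = (fun t => cos (u * t) * expR (- e * `|t|))).
    apply: (@integrable_bounded_mul _ _ _ _ _ measurableT 1).
    - apply: continuous_measurable_fun => t; apply: continuous_comp.
        exact: mulrl_continuous.
      exact: continuous_cos.
    - by move=> t _; rewrite ler_norml cos_geN1 cos_le1.
    - exact: integrable_expRNnorm.
  by apply/funext => t; rewrite mulrC.
have cv := cvg_Rintegral_symitv 0 ig.
rewrite -(cvg_lim (@Rhausdorff R) cv); apply: cvg_lim; first exact: Rhausdorff.
(* The boundary terms at n and -n, damped by exp(-e n); the two boundary terms at 0 add up to 2
   e. *)
pose r n : R := expR (- e * n%:R) *
  ((- e * cos (u * n%:R) + u * sin (u * n%:R)) - (e * cos (u * - n%:R) + u * sin (u * - n%:R))).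
have -> : (fun n : nat => \int[mu]_(t in `[0 - n%:R, 0 + n%:R])
    (expR (- e * `|t|) * cos (u * t))) = (fun n => (r n + 2 * e) / (e ^+ 2 + u ^+ 2)).
  apply/funext => n; rewrite sub0r add0r Rintegral_itv_split0//.
  have -> : \int[mu]_(t in `[- n%:R, 0]) (expR (- e * `|t|) * cos (u * t)) =
      \int[mu]_(t in `[- n%:R, 0]) (expR (e * t) * cos (u * t)).
    apply: eq_Rintegral => t; rewrite inE/= in_itv/= => /andP[_ t0].
    by rewrite ler0_norm// mulrNN.
  have -> : \int[mu]_(t in `[0, n%:R]) (expR (- e * `|t|) * cos (u * t)) =
      \int[mu]_(t in `[0, n%:R]) (expR (- e * t) * cos (u * t)).
    apply: eq_Rintegral => t; rewrite inE/= in_itv/= => /andP[t0 _].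
    by rewrite ger0_norm.
  rewrite !Rintegral_expcos ?oppr_eq0// ?oppr_le0// sqrrN -mulrDl; congr (_ / _).
  by rewrite !mulr0 expR0 sin0 cos0 /r (mulrN e) (mulNr e n%:R); ring.
rewrite (_ : 2 * pi * pk e u = (0 + 2 * e) / (e ^+ 2 + u ^+ 2)); last first.
  rewrite /pk add0r; have : pi != 0 :> R by rewrite gt_eqF ?pi_gt0.
  move: (gt_eqF q0) (@pi R) => /negbT q0' p p0; field.
  by rewrite q0'.
apply: cvgMr_tmp; apply: cvgD; last exact: cvg_cst.
apply: (@cvg_mul_bounded0 _ _ ((e + `|u|) + (e + `|u|))); first exact: cvg_expRN.
move=> n; rewrite (le_trans (ler_normB _ _))// lerD//.
  by rewrite (le_trans (normr_trig_le _ _ _))// normrN gtr0_norm.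
by rewrite (le_trans (normr_trig_le _ _ _))// gtr0_norm.
Qed.

(** The integrand is odd: the contributions of the two halves of [-n, n] cancel for every n. *)
Lemma Rintegral_poisson_sin e u : 0 < e ->
  \int[mu]_t (expR (- e * `|t|) * sin (u * t)) = 0.
Proof.
move=> e0; have en0 : e != 0 by rewrite gt_eqF.
have q0 := sqrDsqr_gt0 u en0.
have ig : mu.-integrable setT (EFin \o (fun t => expR (- e * `|t|) * sin (u * t))).
  rewrite (_ : (fun t => _) = (fun t => sin (u * t) * expR (- e * `|t|))).
    apply: (@integrable_bounded_mul _ _ _ _ _ measurableT 1).
    - apply: continuous_measurable_fun => t; apply: continuous_comp.
        exact: mulrl_continuous.
      exact: continuous_sin.
    - by move=> t _; rewrite ler_norml sin_geN1 sin_le1.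
    - exact: integrable_expRNnorm.
  by apply/funext => t; rewrite mulrC.
have cv := cvg_Rintegral_symitv 0 ig.
rewrite -(cvg_lim (@Rhausdorff R) cv); apply: cvg_lim; first exact: Rhausdorff.
have -> : (fun n : nat => \int[mu]_(t in `[0 - n%:R, 0 + n%:R])
    (expR (- e * `|t|) * sin (u * t))) = (fun n => 0); last exact: cvg_cst.
apply/funext => n; rewrite sub0r add0r Rintegral_itv_split0//.
have -> : \int[mu]_(t in `[- n%:R, 0]) (expR (- e * `|t|) * sin (u * t)) =
    \int[mu]_(t in `[- n%:R, 0]) (expR (e * t) * sin (u * t)).
  apply: eq_Rintegral => t; rewrite inE/= in_itv/= => /andP[_ t0].
  by rewrite ler0_norm// mulrNN.
have -> : \int[mu]_(t in `[0, n%:R]) (expR (- e * `|t|) * sin (u * t)) =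
    \int[mu]_(t in `[0, n%:R]) (expR (- e * t) * sin (u * t)).
  apply: eq_Rintegral => t; rewrite inE/= in_itv/= => /andP[t0 _].
  by rewrite ger0_norm.
rewrite !Rintegral_expsin ?oppr_eq0// ?oppr_le0// sqrrN -mulrDl.
rewrite !mulr0 expR0 sin0 cos0 (mulrN e) (mulNr e n%:R) (mulrN u) sinN cosN.
by rewrite [X in X / _](_ : _ = 0) ?mul0r//; ring.
Qed.

Lemma cintegral_poisson e u : 0 < e ->
  cintegrable mu setT (fun t => (expR (- e * `|t|))%:C%C * cexp (Complex 0 (u * t))) /\
  cintegral mu setT (fun t => (expR (- e * `|t|))%:C%C * cexp (Complex 0 (u * t))) =
  (2 * pi * pk e u)%:C%C.
Proof.
move=> e0; split.
  apply: (@cintegrable_le R _ (measurableTypeR R) mu setT _ (fun t : R => expR (- e * `|t|))) => //.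
  - apply: cmeasurableM.
      apply: cmeasurable_real.
      by apply/measurable_EFinP; exact: measurable_int (integrable_expRNnorm e0).
    apply: cmeasurable_cexp => //; split => /=; first exact: measurable_cst.
    by apply: measurable_funM => //; exact: measurable_cst.
  - exact: integrable_expRNnorm.
  - move=> t _; rewrite Normc.normcM normc_real normc_cexp/= expR0 mulr1.
    by rewrite ger0_norm// expR_ge0.
apply: complex_ext => /=.
  rewrite -(Rintegral_poisson_cos u e0); apply: eq_Rintegral => t _.
  by rewrite expR0; ring.
rewrite -[RHS](Rintegral_poisson_sin u e0); apply: eq_Rintegral => t _.
by rewrite expR0; ring.
Qed.

End poisson_kernel.

(** * Absolutely continuous primitives and the scalar linear equation *)

Section primitives.
Context {R : realType}.
Local Notation mu := (@lebesgue_measure R).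
Implicit Types (f g F G V D : R -> R).

(* Bisecting at the midpoint value of [V] halves the constant. *)
Lemma quadratic_increment_cst D V (a b C : R) : a <= b ->
  {within `[a, b], continuous V} ->
  (forall s t, a <= s -> s <= t -> t <= b -> V s <= V t) ->
  (forall s t, a <= s -> s <= t -> t <= b ->
    `|D t - D s| <= C * (V t - V s) ^+ 2) ->
  D b = D a.
Proof.
move=> ab cV ndV quad.
have half n s t : a <= s -> s <= t -> t <= b ->
    `|D t - D s| <= C / 2 ^+ n * (V t - V s) ^+ 2.
  elim: n s t => [|n IH] s t as_ st tb.
    by rewrite expr0 divr1 quad.
  have [m mst Vm] : exists2 m, m \in `[s, t] & V m = (V s + V t) / 2.
    apply: IVT => //.
    apply: continuous_subspaceW cV => x /=; rewrite !in_itv/= => /andP[h1 h2].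
    by rewrite (le_trans as_ h1) (le_trans h2 tb).
    have := ndV s t as_ st tb => Vst.
    by rewrite (min_idPl Vst) (max_idPr Vst); apply/andP; split; lra.
  move: mst; rewrite in_itv/= => /andP[sm mt].
  have h1 := IH s m as_ sm (le_trans mt tb).
  have h2 := IH m t (le_trans as_ sm) mt tb.
  rewrite (_ : D t - D s = (D t - D m) + (D m - D s)); last by ring.
  rewrite (le_trans (ler_normD _ _))// (le_trans (lerD h2 h1))//.
  rewrite Vm le_eqVlt; apply/orP; left; apply/eqP; rewrite [2 ^+ n.+1]exprS; field.
  by rewrite expf_neq0.
apply/eqP; rewrite -subr_eq0 -normr_eq0; apply/eqP/le_anti; rewrite normr_ge0 andbT.
rewrite leNgt; apply/negP => x0.
set x := `|D b - D a| in x0; set K := C * (V b - V a) ^+ 2.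
have xK n : x * n%:R <= K.
  have := half n a b (lexx _) ab (lexx _); rewrite -/x mulrAC -/K.
  rewrite ler_pdivlMr ?exprn_gt0// => h.
  apply: le_trans h; rewrite ler_wpM2l// ?ltW//.
  by rewrite -[2]/(2%:R) -natrX ltr_nat ltn_expl.
have := xK (Num.truncn (K / x)).+1; apply/negP; rewrite -ltNge.
by rewrite mulrC -ltr_pdivrMr// truncnS_gt.
Qed.

Variable t1 : R.
Hypothesis t10 : 0 <= t1.

(** Absolute continuity on [0, t1] with density f, encoded by the integral identity, so that the
    rules below become statements about increments. *)
Definition prim f F := mu.-integrable `]0, t1[ (EFin \o f) /\
  forall t, 0 <= t <= t1 -> F t = F 0 + \int[mu]_(r in `]0, t[) f r.

Lemma itvoo_sub (s t : R) : 0 <= s -> t <= t1 -> `]s, t[%classic `<=` `]0, t1[%classic.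
Proof.
move=> s0 tt x /=; rewrite !in_itv/= => /andP[h1 h2].
by rewrite (le_lt_trans s0 h1) (lt_le_trans h2 tt).
Qed.

Lemma integrable_itvoo f (s t : R) : 0 <= s -> t <= t1 ->
  mu.-integrable `]0, t1[ (EFin \o f) -> mu.-integrable `]s, t[ (EFin \o f).
Proof.
move=> s0 tt; apply: integrableS => //.
exact: itvoo_sub.
Qed.

(** The two open intervals miss only the point s, which is negligible; the degenerate cases s = t
    and s = 0 are treated apart. *)
Lemma Rintegral_itvoo_split f (s t : R) : 0 <= s -> s <= t -> t <= t1 ->
  mu.-integrable `]0, t1[ (EFin \o f) ->
  \int[mu]_(r in `]0, t[) f r = \int[mu]_(r in `]0, s[) f r +
    \int[mu]_(r in `]s, t[) f r.
Proof.
move=> s0 st tt if_.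
have [->|ns] := eqVneq s t.
  by rewrite [X in _ + X](_ : _ = 0) ?addr0// set_itvoo0 Rintegral_set0.
have [e|n0] := eqVneq 0 s.
  by rewrite -e [X in X + _](_ : _ = 0) ?add0r// set_itvoo0 Rintegral_set0.
have sp : 0 < s by rewrite lt_neqAle n0.
have sl : s < t by rewrite lt_neqAle ns.
have iot : mu.-integrable `]0, t[ (EFin \o f) by exact: integrable_itvoo.
have mt : measurable_fun `]0, t[ f by apply/measurable_EFinP; exact: measurable_int iot.
have := @Rintegral_itvB R f (BRight 0) (BLeft t) s iot.
rewrite !bnd_simp => /(_ s0 sl) <-.
rewrite -(@Rintegral_itv_bndo_bndc _ (BRight 0) s); last first.
  apply: integrable_itvoo => //; exact: le_trans st tt.
by ring.
Qed.

Lemma Rintegral_itvoo_le f (s t : R) : (forall x, 0 <= f x) -> 0 <= s -> s <= t ->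
  t <= t1 -> mu.-integrable `]0, t1[ (EFin \o f) ->
  \int[mu]_(r in `]0, s[) f r <= \int[mu]_(r in `]0, t[) f r.
Proof.
move=> f0 s0 st tt if_; rewrite (Rintegral_itvoo_split s0 st tt if_) lerDl.
exact: Rintegral_ge0.
Qed.

Lemma prim_incr f F (s t : R) : prim f F -> 0 <= s -> s <= t -> t <= t1 ->
  F t - F s = \int[mu]_(r in `]s, t[) f r.
Proof.
move=> [if_ Ff] s0 st tt.
rewrite Ff; last by rewrite (le_trans s0 st) tt.
rewrite (Ff s); last by rewrite s0 (le_trans st tt).
by rewrite (Rintegral_itvoo_split s0 st tt if_); ring.
Qed.

Lemma continuous_Rintegral_itvoo f : mu.-integrable `]0, t1[ (EFin \o f) ->
  {within `[0, t1], continuous (fun t => \int[mu]_(r in `]0, t[) f r)}.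
Proof.
(* Extension by 0 makes f integrable on the closed interval, where continuity of the indefinite
   integral is available; the endpoints are negligible. *)
move=> if_; pose h := f \_ `]0, t1[.
have ih : mu.-integrable setT (EFin \o h).
  exact: (integrable_patchR mu (measurable_itv _) f).1 if_.
have ihc : mu.-integrable `[0, t1] (EFin \o h) by exact: integrableS ih.
have := @parameterized_integral_continuous R 0 t1 h t10 ihc.
apply: subspace_eq_continuous => x; rewrite inE/= in_itv/= => /andP[x0 xt].
transitivity (\int[mu]_(r in `[0, x]) h r); first by [].
rewrite -Rintegral_itv_obnd_cbnd; last first.
  by apply: integrableS ih.
rewrite -Rintegral_itv_bndo_bndc; last by apply: integrableS ih.
apply: eq_Rintegral => r; rewrite inE => rx.
by rewrite /h patchE mem_set//; apply: itvoo_sub rx.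
Qed.

Lemma prim_continuous f F : prim f F -> {within `[0, t1], continuous F}.
Proof.
move=> [if_ Ff]; have c := continuous_Rintegral_itvoo if_.
have : {within `[0, t1], continuous (fun t => F 0 + \int[mu]_(r in `]0, t[) f r)}.
  by move=> x; apply: cvgD; [exact: cvg_cst|exact: c].
apply: subspace_eq_continuous => x; rewrite inE/= in_itv/= => /Ff.
exact: esym.
Qed.

Lemma prim_measurable f F : prim f F -> measurable_fun `]0, t1[ F.
Proof.
move=> /prim_continuous cF.
apply: (@measurable_funS _ _ _ _ `[0, t1]%classic) => //.
  exact: subset_itv_oo_cc.
exact: subspace_continuous_measurable_fun.
Qed.

Lemma prim_le f F t : prim f F -> 0 <= t <= t1 ->
  `|F t| <= `|F 0| + \int[mu]_(r in `]0, t1[) `|f r|.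
Proof.
move=> [if_ Ff] tt; rewrite Ff// (le_trans (ler_normD _ _))// lerD2l.
have /andP[t0 tl] := tt.
have i_t : mu.-integrable `]0, t[ (EFin \o f) by exact: integrable_itvoo.
rewrite (le_trans (le_normr_Rintegral _ i_t))//.
by apply: (@Rintegral_itvoo_le (fun r => `|f r|)) => //; exact: integrable_norm.
Qed.

Lemma prim_integrable_mul f F g : prim f F ->
  mu.-integrable `]0, t1[ (EFin \o g) ->
  mu.-integrable `]0, t1[ (EFin \o (fun r => F r * g r)).
Proof.
move=> pF; apply: (@integrable_bounded_mul _ _ _ mu _ _
  (`|F 0| + \int[mu]_(r in `]0, t1[) `|f r|)) => //.
  exact: prim_measurable pF.
by move=> x /=; rewrite in_itv/= => /andP[x0 xt]; rewrite prim_le// !ltW.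
Qed.

(** The defect D of the product rule has, from s to u, the increment (F u - F s)(G u - G s) minus
    the error made by freezing F and G at s under the integral. With V the primitive of |f| + |g|,
    each part is at most (V u - V s)^2, so the quadratic criterion applies with constant 2. *)
Lemma primM f F g G : prim f F -> prim g G ->
  prim (fun r => G r * f r + F r * g r) (fun r => F r * G r).
Proof.
move=> pF pG; have [if_ Ff] := pF; have [ig Gg] := pG.
have i1 := prim_integrable_mul pG if_; have i2 := prim_integrable_mul pF ig.
have i12 : mu.-integrable `]0, t1[ (EFin \o (fun r => G r * f r + F r * g r)).
  exact: integrable_addR.
split=> // t /andP[t0 tt].
pose V s := \int[mu]_(r in `]0, s[) (`|f r| + `|g r|).
have iv : mu.-integrable `]0, t1[ (EFin \o (fun r => `|f r| + `|g r|)).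
  by apply: integrable_addR => //; exact: integrable_norm.
have Vincr (s u : R) : 0 <= s -> s <= u -> u <= t ->
    V u - V s = \int[mu]_(r in `]s, u[) (`|f r| + `|g r|).
  move=> s0 su ut; rewrite /V (Rintegral_itvoo_split s0 su (le_trans ut tt) iv).
  by ring.
pose D s := F s * G s - \int[mu]_(r in `]0, s[) (G r * f r + F r * g r).
suff : D t = D 0.
  by rewrite /D set_itvoo0 Rintegral_set0 => /eqP; rewrite subr0 subr_eq => /eqP.
apply: (@quadratic_increment_cst D V 0 t 2) => //.
- apply: (@continuous_subspaceW _ _ _ `[0, t1]%classic).
    by move=> x /=; rewrite !in_itv/= => /andP[-> h]; rewrite (le_trans h).
  exact: continuous_Rintegral_itvoo.
- move=> s u s0 su ut; apply: Rintegral_itvoo_le => //; exact: le_trans ut tt.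
move=> s u s0 su ut; have utt := le_trans ut tt.
have dV0 : 0 <= V u - V s.
  by rewrite Vincr//; apply: Rintegral_ge0 => r _; rewrite addr_ge0.
have ivu : mu.-integrable `]s, u[ (EFin \o (fun r => `|f r| + `|g r|)).
  exact: integrable_itvoo.
have dle (h H : R -> R) (w : R) : prim h H ->
    (forall r, `|h r| <= `|f r| + `|g r|) -> s <= w <= u ->
    `|H w - H s| <= V u - V s.
  move=> pH hle /andP[sw wu]; have [ih _] := pH.
  have wt := le_trans wu utt.
  rewrite (prim_incr pH)//.
  have ihw : mu.-integrable `]s, w[ (EFin \o h) by exact: integrable_itvoo.
  have ivw : mu.-integrable `]s, w[ (EFin \o (fun r => `|f r| + `|g r|)).
    exact: integrable_itvoo.
  rewrite (le_trans (le_normr_Rintegral _ ihw))//.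
  apply: (@le_trans _ _ (\int[mu]_(r in `]s, w[) (`|f r| + `|g r|))).
    by apply: le_Rintegral => //; exact: integrable_norm.
  rewrite -Vincr ?(le_trans wu)// lerD2r.
  apply: Rintegral_itvoo_le => //; exact: le_trans s0 sw.
have fle r : `|f r| <= `|f r| + `|g r| by rewrite lerDl.
have gle r : `|g r| <= `|f r| + `|g r| by rewrite lerDr.
have dF w := dle f F w pF fle; have dG w := dle g G w pG gle.
have ifu : mu.-integrable `]s, u[ (EFin \o f) by exact: integrable_itvoo.
have igu : mu.-integrable `]s, u[ (EFin \o g) by exact: integrable_itvoo.
have iGs : mu.-integrable `]s, u[ (EFin \o (fun r => G s * f r)).
  exact: integrable_scaleR.
have iFs : mu.-integrable `]s, u[ (EFin \o (fun r => F s * g r)).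
  exact: integrable_scaleR.
have i12u : mu.-integrable `]s, u[ (EFin \o (fun r => G r * f r + F r * g r)).
  exact: integrable_itvoo.
have iGF : mu.-integrable `]s, u[ (EFin \o (fun r => G s * f r + F s * g r)).
  exact: integrable_addR.
have -> : D u - D s = (F u - F s) * (G u - G s) -
    \int[mu]_(r in `]s, u[) ((G r * f r + F r * g r) - (G s * f r + F s * g r)).
  rewrite RintegralB//.
  have -> : \int[mu]_(r in `]s, u[) (G s * f r + F s * g r) =
      G s * \int[mu]_(r in `]s, u[) f r + F s * \int[mu]_(r in `]s, u[) g r.
    by rewrite RintegralD//; congr (_ + _); rewrite RintegralZl.
  rewrite -(prim_incr pF)// -(prim_incr pG)//.
  rewrite /D (Rintegral_itvoo_split s0 su utt i12); ring.
rewrite (le_trans (ler_normB _ _))// mulr_natl mulr2n lerD//.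
  by rewrite normrM expr2 ler_pM//; [apply: dF|apply: dG]; rewrite su lexx.
have iB : mu.-integrable `]s, u[
    (EFin \o (fun r => (G r * f r + F r * g r) - (G s * f r + F s * g r))).
  exact: integrable_subR.
rewrite (le_trans (le_normr_Rintegral _ iB))//.
rewrite expr2 [X in _ <= _ * X]Vincr// -RintegralZl//.
apply: le_Rintegral => //; first exact: integrable_norm.
  exact: integrable_scaleR.
move=> r; rewrite /= in_itv/= => /andP[sr ru].
rewrite (_ : _ - _ = (G r - G s) * f r + (F r - F s) * g r); last by ring.
rewrite (le_trans (ler_normD _ _))// !normrM mulrDr lerD// ler_wpM2r//.
  by apply: dG; rewrite !ltW.
by apply: dF; rewrite !ltW.
Qed.

(** Stated without an order between x and y, and with the intermediate point kept in [-M, M], where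
    bounds on the derivatives are at hand. *)
Lemma MVT_le (Phi Phi1 : R -> R) (M x y : R) :
  (forall x : R, is_derive x (1 : R) Phi (Phi1 x)) -> `|x| <= M -> `|y| <= M ->
  exists c, [/\ `|c| <= M, `|c - x| <= `|y - x| &
    Phi y - Phi x = Phi1 c * (y - x)].
Proof.
move=> dPhi.
have main u v : u <= v -> exists2 c, u <= c <= v & Phi v - Phi u = Phi1 c * (v - u).
  move=> uv.
  have [c] : exists2 c, c \in `[u, v] & Phi v - Phi u = Phi1 c * (v - u).
    apply: MVT_segment => //.
    apply: continuous_subspaceT => z; apply: differentiable_continuous.
    by apply/derivable1_diffP; have [] := dPhi z.
  by rewrite in_itv; exists c.
rewrite !ler_norml => /andP[x1 x2] /andP[y1 y2].
have [xy|/ltW yx] := leP x y.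
  have [c /andP[c1 c2] e] := main _ _ xy; exists c; split => //.
    by rewrite ler_norml; apply/andP; split; lra.
  by rewrite !ger0_norm; lra.
have [c /andP[c1 c2] e] := main _ _ yx; exists c; split.
- by rewrite ler_norml; apply/andP; split; lra.
- by rewrite !ler0_norm; lra.
- by rewrite -opprB e; ring.
Qed.

(** Same scheme as for products: the increment of the defect is the first-order Taylor remainder of
    [Phi] minus the error made by freezing [Phi1 (F r)] at r = s. Each is at most C (V u - V s)^2,
    with V the primitive of |f| and C a bound for [Phi1] and [Phi2] on an interval containing the
    range of F. *)
Lemma prim_comp (Phi Phi1 Phi2 : R -> R) f F :
  (forall x : R, is_derive x (1 : R) Phi (Phi1 x)) ->
  (forall x : R, is_derive x (1 : R) Phi1 (Phi2 x)) ->
  (forall M, exists C, forall x, `|x| <= M -> `|Phi1 x| <= C /\ `|Phi2 x| <= C) ->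
  prim f F -> prim (fun r => Phi1 (F r) * f r) (fun r => Phi (F r)).
Proof.
move=> dPhi dPhi1 Phib pF; have [if_ Ff] := pF.
set M := `|F 0| + \int[mu]_(r in `]0, t1[) `|f r|.
have FM t : 0 <= t <= t1 -> `|F t| <= M by exact: prim_le.
have [C PhiC] := Phib M.
have C0 : 0 <= C.
  have [] := PhiC (F 0) (FM 0 _); first by rewrite lexx.
  by move=> h _; apply: le_trans h.
have i1 : mu.-integrable `]0, t1[ (EFin \o (fun r => Phi1 (F r) * f r)).
  apply: (@integrable_bounded_mul _ _ _ mu _ _ C) => //.
    apply: (@measurableT_comp _ _ _ _ _ _ Phi1); last exact: prim_measurable pF.
    apply: continuous_measurable_fun => x; apply: differentiable_continuous.
    by apply/derivable1_diffP; have [] := dPhi1 x.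
  move=> x /=; rewrite in_itv/= => /andP[x0 xt].
  by have [] := PhiC (F x) (FM x _); first by rewrite !ltW.
split=> // t /andP[t0 tt].
pose V s := \int[mu]_(r in `]0, s[) `|f r|.
have iv : mu.-integrable `]0, t1[ (EFin \o (fun r => `|f r|)).
  exact: integrable_norm.
have Vincr (s u : R) : 0 <= s -> s <= u -> u <= t ->
    V u - V s = \int[mu]_(r in `]s, u[) `|f r|.
  move=> s0 su ut; rewrite /V (Rintegral_itvoo_split s0 su (le_trans ut tt) iv).
  by ring.
pose D s := Phi (F s) - \int[mu]_(r in `]0, s[) (Phi1 (F r) * f r).
suff : D t = D 0.
  by rewrite /D set_itvoo0 Rintegral_set0 => /eqP; rewrite subr0 subr_eq => /eqP.
apply: (@quadratic_increment_cst D V 0 t (2 * C)) => //.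
- apply: (@continuous_subspaceW _ _ _ `[0, t1]%classic).
    by move=> x /=; rewrite !in_itv/= => /andP[-> h]; rewrite (le_trans h).
  exact: continuous_Rintegral_itvoo.
- move=> s u s0 su ut; apply: Rintegral_itvoo_le => //.
  exact: le_trans ut tt.
move=> s u s0 su ut; have utt := le_trans ut tt.
have dV0 : 0 <= V u - V s by rewrite Vincr//; apply: Rintegral_ge0.
have dF w : s <= w <= u -> `|F w - F s| <= V u - V s.
  move=> /andP[sw wu]; have wt := le_trans wu utt.
  have ifw : mu.-integrable `]s, w[ (EFin \o f) by exact: integrable_itvoo.
  rewrite (prim_incr pF)// (le_trans (le_normr_Rintegral _ ifw))//.
  rewrite -Vincr ?(le_trans wu)// lerD2r.
  by apply: Rintegral_itvoo_le => //; exact: le_trans s0 sw.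
have ifu : mu.-integrable `]s, u[ (EFin \o f) by exact: integrable_itvoo.
have i1u : mu.-integrable `]s, u[ (EFin \o (fun r => Phi1 (F r) * f r)).
  exact: integrable_itvoo.
have isu : mu.-integrable `]s, u[ (EFin \o (fun r => Phi1 (F s) * f r)).
  exact: integrable_scaleR.
have -> : D u - D s = (Phi (F u) - Phi (F s) - Phi1 (F s) * (F u - F s)) -
    \int[mu]_(r in `]s, u[) (Phi1 (F r) * f r - Phi1 (F s) * f r).
  rewrite RintegralB// RintegralZl// -(prim_incr pF)//.
  rewrite /D (Rintegral_itvoo_split s0 su utt i1); ring.
have Fs : `|F s| <= M by apply: FM; rewrite s0 (le_trans su).
have Phi1L w : s <= w <= u -> `|Phi1 (F w) - Phi1 (F s)| <= C * (V u - V s).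
  move=> /andP[sw wu].
  have Fw : `|F w| <= M by apply: FM; rewrite (le_trans s0 sw) (le_trans wu).
  have [c [cM cd ->]] := MVT_le dPhi1 Fs Fw.
  rewrite normrM ler_pM//; first by have [] := PhiC c cM.
  by apply: dF; rewrite sw wu.
rewrite (le_trans (ler_normB _ _))// -mulrA mulr_natl mulr2n lerD//.
  have Fu : `|F u| <= M by apply: FM; rewrite (le_trans s0 su).
  have [c [cM cd ->]] := MVT_le dPhi Fs Fu.
  rewrite -mulrBl normrM expr2 mulrA ler_pM//; last by apply: dF; rewrite su lexx.
  have [e [eM ed ->]] := MVT_le dPhi1 Fs cM.
  rewrite normrM ler_pM//; first by have [] := PhiC e eM.
  by rewrite (le_trans cd)//; apply: dF; rewrite su lexx.
have iB : mu.-integrable `]s, u[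
    (EFin \o (fun r => Phi1 (F r) * f r - Phi1 (F s) * f r)).
  exact: integrable_subR.
rewrite (le_trans (le_normr_Rintegral _ iB))//.
rewrite expr2 mulrA [X in _ <= _ * X]Vincr// -RintegralZl//; last first.
  exact: integrable_itvoo.
apply: le_Rintegral => //; first exact: integrable_norm.
  by apply: integrable_scaleR => //; exact: integrable_itvoo.
move=> r; rewrite /= in_itv/= => /andP[sr ru].
by rewrite -mulrBl normrM ler_wpM2r//; apply: Phi1L; rewrite !ltW.
Qed.

Lemma prim_expR f F : prim f F ->
  prim (fun r => expR (F r) * f r) (fun r => expR (F r)).
Proof.
apply: (@prim_comp expR expR expR) => // M; exists (expR M) => x xM.
have h : `|expR x| <= expR M.
  by rewrite ger0_norm ?expR_ge0// ler_expR (le_trans (ler_norm _)).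
by [].
Qed.

Lemma normr_cos_le1 x : `|cos x : R| <= 1.
Proof. by rewrite ler_norml cos_geN1 cos_le1. Qed.

Lemma normr_sin_le1 x : `|sin x : R| <= 1.
Proof. by rewrite ler_norml sin_geN1 sin_le1. Qed.

Lemma prim_cos f F : prim f F ->
  prim (fun r => - sin (F r) * f r) (fun r => cos (F r)).
Proof.
apply: (@prim_comp cos (fun x => - sin x) (fun x => - cos x)).
by move=> M; exists 1 => x _; rewrite !normrN normr_cos_le1 normr_sin_le1.
Qed.

Lemma prim_sin f F : prim f F ->
  prim (fun r => cos (F r) * f r) (fun r => sin (F r)).
Proof.
apply: (@prim_comp sin cos (fun x => - sin x)).
by move=> M; exists 1 => x _; rewrite !normrN normr_cos_le1 normr_sin_le1.
Qed.

Lemma prim_ext f g F G : (forall r, f r = g r) -> (forall r, F r = G r) ->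
  prim f F -> prim g G.
Proof. by move=> /funext -> /funext ->. Qed.

Lemma primD f F g G : prim f F -> prim g G ->
  prim (fun r => f r + g r) (fun r => F r + G r).
Proof.
move=> [if_ Ff] [ig Gg]; split; first exact: integrable_addR.
move=> t tt; have /andP[t0 tl] := tt.
rewrite RintegralD//; [|exact: integrable_itvoo..].
by rewrite Ff// Gg//; ring.
Qed.

Lemma primN f F : prim f F -> prim (fun r => - f r) (fun r => - F r).
Proof.
move=> [if_ Ff].
have oppE g : (fun r => - g r) = (fun r => (-1) * g r :> R).
  by apply/funext => r; rewrite mulN1r.
rewrite (oppE f); split; first exact: integrable_scaleR.
move=> t tt; have /andP[t0 tl] := tt.
by rewrite RintegralZl//; [rewrite Ff//; ring|exact: integrable_itvoo].
Qed.

End primitives.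

Section complex_primitives.
Context {R : realType}.
Local Notation mu := (@lebesgue_measure R).
Variable t1 : R.
Hypothesis t10 : 0 <= t1.
Implicit Types (f g F G : R -> R[i]).

Definition cprim f F := prim t1 (Re \o f) (Re \o F) /\ prim t1 (Im \o f) (Im \o F).

Lemma cprimP f F : cprim f F <-> cintegrable mu `]0, t1[ f /\
  forall t, 0 <= t <= t1 -> F t = F 0 + cintegral mu `]0, t[ f.
Proof.
split=> [[[i1 h1] [i2 h2]]|[[i1 i2] h]].
  by split=> // t tt; apply: complex_ext; rewrite !ReIm_simp; [exact: h1|exact: h2].
by split; split => // t tt /=; rewrite h// !ReIm_simp.
Qed.

Lemma cprim_ext f g F G : (forall r, f r = g r) -> (forall r, F r = G r) ->
  cprim f F -> cprim g G.
Proof. by move=> /funext -> /funext ->. Qed.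

Lemma cprimM f F g G : cprim f F -> cprim g G ->
  cprim (fun r => G r * f r + F r * g r) (fun r => F r * G r).
Proof.
move=> [f1 f2] [g1 g2]; split.
  apply: (prim_ext _ _ (primD (primM t10 f1 g1) (primN (primM t10 f2 g2)))).
    by move=> r /=; rewrite !ReIm_simp; ring.
  by move=> r /=; rewrite !ReIm_simp; ring.
apply: (prim_ext _ _ (primD (primM t10 f1 g2) (primM t10 f2 g1))).
  by move=> r /=; rewrite !ReIm_simp; ring.
by move=> r /=; rewrite !ReIm_simp; ring.
Qed.

Lemma cprim_cexp f F : cprim f F ->
  cprim (fun r => cexp (F r) * f r) (fun r => cexp (F r)).
Proof.
move=> [f1 f2]; split.
  apply: (prim_ext _ _ (primM t10 (prim_expR t10 f1) (prim_cos t10 f2))) => // r /=.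
  by rewrite !ReIm_simp /=; ring.
apply: (prim_ext _ _ (primM t10 (prim_expR t10 f1) (prim_sin t10 f2))) => // r /=.
by rewrite !ReIm_simp /=; ring.
Qed.

Lemma cprim_integral f c : cintegrable mu `]0, t1[ f ->
  cprim f (fun t => c + cintegral mu `]0, t[ f).
Proof.
move=> if_; apply/cprimP; split => // t tt; congr (_ + _).
rewrite set_itvoo0 [X in _ + X](_ : _ = 0) ?addr0//.
by apply: complex_ext; rewrite /= Rintegral_set0.
Qed.

Lemma cprim_integrable_mul f F g : cprim f F -> cintegrable mu `]0, t1[ g ->
  cintegrable mu `]0, t1[ (fun r => F r * g r).
Proof.
move=> [f1 f2] [g1 g2]; split.
  rewrite (_ : EFin \o _ = EFin \o (fun r => Re (F r) * Re (g r) - Im (F r) * Im (g r))).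
    apply: integrable_subR => //.
      exact: (prim_integrable_mul t10 f1).
    exact: (prim_integrable_mul t10 f2).
  by apply/funext => r /=; rewrite cReM.
rewrite (_ : EFin \o _ = EFin \o (fun r => Re (F r) * Im (g r) + Im (F r) * Re (g r))).
  apply: integrable_addR => //.
    exact: (prim_integrable_mul t10 f1).
  exact: (prim_integrable_mul t10 f2).
by apply/funext => r /=; rewrite cImM.
Qed.

Variables (a h : R -> R[i]) (c : R[i]).
Hypothesis ia : cintegrable mu `]0, t1[ a.
Hypothesis ih : cintegrable mu `]0, t1[ h.

Let A t := cintegral mu `]0, t[ a.

Let cint0 f : cintegral mu `]0, 0[ f = 0.
Proof. by rewrite set_itvoo0; apply: complex_ext; rewrite /= Rintegral_set0. Qed.

Let pA : cprim a A.
Proof.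
apply: (cprim_ext _ _ (cprim_integral 0 ia)) => // t.
by rewrite add0r.
Qed.

Let pNA : cprim (fun r => - a r) (fun t => - A t).
Proof.
have [p1 p2] := pA; split.
  by apply: (prim_ext _ _ (primN p1)) => r; exact/esym/cReN.
by apply: (prim_ext _ _ (primN p2)) => r; exact/esym/cImN.
Qed.

Let K t := c + cintegral mu `]0, t[ (fun s => cexp (- A s) * h s).

Let iK : cintegrable mu `]0, t1[ (fun s => cexp (- A s) * h s).
Proof. exact: (cprim_integrable_mul (cprim_cexp pNA) ih). Qed.

(** The factored form of variation of constants: as a product of two primitives it falls under
    [cprimM]. The kernel exp(int_s^t a) is restored by [duhamelE]. *)
Definition duhamel t := cexp (A t) * K t.

Lemma duhamel0 : duhamel 0 = c.
Proof. by rewrite /duhamel /A /K !cint0 cexp0 mul1r addr0. Qed.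

Lemma cprim_duhamel : cprim (fun s => a s * duhamel s + h s) duhamel.
Proof.
apply: (cprim_ext _ _ (cprimM (cprim_cexp pA) (cprim_integral c iK))) => // r.
rewrite /duhamel -/(K r) [cexp (A r) * (_ * _)]mulrA cexpN mul1r; ring.
Qed.

Lemma duhamel_unique y : y 0 = c -> cprim (fun s => a s * y s + h s) y ->
  forall t, 0 <= t <= t1 -> y t = duhamel t.
Proof.
move=> y0 py t tt.
(* The density of exp(-A) y is exp(-A)(-a) y + exp(-A)(a y + h), in which the terms with a
   cancel. *)
have pz := cprimM (cprim_cexp pNA) py.
have zK : cexp (- A t) * y t = K t.
  have /cprimP[_ /(_ t tt) ->] := pz.
  rewrite {1}/A cint0 oppr0 cexp0 mul1r y0 /K; congr (_ + _).
  by apply: eq_cintegral => s _; ring.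
by rewrite /duhamel -zK mulrA cexpN mul1r.
Qed.

Lemma cintegral_itvoo_sub s t : 0 <= s -> s <= t -> t <= t1 ->
  cintegral mu `]s, t[ a = A t - A s.
Proof.
move=> s0 st tt; have [p1 p2] := pA.
apply: complex_ext; rewrite !ReIm_simp; symmetry.
  exact: (prim_incr p1).
exact: (prim_incr p2).
Qed.

Lemma duhamelE t : 0 <= t <= t1 ->
  duhamel t = cexp (cintegral mu `]0, t[ a) * c +
    cintegral mu `]0, t[ (fun s => cexp (cintegral mu `]s, t[ a) * h s).
Proof.
move=> /andP[t0 tt]; rewrite /duhamel /K mulrDr; congr (_ + _).
rewrite -cintegralZ//; last first.
  by apply: cintegrableS iK => //; exact: itvoo_sub.
apply: eq_cintegral => s; rewrite inE/= in_itv/= => /andP[s0 st].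
by rewrite cintegral_itvoo_sub ?(ltW s0) ?(ltW st)// cexpD mulrA.
Qed.

Lemma cintegrable_duhamel t : 0 <= t <= t1 ->
  cintegrable mu `]0, t[ (fun s => cexp (cintegral mu `]s, t[ a) * h s).
Proof.
move=> /andP[t0 tt].
have iKt : cintegrable mu `]0, t[ (fun s => cexp (A t) * (cexp (- A s) * h s)).
  apply: cintegrableZ => //; apply: cintegrableS iK => //; exact: itvoo_sub.
have E : {in `]0, t[%classic, (fun s => cexp (A t) * (cexp (- A s) * h s)) =1
    (fun s => cexp (cintegral mu `]s, t[ a) * h s)}.
  move=> s; rewrite inE/= in_itv/= => /andP[s0 st].
  by rewrite cintegral_itvoo_sub ?(ltW s0) ?(ltW st)// cexpD mulrA.
apply: (ae_eq_cintegrable _ _ _ iKt) => //.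
  exact: eq_cmeasurable (cintegrable_cmeasurable iKt).
by apply: aeW => s ss; apply: E; rewrite inE.
Qed.

End complex_primitives.

(** * Dominated convergence and the mass of the Poisson kernel *)

Section dominated.
Context {R : realType} {disp} {X : measurableType disp}.
Variable mu : {measure set X -> \bar R}.

Lemma Rintegral_dominated_cvg (D : set X) (f_ : nat -> X -> R) (f g : X -> R) :
  measurable D -> (forall n, measurable_fun D (f_ n)) -> measurable_fun D f ->
  (forall x, D x -> f_ n x @[n --> \oo] --> f x) ->
  mu.-integrable D (EFin \o g) -> (forall n x, D x -> `|f_ n x| <= g x) ->
  \int[mu]_(x in D) f_ n x @[n --> \oo] --> \int[mu]_(x in D) f x.
Proof.
move=> mD mf_ mf cf ig fg.
have mf_' n : measurable_fun D (EFin \o f_ n) by exact/measurable_EFinP.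
have mf' : measurable_fun D (EFin \o f) by exact/measurable_EFinP.
have ae1 : {ae mu, forall x, D x -> (EFin \o f_ n) x @[n --> \oo] --> (EFin \o f) x}.
  by apply: aeW => x Dx; apply: cvg_EFin; [exact: nearW|exact: cf].
have ae2 : {ae mu, forall x n, D x -> (`|(EFin \o f_ n) x| <= (EFin \o g) x)%E}.
  by apply: aeW => x n Dx; rewrite lee_fin; exact: fg.
have [if_ _ hcv] := @dominated_convergence _ _ _ mu D mD (fun n => EFin \o f_ n)
  (EFin \o f) (EFin \o g) mf_' mf' ae1 ig ae2.
have E : (\int[mu]_(x in D) (EFin \o f) x = (\int[mu]_(x in D) f x)%:E)%E.
  by rewrite /Rintegral fineK//; exact: integrable_fin_num.
by rewrite E in hcv; have := fine_cvg hcv; apply.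
Qed.

End dominated.

Section pk_mass.
Context {R : realType}.
Local Notation mu := (@lebesgue_measure R).

Lemma continuous_pk (e x : R) : 0 < e -> continuous (fun u => pk e (u - x)).
Proof.
move=> e0 u; rewrite /pk; apply: cvgMl_tmp; apply: cvgV.
  by rewrite gt_eqF// mulr_gt0 ?pi_gt0// sqrDsqr_gt0// gt_eqF.
apply: cvgMl_tmp; apply: cvgD; first exact: cvg_cst.
have c : u0 - x @[u0 --> u] --> u - x by apply: cvgB; [exact: cvg_id|exact: cvg_cst].
by rewrite expr2; under eq_fun do rewrite expr2; exact: cvgM.
Qed.

Lemma is_derive_atan_pk (e x u : R) : 0 < e ->
  is_derive u (1 : R) (fun u => pi^-1 * atan (e^-1 * (u - x))) (pk e (u - x)).
Proof.
move=> e0; have en0 : e != 0 by rewrite gt_eqF.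
have d1 : is_derive u (1 : R) (fun u : R => u - x) 1.
  have := @is_deriveB _ _ _ _ _ _ _ _ _ (is_derive_id u (1 : R)) (is_derive_cst x u (1 : R)).
  by rewrite subr0.
have d2 : is_derive u (1 : R) (fun u : R => e^-1 * (u - x)) (e^-1 * 1).
  exact: (@is_deriveZ _ _ _ _ e^-1 _ _ _ d1).
have da (y : R) : is_derive y (1 : R) (@atan R) ((1 + y ^+ 2)^-1).
  apply: DeriveDef; first exact: derivable_atan.
  by rewrite -derive1E derive1_atan.
have d3 : is_derive u (1 : R) (fun u => atan (e^-1 * (u - x)))
    ((1 + (e^-1 * (u - x)) ^+ 2)^-1 * (e^-1 * 1)).
  exact: (@is_derive1_comp R (@atan R) (fun u => e^-1 * (u - x)) u _ _ (da _) d2).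
have := @is_deriveZ _ _ _ _ pi^-1 _ _ _ d3.
apply: is_derive_conv; rewrite /GRing.scale/= /pk.
have := sqrDsqr_gt0 (u - x) en0; have : pi != 0 :> R by rewrite gt_eqF ?pi_gt0.
move: (u - x) (@pi R) => v p p0 q0; field.
by rewrite p0 en0 (gt_eqF q0).
Qed.

(** The mass that the kernel of height e leaves at distance more than delta from its centre,
    computed with the primitive atan(u / e) / pi. *)
Definition tail (e delta : R) := 1 - 2 * (pi^-1 * atan (e^-1 * delta)).

Lemma Rintegral_pk_itv (e x delta : R) : 0 < e -> 0 <= delta ->
  \int[mu]_(u in `[x - delta, x + delta]) pk e (u - x) =
  2 * (pi^-1 * atan (e^-1 * delta)).
Proof.
move=> e0 d0.
have ab : x - delta <= x + delta by lra.
have -> := Rintegral_FTC2 ab (continuous_pk e0) (fun t => is_derive_atan_pk x t e0).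
rewrite (_ : x + delta - x = delta); last by ring.
rewrite (_ : x - delta - x = - delta); last by ring.
by rewrite mulrN atanN; ring.
Qed.

Lemma cvg_tail (delta : R) : 0 < delta ->
  tail (n.+1%:R^-1) delta @[n --> \oo] --> (0 : R).
Proof.
move=> d0; rewrite /tail.
rewrite [X in _ --> X](_ : _ = 1 - 2 * (pi^-1 * (pi / 2))); last first.
  have : pi != 0 :> R by rewrite gt_eqF ?pi_gt0.
  by move: (@pi R) => p p0; field.
apply: cvgB; first exact: cvg_cst.
apply: cvgMl_tmp; apply: cvgMl_tmp.
apply: (@cvg_comp _ _ _ (fun n => (n.+1%:R^-1)^-1 * delta) (@atan R) _ (pinfty_nbhs R)).
  under eq_fun do rewrite invrK.
  have cy : n%:R * delta @[n --> \oo] --> +oo.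
    exact: (@gt0_cvgMly R (n%:R @[n --> \oo]) _ delta id d0 (@cvgr_idn R)).
  by rewrite -(@cvg_shiftS R (fun n : nat => n%:R * delta) (pinfty_nbhs R)) in cy.
exact: cvgy_atan.
Qed.

Lemma pk_itv_cvg (e : R) : 0 < e ->
  2 * (pi^-1 * atan (e^-1 * n%:R)) @[n --> \oo] --> (1 : R).
Proof.
move=> e0.
rewrite [X in _ --> X](_ : _ = 2 * (pi^-1 * (pi / 2))); last first.
  have : pi != 0 :> R by rewrite gt_eqF ?pi_gt0.
  by move: (@pi R) => p p0; field.
apply: cvgMl_tmp; apply: cvgMl_tmp.
apply: (@cvg_comp _ _ _ (fun n => e^-1 * n%:R) (@atan R) _ (pinfty_nbhs R)).
  by apply: (@gt0_cvgMry R (n%:R @[n --> \oo]) _ _ id _ (@cvgr_idn R)); rewrite invr_gt0.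
exact: cvgy_atan.
Qed.

Lemma measurable_pk (e x : R) : 0 < e ->
  measurable_fun [set: measurableTypeR R] (fun u => pk e (u - x)).
Proof. by move=> e0; apply: continuous_measurable_fun; exact: continuous_pk. Qed.

(** Monotone convergence along the intervals of radius n around x, on which the mass is an explicit
    arctangent. *)
Lemma integral_pk (e x : R) : 0 < e -> (\int[mu]_u (pk e (u - x))%:E = 1%:E)%E.
Proof.
move=> e0; pose F n := `[x - n%:R, x + n%:R]%classic : set (measurableTypeR R).
have UF : \bigcup_n F n = setT.
  apply/seteqP; split=> // u _; exists (Num.truncn `|u - x|).+1 => //=.
  rewrite /F /= in_itv/=; have /ltW := truncnS_gt `|u - x|.
  by rewrite ler_norml => /andP[h1 h2]; apply/andP; split; lra.
have ndF : nondecreasing_seq F.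
  move=> m n mn; apply/subsetPset => u; rewrite /F /= !in_itv/=.
  have : (m%:R : R) <= n%:R by rewrite ler_nat.
  by move=> h /andP[h1 h2]; apply/andP; split; lra.
have mpk := measurable_pk x e0.
have := @ge0_nondecreasing_set_cvg_integral _ (measurableTypeR R) R F
  (fun u => (pk e (u - x))%:E) mu ndF (fun n => measurable_itv _).
rewrite UF.
have mEpk : measurable_fun [set: measurableTypeR R] (fun u => (pk e (u - x))%:E).
  exact/measurable_EFinP.
move=> /(_ (fun n => measurable_funS measurableT (@subsetT _ _) mEpk)) H.
have {}H := H (fun n u _ => pk_ge0 (u - x) e0).
have E n : (\int[mu]_(u in F n) (pk e (u - x))%:E =
    (2 * (pi^-1 * atan (e^-1 * n%:R)))%:E)%E.
  rewrite -(@Rintegral_pk_itv _ x)// /Rintegral fineK//.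
  apply: integrable_fin_num => //.
  apply: continuous_compact_integrable; first exact: segment_compact.
  by apply: continuous_subspaceT; exact: continuous_pk.
rewrite -(cvg_lim _ H)//; apply: cvg_lim => //.
under eq_fun do rewrite E.
by apply: cvg_EFin; [exact: nearW|exact: pk_itv_cvg].
Qed.

Lemma integrable_pk (e x : R) : 0 < e ->
  mu.-integrable setT (EFin \o (fun u => pk e (u - x))).
Proof.
move=> e0; apply/integrableP; split.
  by apply/measurable_EFinP; exact: measurable_pk.
rewrite (eq_integral (fun u : measurableTypeR R => (pk e (u - x))%:E)).
  by rewrite integral_pk// ltry.
by move=> u _ /=; rewrite ger0_norm// pk_ge0.
Qed.

Definition far (x delta : R) : set R := ~` `[x - delta, x + delta]%classic.

Lemma integral_pk_far (e x delta : R) : 0 < e -> 0 <= delta ->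
  (\int[mu]_u (pk e (u - x) * \1_(far x delta) u)%:E = (tail e delta)%:E)%E.
Proof.
move=> e0 d0.
have ipk := integrable_pk x e0.
have mf : measurable (far x delta : set (measurableTypeR R)).
  by apply: measurableC; exact: measurable_itv.
have ipkf : mu.-integrable (far x delta) (EFin \o (fun u => pk e (u - x))).
  by apply: integrableS ipk.
transitivity (\int[mu]_(u in far x delta) (pk e (u - x))%:E)%E.
  rewrite [RHS]integral_mkcond; apply: eq_integral => u _.
  by rewrite /patch indicE; case: (u \in _); rewrite ?mulr1 ?mulr0.
rewrite -[LHS]fineK; last exact: integrable_fin_num.
congr (_%:E); rewrite /tail -(@Rintegral_pk_itv e x delta)//.
have -> : (1 : R) = \int[mu]_u pk e (u - x) by rewrite /Rintegral integral_pk.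
rewrite -[X in \int[mu]_(_ in X) _](setUv `[x - delta, x + delta]%classic).
rewrite Rintegral_setU//.
- by rewrite addrAC subrr add0r.
- by rewrite setUv.
- by apply/disj_setPS => u [].
Qed.

End pk_mass.

(** * Products of Poisson kernels as an approximate identity *)

Section approximate_identity.
Context {R : realType} {d : nat}.
Local Notation Rd := 'rV[R]_d.
Local Notation leb := (lebesgue_rV R d).

Definition pkd (e : R) (x y : Rd) : R := \prod_(i < d) pk e (y ord0 i - x ord0 i).

Lemma pkd_ge0 e x y : 0 < e -> 0 <= pkd e x y.
Proof. by move=> e0; apply: prodr_ge0 => i _; exact: pk_ge0. Qed.

Lemma measurable_pkd e x : 0 < e -> measurable_fun setT (pkd e x).
Proof.
move=> e0; apply: (@measurable_prodr _ _ (fun i u => pk e (u - x ord0 i))) => i.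
exact: measurable_pk.
Qed.

Lemma integral_pkd e x : 0 < e -> (\int[leb]_y (pkd e x y)%:E = 1%:E)%E.
Proof.
move=> e0; rewrite (@integral_prod_rV _ _ (fun i u => pk e (u - x ord0 i)) (fun=> 1)).
- by rewrite big1.
- by move=> i; exact: measurable_pk.
- by move=> i u; exact: pk_ge0.
- by move=> i; exact: integral_pk.
Qed.

Lemma integrable_pkd e x : 0 < e -> leb.-integrable setT (EFin \o pkd e x).
Proof.
move=> e0; apply/integrableP; split.
  by apply/measurable_EFinP; exact: measurable_pkd.
rewrite (eq_integral (fun u => (pkd e x u)%:E)).
  by rewrite integral_pkd// ltry.
by move=> u _ /=; rewrite ger0_norm// pkd_ge0.
Qed.

(** The indicator is inserted as an extra factor in coordinate i, which keeps the integrand a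
    product; every other coordinate contributes mass 1. *)
Lemma integral_pkd_far e x delta (i : 'I_d) : 0 < e -> 0 <= delta ->
  (\int[leb]_y (pkd e x y * \1_(far (x ord0 i) delta) (y ord0 i))%:E =
   (tail e delta)%:E)%E.
Proof.
move=> e0 d0.
pose k (j : 'I_d) u := pk e (u - x ord0 j) * (if j == i then \1_(far (x ord0 i) delta) u else 1).
pose c (j : 'I_d) := if j == i then tail e delta else 1.
have -> : tail e delta = \prod_(j < d) c j.
  by rewrite /c -big_mkcond big_pred1_eq.
rewrite -(@integral_prod_rV _ _ k c).
- apply: eq_integral => y _; congr (_%:E); rewrite /k big_split/=; congr (_ * _).
  rewrite (bigD1 i)//= eqxx big1 ?mulr1// => j /negbTE ->.
  by [].
- move=> j; rewrite /k; apply: measurable_funM; first exact: measurable_pk.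
  case: eqP => _; last exact: measurable_cst.
  by apply: measurable_indic; apply: measurableC; exact: measurable_itv.
- move=> j u; rewrite /k mulr_ge0 ?pk_ge0//; case: eqP => // _.
- move=> j; rewrite /k /c; case: eqP => [->|_]; first exact: integral_pk_far.
  by under eq_integral do rewrite mulr1; exact: integral_pk.
Qed.

(** Where all coordinates are within delta, f varies by at most eta. Elsewhere some coordinate is
    far and |f y - f x| <= 2 M; summing over the d coordinates bounds the mass of this region by d
    times [tail e delta]. *)
Lemma approx_identity_le (f : Rd -> R) (x : Rd) (M eta delta e : R) :
  measurable_fun setT f -> (forall y, `|f y| <= M) -> 0 < e -> 0 <= delta ->
  0 <= eta ->
  (forall y : Rd, (forall i, `|y ord0 i - x ord0 i| <= delta) ->
    `|f y - f x| <= eta) ->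
  `|\int[leb]_y (f y * pkd e x y) - f x| <= eta + 2 * M * d%:R * tail e delta.
Proof.
move=> mf fM e0 d0 eta0 fx.
have M0 : 0 <= M by exact: le_trans (fM x).
have ik := integrable_pkd x e0.
have ifk : leb.-integrable setT (EFin \o (fun y => f y * pkd e x y)).
  exact: (integrable_bounded_mul measurableT mf (fun y _ => fM y) ik).
have icf : leb.-integrable setT (EFin \o (fun y => f x * pkd e x y)).
  exact: integrable_scaleR.
have k1 : \int[leb]_y pkd e x y = 1 by rewrite /Rintegral integral_pkd.
pose B y := eta * pkd e x y + \sum_(i < d) 2 * M * (pkd e x y * \1_(far (x ord0 i) delta) (y ord0 i)).
have mfar i : measurable_fun setT (fun y : Rd => pkd e x y * \1_(far (x ord0 i) delta) (y ord0 i)).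
  apply: measurable_funM; first exact: measurable_pkd.
  apply: (@measurableT_comp _ _ _ _ _ _ (\1_(far (x ord0 i) delta) : measurableTypeR R -> R)).
    by apply: measurable_indic; apply: measurableC; exact: measurable_itv.
  exact: measurable_rV_coord.
have ifar i : leb.-integrable setT
    (EFin \o (fun y : Rd => pkd e x y * \1_(far (x ord0 i) delta) (y ord0 i))).
  apply: (le_integrable measurableT _ _ ik); first exact/measurable_EFinP.
  move=> y _ /=; rewrite lee_fin normrM ler_piMr//.
  by rewrite indicE; case: (_ \in _); rewrite ?normr1 ?normr0.
have vfar i : \int[leb]_y (pkd e x y * \1_(far (x ord0 i) delta) (y ord0 i)) = tail e delta.
  by rewrite /Rintegral integral_pkd_far.
have isum n (h : 'I_n -> Rd -> R) : (forall i, leb.-integrable setT (EFin \o h i)) ->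
    leb.-integrable setT (EFin \o (fun y => \sum_(i < n) h i y)) /\
    \int[leb]_y (\sum_(i < n) h i y) = \sum_(i < n) \int[leb]_y h i y.
  elim: n h => [|n IH] h ih.
    rewrite big_ord0; under [in X in _ /\ X]eq_Rintegral do rewrite big_ord0.
    rewrite (_ : (fun y => _) = cst 0); last by apply/funext => y; rewrite big_ord0.
    split; first exact: integrable0.
    by rewrite /Rintegral integral0.
  have [i1 i2] := IH (fun i => h (lift ord0 i)) (fun i => ih (lift ord0 i)).
  rewrite big_ord_recl -i2.
  have E : (fun y => \sum_(i < n.+1) h i y) =
      (fun y => h ord0 y + \sum_(i < n) h (lift ord0 i) y).
    by apply/funext => y; rewrite big_ord_recl.
  rewrite E; split; first exact: integrable_addR.
  by rewrite RintegralD.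
have [is1 is2] := isum d (fun i y => 2 * M * (pkd e x y * \1_(far (x ord0 i) delta) (y ord0 i)))
  (fun i => integrable_scaleR measurableT (2 * M) (ifar i)).
have iek := integrable_scaleR measurableT eta ik.
have iB : leb.-integrable setT (EFin \o B) by exact: integrable_addR.
have vB : \int[leb]_y B y = eta + 2 * M * d%:R * tail e delta.
  rewrite /B RintegralD// RintegralZl// k1 mulr1 is2; congr (_ + _).
  rewrite (eq_bigr (fun=> 2 * M * tail e delta)).
    by rewrite sumr_const card_ord -mulr_natr; ring.
  by move=> i _; rewrite RintegralZl// vfar.
have -> : f x = \int[leb]_y (f x * pkd e x y) by rewrite RintegralZl// k1 mulr1.
rewrite -RintegralB// -vB.
have isub : leb.-integrable setT (EFin \o (fun y => f y * pkd e x y - f x * pkd e x y)).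
  exact: integrable_subR.
rewrite (le_trans (le_normr_Rintegral measurableT isub))//.
apply: le_Rintegral => //; first exact: (integrable_norm isub).
move=> y _; rewrite -mulrBl normrM (ger0_norm (pkd_ge0 _ _ e0)).
have k0 := pkd_ge0 x y e0.
have t0 i : 0 <= 2 * M * (pkd e x y * \1_(far (x ord0 i) delta) (y ord0 i)).
  by rewrite !mulr_ge0.
have [near_|] := pselect (forall i, `|y ord0 i - x ord0 i| <= delta).
  by rewrite /B ler_wpDr ?sumr_ge0// ler_wpM2r// fx.
move=> /existsNP[i /negP]; rewrite -ltNge => hi.
rewrite /B ler_wpDl ?mulr_ge0// (bigD1 i)//= ler_wpDr ?sumr_ge0//.
rewrite indicE mem_set ?mulr1; last first.
  rewrite /far /= in_itv/= => /andP[h1 h2]; move: hi; apply/negP; rewrite -leNgt.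
  by rewrite ler_norml; apply/andP; split; lra.
rewrite ler_wpM2r// (le_trans (ler_normB _ _))// mulr_natl mulr2n.
by rewrite lerD.
Qed.

Lemma approx_identity (f : Rd -> R) (x : Rd) (M : R) : continuous f ->
  (forall y, `|f y| <= M) ->
  \int[leb]_y (f y * pkd (n.+1%:R^-1) x y) @[n --> \oo] --> f x.
Proof.
move=> cf fM; have M0 : 0 <= M by exact: le_trans (fM x).
have mf := continuous_measurable_rV cf.
apply/cvgrPdist_le => eps eps0.
have e20 : 0 < eps / 2 by rewrite divr_gt0.
have /cvgrPdist_le/(_ _ e20)/nbhs_ballP[del /= del0 hdel] := cf x.
(* Halving [del] turns the non-strict inequalities of the estimate into membership of the open
   ball. *)
pose delta := del / 2; have d0 : 0 < delta by rewrite divr_gt0.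
have fx (y : Rd) : (forall i, `|y ord0 i - x ord0 i| <= delta) -> `|f y - f x| <= eps / 2.
  move=> hy; rewrite distrC; apply: hdel; apply/ball_rVE => // i.
  by rewrite distrC (le_lt_trans (hy i))// /delta; lra.
have c0 : 2 * M * d%:R * tail n.+1%:R^-1 delta @[n --> \oo] --> (0 : R).
  by rewrite -[X in _ --> X](mulr0 (2 * M * d%:R)); apply: cvgMl_tmp; exact: cvg_tail.
near=> n.
rewrite distrC (le_trans (@approx_identity_le f x M (eps / 2) delta _ mf fM _ _ _ fx))//.
- exact: ltW.
- exact: ltW.
have : 2 * M * d%:R * tail n.+1%:R^-1 delta <= eps / 2.
  near: n; have /cvgrPdist_le/(_ _ e20) := c0.
  by apply: filterS => n /=; rewrite sub0r normrN; apply: le_trans; exact: ler_norm.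
by lra.
Unshelve. all: by end_near. Qed.

End approximate_identity.

(** * Fourier inversion *)

Section fourier.
Context {R : realType} {d : nat}.
Local Notation Rd := 'rV[R]_d.
Local Notation leb := (lebesgue_rV R d).
Local Notation C := R[i].

Lemma dotpC (x y : Rd) : dotp x y = dotp y x.
Proof. by apply: eq_bigr => i _; rewrite mulrC. Qed.

Lemma measurable_dotp {disp} {Y : measurableType disp} (f g : Y -> Rd) :
  measurable_fun setT f -> measurable_fun setT g ->
  measurable_fun setT (fun y => dotp (f y) (g y)).
Proof.
move=> mf mg; apply: measurable_sum => i; apply: measurable_funM.
- exact: (measurableT_comp (measurable_rV_coord i) mf).
- exact: (measurableT_comp (measurable_rV_coord i) mg).
Qed.

Lemma cexp_sum n (z : 'I_n -> C) : cexp (\sum_(i < n) z i) = \prod_(i < n) cexp (z i).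
Proof. by apply: (big_morph _ _ _); [exact: cexpD|exact: cexp0]. Qed.

Lemma Complex0_sum n (r : 'I_n -> R) :
  Complex 0 (\sum_(i < n) r i) = \sum_(i < n) Complex 0 (r i) :> C.
Proof.
apply: (big_morph (fun r : R => Complex 0 r)) => // u v.
by apply: complex_ext => /=; rewrite ?addr0.
Qed.

Definition osc (s : R) (x y : Rd) : C := cexp (Complex 0 (s * dotp x y)).

Lemma oscC s x y : osc s x y = osc s y x.
Proof. by rewrite /osc dotpC. Qed.

Lemma normc_osc s x y : normc (osc s x y) = 1.
Proof. by rewrite normc_cexp expR0. Qed.

Lemma osc_prod s x y : osc s x y =
  \prod_(i < d) cexp (Complex 0 (s * (x ord0 i * y ord0 i))).
Proof. by rewrite -cexp_sum -Complex0_sum /osc /dotp mulr_sumr. Qed.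

Lemma cmeasurable_osc {disp} {Y : measurableType disp} s (f g : Y -> Rd) :
  measurable_fun setT f -> measurable_fun setT g ->
  cmeasurable_fun setT (fun y => osc s (f y) (g y)).
Proof.
move=> mf mg; apply: cmeasurable_cexp => //; split; first exact: measurable_cst.
by apply: measurable_funM; [exact: measurable_cst|exact: measurable_dotp].
Qed.

(** One transform for both signs: s = -1 is the Fourier transform, s = 1 its inverse. Inversion and
    decay are then proved once, under [s ^+ 2 = 1]. *)
Definition FT (s : R) (f : Rd -> C) (x : Rd) : C :=
  Fourier_cst (d := d) * cintegral leb setT (fun y => osc s x y * f y).

Lemma FourierE f : Fourier f = FT (-1) f.
Proof.
by apply/funext => x; rewrite /FT /osc; under eq_cintegral do rewrite mulN1r.
Qed.

Lemma invFourierE f : invFourier f = FT 1 f.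
Proof.
by apply/funext => x; rewrite /FT /osc; under eq_cintegral do rewrite mul1r.
Qed.

Lemma cintegrable_osc s x f : cintegrable leb setT f ->
  cintegrable leb setT (fun y => osc s x y * f y).
Proof.
move=> jf; under eq_fun do rewrite mulrC.
apply: (@cintegrable_bounded_mul _ _ _ 1) => //.
  by apply: cmeasurable_osc; [exact: measurable_cst|exact: measurable_id].
by move=> y _; rewrite normc_osc.
Qed.

Local Notation cst := (Fourier_cst (R := R) (d := d)).

(** The normalizing constants of the two transforms cancel the (2 pi)^d produced by the d
    one-dimensional Poisson integrals. *)
Lemma Fourier_cst_sqr : cst * cst * ((2 * pi) ^+ d)%:C%C = 1 :> C.
Proof.
have p0 : 2 * pi != 0 :> R by rewrite mulf_neq0// gt_eqF ?pi_gt0.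
have p1 : 0 <= 2 * pi :> R by rewrite mulr_ge0// pi_ge0.
rewrite /Fourier_cst -!rmorphM/= -powRD ?p0 ?implybT//.
rewrite (_ : - (d%:R / 2) + - (d%:R / 2) = - d%:R :> R); last by field.
by rewrite powRN powR_mulrn// mulVf ?expf_neq0.
Qed.

(** The exponent is the l^1 norm rather than the Euclidean one, so that the damped oscillation is a
    product of functions of one coordinate. *)
Definition damp (e : R) (x : Rd) : R := \prod_(i < d) expR (- e * `|x ord0 i|).

Lemma damp_ge0 e x : 0 <= damp e x.
Proof. by apply: prodr_ge0 => i _; exact: expR_ge0. Qed.

Lemma damp_le1 e x : 0 <= e -> damp e x <= 1.
Proof.
move=> e0; apply: prodr_ile1 => i _; rewrite expR_ge0/= -expR0 ler_expR.
by rewrite mulNr oppr_le0 mulr_ge0.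
Qed.

Lemma measurable_damp e : measurable_fun setT (damp e).
Proof.
apply: (@measurable_prodr _ _ (fun i u => expR (- e * `|u|))) => i.
apply: measurableT_comp; first exact: measurable_expR.
apply: measurable_funM; first exact: measurable_cst.
by apply: continuous_measurable_fun; exact: norm_continuous.
Qed.

Lemma cvg_damp x : damp n.+1%:R^-1 x @[n --> \oo] --> (1 : R).
Proof.
rewrite [X in _ --> X](_ : _ = \prod_(i < d) expR (- 0 * `|x ord0 i|)); last first.
  by rewrite big1// => i _; rewrite oppr0 mul0r expR0.
apply: cvg_prodr => i.
apply: (@cvg_comp _ _ _ (fun n => - n.+1%:R^-1 * `|x ord0 i|) (@expR R)); last first.
  exact: continuous_expR.
apply: cvgMr_tmp; apply: cvgN.
exact: cvg_harmonic.
Qed.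

Lemma cvg_dampM x (r : R) : damp n.+1%:R^-1 x * r @[n --> \oo] --> r.
Proof.
by rewrite -[X in _ --> X]mul1r; apply: cvgMr_tmp; exact: cvg_damp.
Qed.

Lemma cintegral_damp_osc e (u : Rd) : 0 < e ->
  cintegrable leb setT (fun xi => (damp e xi)%:C%C * osc 1 u xi) /\
  cintegral leb setT (fun xi => (damp e xi)%:C%C * osc 1 u xi) =
  ((2 * pi) ^+ d * \prod_(i < d) pk e (u ord0 i))%:C%C.
Proof.
move=> e0.
pose k (i : 'I_d) (t : R) := (expR (- e * `|t|))%:C%C * cexp (Complex 0 (u ord0 i * t)).
have -> : (fun xi : Rd => (damp e xi)%:C%C * osc 1 u xi) =
    (fun xi => \prod_(i < d) k i (xi ord0 i)).
  apply/funext => xi; rewrite big_split/= rmorph_prod osc_prod; congr (_ * _).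
  by apply: eq_bigr => i _; rewrite mul1r.
have ik i := (cintegral_poisson (u ord0 i) e0).1.
split; first exact: (cintegrable_prod_rV ik).
rewrite (cintegral_prod_rV ik) (eq_bigr _ (fun i _ => (cintegral_poisson (u ord0 i) e0).2)).
by rewrite -rmorph_prod big_split/= prodr_const card_ord.
Qed.

Lemma integrable_damp e : 0 < e -> leb.-integrable setT (EFin \o damp e).
Proof.
move=> e0; have [i1 _] := cintegral_damp_osc 0 e0; case: i1 => + _.
apply: eq_integrable => // x _ /=; congr (_%:E).
have -> : dotp 0 x = 0 by apply: big1 => i _; rewrite mxE mul0r.
by rewrite mulr0 expR0 cos0 !mul0r subr0 !mulr1.
Qed.

(** The sign s is moved into the vector, so that both signs lead to the same integral; it disappears
    afterwards because the Poisson kernel is even. *)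
Lemma osc_pair s (x xi y : Rd) : s ^+ 2 = 1 ->
  osc (- s) x xi * osc s xi y = osc 1 (s *: (y - x)) xi.
Proof.
move=> s2; rewrite /osc -cexpD; congr cexp; apply: complex_ext => /=.
  by rewrite addr0.
rewrite mulNr mul1r /dotp !mulr_sumr -sumrN -big_split/=; apply: eq_bigr => i _.
by rewrite !mxE; ring.
Qed.

Lemma pk_sign e s u : s ^+ 2 = 1 -> pk e (s * u) = pk e u :> R.
Proof. by move=> s2; rewrite /pk exprMn s2 mul1r. Qed.

Lemma cintegral_damped_FT s e f x : s ^+ 2 = 1 -> 0 < e -> cintegrable leb setT f ->
  cst * cintegral leb setT (fun xi => (damp e xi)%:C%C * (osc (- s) x xi * FT s f xi)) =
  cintegral leb setT (fun y => f y * (pkd e x y)%:C%C).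
Proof.
move=> s2 e0 jf.
pose F (z : Rd * Rd) := (damp e z.1)%:C%C * (osc (- s) x z.1 * osc s z.1 z.2) * f z.2.
have mF : cmeasurable_fun setT F.
  apply: cmeasurableM.
    apply: cmeasurableM.
      apply: cmeasurable_real.
      exact: (measurableT_comp (measurable_damp e) measurable_fst).
    by apply: cmeasurableM; apply: cmeasurable_osc.
  exact: (@cmeasurable_comp _ _ _ _ _ setT setT _ snd _ _ (cintegrable_cmeasurable jf)).
have nF xi y : normc (F (xi, y)) = damp e xi * normc (f y).
  rewrite /F/= !Normc.normcM !normc_osc !mulr1 normc_real ger0_norm//.
  exact: damp_ge0.
have iF : cintegrable (leb \x leb)%E setT F.
  apply: cintegrable_prod => //.
  have inf := cintegrable_normc measurableT jf.
  pose c := \int[leb]_y normc (f y).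
  rewrite (eq_integral (fun xi => (damp e xi * c)%:E)); last first.
    move=> xi _; under eq_integral do rewrite nF EFinM.
    rewrite ge0_integralZl//.
    - rewrite EFinM; congr (_ * _)%E; rewrite /c /Rintegral fineK//.
      exact: integrable_fin_num.
    - by move/integrableP: inf => [].
    - by move=> y _; rewrite lee_fin normc_ge0.
    - by rewrite lee_fin damp_ge0.
  have : leb.-integrable setT (EFin \o (fun xi => c * damp e xi)).
    exact/integrable_scaleR/integrable_damp.
  move=> /integrableP[_]; apply: le_lt_trans; apply: ge0_le_integral => //.
  - by move=> xi _; rewrite lee_fin mulr_ge0 ?damp_ge0// Rintegral_ge0// => y _; exact: normc_ge0.
  - apply/measurable_EFinP/measurable_funM; [exact: measurable_damp|exact: measurable_cst].
  - apply/measurable_EFinP; apply: measurableT_comp => //.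
    by apply/measurable_funM; [exact: measurable_cst|exact: measurable_damp].
  - by move=> xi _ /=; rewrite lee_fin mulrC ler_norm.
have := cFubini iF.
have E1 : (fun xi => cintegral leb setT (fun y => F (xi, y))) =
    (fun xi => (damp e xi)%:C%C * (osc (- s) x xi * cintegral leb setT (fun y => osc s xi y * f y))).
  apply/funext => xi; rewrite mulrA -cintegralZ//; last exact: cintegrable_osc.
  by apply: eq_cintegral => y _; rewrite /F/= -!mulrA.
have E : (fun y => cintegral leb setT (fun xi => F (xi, y))) =
    (fun y => ((2 * pi) ^+ d)%:C%C * (f y * (pkd e x y)%:C%C)).
  apply/funext => y; rewrite /F/=.
  have [i1 i2] := cintegral_damp_osc (s *: (y - x)) e0.
  under eq_cintegral do rewrite osc_pair// mulrC.
  rewrite cintegralZ// i2 rmorphM/= mulrCA; congr (_ * (_ * (_ %:C)%C)).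
  by apply: eq_bigr => i _; rewrite !mxE pk_sign.
rewrite E => h.
(* Integrability against the kernel is inherited from the Fubini section after division by (2 pi)^d,
   which is nonzero by [Fourier_cst_sqr]. *)
have ifk : cintegrable leb setT (fun y => f y * (pkd e x y)%:C%C).
  have h0 : ((2 * pi) ^+ d)%:C%C != 0 :> C.
    apply/eqP => h0; have := Fourier_cst_sqr; rewrite h0 mulr0 => /esym/eqP.
    by rewrite oner_eq0.
  have := cintegrable_section2 iF; rewrite E.
  move/(cintegrableZ ((2 * pi) ^+ d)%:C%C^-1 measurableT).
  by under eq_fun do rewrite mulrA mulVf// mul1r.
rewrite cintegralZ// E1 in h.
rewrite -[RHS]mul1r -Fourier_cst_sqr -[RHS]mulrA -h -mulrA; congr (_ * _).
rewrite -cintegralZ//; last by rewrite -E1; exact: cintegrable_section1 iF.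
by apply: eq_cintegral => xi _; rewrite /FT (mulrCA (osc (- s) x xi) cst) (mulrCA _ cst).
Qed.

Lemma cintegral_dominated_cvg (f_ : nat -> Rd -> C) (f : Rd -> C) (g : Rd -> R) :
  (forall n, cmeasurable_fun setT (f_ n)) -> cmeasurable_fun setT f ->
  (forall x, Re (f_ n x) @[n --> \oo] --> Re (f x)) ->
  (forall x, Im (f_ n x) @[n --> \oo] --> Im (f x)) ->
  leb.-integrable setT (EFin \o g) -> (forall n x, normc (f_ n x) <= g x) ->
  (Re (cintegral leb setT (f_ n)) @[n --> \oo] --> Re (cintegral leb setT f)) /\
  (Im (cintegral leb setT (f_ n)) @[n --> \oo] --> Im (cintegral leb setT f)).
Proof.
move=> mf_ mf cR cI ig fg; split.
- apply: (@Rintegral_dominated_cvg _ _ _ leb setT _ _ g) => //.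
  + by move=> n; exact: (mf_ n).1.
  + exact: mf.1.
  + by move=> n x _; exact: le_trans (normr_Re_le _) (fg n x).
- apply: (@Rintegral_dominated_cvg _ _ _ leb setT _ _ g) => //.
  + by move=> n; exact: (mf_ n).2.
  + exact: mf.2.
  + by move=> n x _; exact: le_trans (normr_Im_le _) (fg n x).
Qed.

(* Multiplying by [damp] makes the iterated integral absolutely convergent, and
   the inner integral becomes a product of Poisson kernels. *)
Lemma Fourier_inversion s f M x : s ^+ 2 = 1 ->
  continuous (Re \o f) -> continuous (Im \o f) -> (forall y, normc (f y) <= M) ->
  cintegrable leb setT f -> cintegrable leb setT (FT s f) ->
  FT (- s) (FT s f) x = f x.
Proof.
move=> s2 cR cI fM jf ih.
have e0 n : 0 < n.+1%:R^-1 :> R by rewrite invr_gt0.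
pose w xi := osc (- s) x xi * FT s f xi.
have iw : cintegrable leb setT w by exact: cintegrable_osc.
have wR xi : Re ((damp n.+1%:R^-1 xi)%:C%C * w xi) @[n --> \oo] --> Re (w xi).
  move: (w xi) => z; under eq_fun do rewrite cReM mul0r subr0.
  exact: cvg_dampM.
have wI xi : Im ((damp n.+1%:R^-1 xi)%:C%C * w xi) @[n --> \oo] --> Im (w xi).
  move: (w xi) => z; under eq_fun do rewrite cImM mul0r addr0.
  exact: cvg_dampM.
have wM n xi : normc ((damp n.+1%:R^-1 xi)%:C%C * w xi) <= normc (w xi).
  rewrite Normc.normcM normc_real ger0_norm ?damp_ge0//.
  by rewrite ler_piMl ?normc_ge0// damp_le1// ltW.
have [c1 c2] := @cintegral_dominated_cvg
  (fun n xi => (damp n.+1%:R^-1 xi)%:C%C * w xi) w (fun xi => normc (w xi))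
  (fun n => cmeasurableM (cmeasurable_real (measurable_damp _)) (cintegrable_cmeasurable iw))
  (cintegrable_cmeasurable iw)
  wR wI (cintegrable_normc measurableT iw) wM.
have J n : cst * cintegral leb setT (fun xi => (damp n.+1%:R^-1 xi)%:C%C * w xi) =
    cintegral leb setT (fun y => f y * (pkd n.+1%:R^-1 x y)%:C%C).
  exact: cintegral_damped_FT.
have cstE (z : C) : Re (cst * z) = Re cst * Re z /\ Im (cst * z) = Re cst * Im z.
  by rewrite cReM cImM /= !mul0r subr0 addr0.
apply: complex_ext.
- have l1 : Re (cst * cintegral leb setT (fun xi => (damp n.+1%:R^-1 xi)%:C%C * w xi))
      @[n --> \oo] --> Re (FT (- s) (FT s f) x).
    by rewrite (cstE _).1; under eq_fun do rewrite (cstE _).1; exact: cvgMl_tmp.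
  rewrite -(cvg_lim (@Rhausdorff R) l1); apply: cvg_lim; first exact: Rhausdorff.
  under eq_fun do rewrite J /=.
  under eq_fun do under eq_Rintegral do rewrite cReM/= mulr0 subr0.
  apply: approx_identity => // y; exact: le_trans (normr_Re_le _) (fM y).
- have l1 : Im (cst * cintegral leb setT (fun xi => (damp n.+1%:R^-1 xi)%:C%C * w xi))
      @[n --> \oo] --> Im (FT (- s) (FT s f) x).
    by rewrite (cstE _).2; under eq_fun do rewrite (cstE _).2; exact: cvgMl_tmp.
  rewrite -(cvg_lim (@Rhausdorff R) l1); apply: cvg_lim; first exact: Rhausdorff.
  under eq_fun do rewrite J /=.
  under eq_fun do under eq_Rintegral do rewrite cImM/= mulr0 add0r.
  apply: approx_identity => // y; exact: le_trans (normr_Im_le _) (fM y).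
Qed.


End fourier.

(** * Fourier transforms of test functions *)

Section test_fun_closure.
Context {R : realType} {d : nat}.
Local Notation Rd := 'rV[R]_d.
Local Notation leb := (lebesgue_rV R d).
Local Notation C := R[i].
Local Notation ei i := (delta_mx ord0 i : Rd).
Local Notation D := (@test_fun R d setT).
Implicit Types (chi g : Rd -> C).

Lemma test_fun_sub chi g : D chi -> csmooth g ->
  (forall x, ~ csupp chi x -> g x = 0) -> D g.
Proof.
move=> [_ cK _] sg g0; split => //.
have sub : csupp g `<=` csupp chi.
  rewrite [X in _ `<=` X]((closure_id (csupp chi)).1 _); last exact: closed_closure.
  apply: closureS => x /= gx; apply: contrapT => /g0 gx0.
  by move: gx; rewrite gx0 eqxx.
exact: (@subclosed_compact _ (csupp g) (csupp chi) (@closed_closure _ _) cK sub).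
Qed.

Lemma csmoothZ (c : C) g : csmooth g -> csmooth (fun x => c * g x).
Proof.
move=> [s1 s2]; split.
- rewrite (_ : _ \o _ = fun x => Re c * (Re \o g) x - Im c * (Im \o g) x).
    by apply: smoothB; apply: smoothZ.
  by apply/funext => x /=; rewrite cReM.
- rewrite (_ : _ \o _ = fun x => Re c * (Im \o g) x + Im c * (Re \o g) x).
    by apply: smoothD; apply: smoothZ.
  by apply/funext => x /=; rewrite cImM.
Qed.

Lemma csmoothD chi g : csmooth chi -> csmooth g -> csmooth (fun x => chi x + g x).
Proof.
move=> [s1 s2] [s3 s4]; split.
- rewrite (_ : _ \o _ = fun x => (Re \o chi) x + (Re \o g) x); first exact: smoothD.
  by apply/funext => x /=; rewrite cReD.
- rewrite (_ : _ \o _ = fun x => (Im \o chi) x + (Im \o g) x); first exact: smoothD.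
  by apply/funext => x /=; rewrite cImD.
Qed.

Lemma test_funZ (c : C) chi : D chi -> D (fun x => c * chi x).
Proof.
move=> tc; apply: (test_fun_sub tc); first by case: tc => sc _ _; exact: csmoothZ.
by move=> x /csupp_out ->; rewrite mulr0.
Qed.

Lemma test_funD chi g : D chi -> D g -> D (fun x => chi x + g x).
Proof.
move=> [s1 c1 _] [s2 c2 _]; split; [exact: csmoothD| |by []].
have sub : csupp (fun x => chi x + g x) `<=` csupp chi `|` csupp g.
  rewrite [X in _ `<=` X]((closure_id (csupp chi `|` csupp g)).1 _); last first.
    by apply: closedU; exact: closed_closure.
  apply: closureS => x /= h; apply: contrapT => /not_orP[/csupp_out h1 /csupp_out h2].
  by move: h; rewrite h1 h2 addr0 eqxx.
exact: (@subclosed_compact _ (csupp _) _ (@closed_closure _ _) (compactU c1 c2) sub).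
Qed.

(** Multiplication by i s y_i, the effect on [chi] of differentiating [FT s chi] in direction i. *)
Definition imul_coord (s : R) (i : 'I_d) chi : Rd -> C :=
  fun y => Complex 0 (s * y ord0 i) * chi y.

Lemma test_fun_imul_coord s i chi : D chi -> D (imul_coord s i chi).
Proof.
move=> tc; apply: (test_fun_sub tc); last first.
  by move=> x /csupp_out; rewrite /imul_coord => ->; rewrite mulr0.
case: tc => -[s1 s2] _ _; have sc := smoothZ s (smooth_coord (R := R) i).
split.
- rewrite (_ : _ \o _ = fun x : Rd => - ((s * x ord0 i) * (Im \o chi) x)).
    by apply: smoothN; exact: (smoothM sc s2).
  by apply/funext => x /=; rewrite /imul_coord cReM/= mul0r sub0r.
- rewrite (_ : _ \o _ = fun x : Rd => (s * x ord0 i) * (Re \o chi) x).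
    exact: (smoothM sc s1).
  by apply/funext => x /=; rewrite /imul_coord cImM/= mul0r add0r.
Qed.

Lemma derive_near0 (g : Rd -> R) (K : set Rd) (v : Rd) x : closed K ->
  (forall x, ~ K x -> g x = 0) -> ~ K x -> 'D_v g x = 0.
Proof.
move=> cK g0 xK; have oK : open (~` K) by exact: closed_openC.
rewrite -(derive_cst (0 : R) x v); apply: near_eq_derive.
by have := open_nbhs_nbhs (conj oK xK); apply: filterS => y /g0.
Qed.

Lemma test_fun_partial i chi : D chi -> D (cpartials [:: i] chi).
Proof.
move=> tc; apply: (test_fun_sub tc).
  by case: tc => -[s1 s2] _ _; split; exact: smooth_D.
move=> x xK; apply: complex_ext => /=;
  by apply: (@derive_near0 _ (csupp chi)) xK; [exact: closed_closure|move=> y /csupp_out h /=; rewrite h].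
Qed.

Lemma test_fun_cbox chi : D chi -> exists N : nat,
  forall x, ~ cbox (const_mx (- N%:R)) (const_mx N%:R) x -> chi x = 0.
Proof.
move=> [_ cK _]; have [N KN] := compact_sub_cbox cK; exists N => x xN.
by apply: csupp_out => /KN.
Qed.

Lemma integrable_compact_supp (g : Rd -> R) (K : set Rd) (M : R) : compact K ->
  measurable_fun setT g -> (forall x, `|g x| <= M) -> (forall x, ~ K x -> g x = 0) ->
  leb.-integrable setT (EFin \o g).
Proof.
move=> cK mg gM g0; have mK := compact_measurable_rV cK.
have iK' : leb.-integrable K (EFin \o g).
  apply: measurable_bounded_integrable => //; first exact: compact_lebesgue_lty.
    exact: measurable_funS mg.
  by exists M; split; [exact: num_real|move=> N MN x _; exact: le_trans (gM x) (ltW MN)].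
move/(integrable_patchR _ mK) : iK'; congr (_.-integrable _ (EFin \o _)).
apply/funext => x; rewrite /patch; case: ifPn => // /negP xK.
by rewrite g0// => Kx; apply: xK; rewrite inE.
Qed.

Lemma cintegrable_test_fun chi : D chi -> cintegrable leb setT chi.
Proof.
move=> tc; have [M M0 hM] := test_fun_bounded tc.
have [sc cK _] := tc; have [m1 m2] := csmooth_cmeasurable sc.
split; apply: (integrable_compact_supp (M := M) cK) => //.
- by move=> x; exact: le_trans (normr_Re_le _) (hM x).
- by move=> x /csupp_out h /=; rewrite h.
- by move=> x; exact: le_trans (normr_Im_le _) (hM x).
- by move=> x /csupp_out h /=; rewrite h.
Qed.

End test_fun_closure.

(** * Vanishing integrals of compactly supported derivatives *)

Section integral_of_partial.
Context {R : realType}.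
Local Notation mu := (@lebesgue_measure R).

Lemma Rintegral_deriv_line (G G1 : R -> R) (N : nat) : continuous G1 ->
  (forall t : R, is_derive t (1 : R) G (G1 t)) -> (forall t, N%:R < `|t| -> G t = 0) ->
  \int[mu]_t G1 t = 0.
Proof.
move=> cG1 dG G0.
have G10 (t : R) : N%:R < `|t| -> G1 t = 0.
  move=> ht; rewrite -(@derive_val _ _ _ _ _ _ _ (dG t)).
  rewrite -(derive_cst (0 : R) t (1 : R)); apply: near_eq_derive.
  have : nbhs t [set t | N%:R < `|t|].
    apply: open_nbhs_nbhs; split => //.
    apply: (@open_comp _ _ (fun t : R => `|t|) [set x | N%:R < x]); last exact: open_gt.
    by move=> x _; exact: norm_continuous.
  by apply: filterS => y /G0.
(* The endpoints are N + 1 and -(N + 1), strictly outside [-N, N], since G is known to vanish only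
   where |t| > N. *)
transitivity (\int[mu]_(t in `[- N.+1%:R, N.+1%:R]) G1 t).
  rewrite [RHS]Rintegral_mkcond; apply: eq_Rintegral => t _; rewrite /patch.
  case: ifPn => // /negP h; apply: G10; rewrite ltNge; apply/negP => tN.
  apply: h; rewrite inE/= in_itv/= -ler_norml (le_trans tN)// ler_nat.
  by [].
have N1 : - N.+1%:R <= N.+1%:R :> R.
  by rewrite (@le_trans _ _ 0)// ?oppr_le0.
have -> := Rintegral_FTC2 N1 cG1 dG.
by rewrite !G0 ?subrr// ?normrN ger0_norm// ltr_nat.
Qed.

Lemma continuous_rV_cons1 n (v : 'rV[R]_n) : continuous (fun x : R => rV_cons (x, v)).
Proof.
move=> x; apply/cvg_ballP => e e0; near=> y.
apply/ball_rVE => // i; have [j ->|->] := unliftP ord0 i.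
  by rewrite !rV_consS subrr normr0.
by rewrite !rV_cons0; near: y; apply/nbhs_ballP; exists e.
Unshelve. all: by end_near. Qed.

Lemma continuous_rV_cons2 n (x : R) : continuous (fun v : 'rV[R]_n => rV_cons (x, v)).
Proof.
move=> v A /nbhs_ballP[e e0 hA]; apply/nbhs_ballP; exists e => //= w vw.
apply: hA; apply/ball_rVE => // i; have [j ->|->] := unliftP ord0 i; last first.
  by rewrite !rV_cons0 subrr normr0.
by rewrite !rV_consS; move: j; apply/ball_rVE.
Qed.

Lemma rV_cons_add0 n (x t : R) (v : 'rV[R]_n) :
  t *: delta_mx ord0 ord0 + rV_cons (x, v) = rV_cons (t + x, v).
Proof.
apply/rowP => i; rewrite !mxE eqxx/=; have [j ->|->] := unliftP ord0 i.
  by rewrite eq_sym (negbTE (neq_lift _ _)) mulr0 add0r.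
by rewrite eqxx mulr1.
Qed.

Lemma rV_cons_addS n (x t : R) (v : 'rV[R]_n) j :
  t *: delta_mx ord0 (lift ord0 j) + rV_cons (x, v) =
  rV_cons (x, t *: delta_mx ord0 j + v).
Proof.
apply/rowP => i; rewrite !mxE eqxx/=; have [k ->|->] := unliftP ord0 i.
  by rewrite /= !mxE (inj_eq lift_inj).
by rewrite (negbTE (neq_lift _ _)) mulr0 add0r.
Qed.

(** Induction on the dimension. If i is the first coordinate, it is integrated innermost, by the
    fundamental theorem of calculus on a line; otherwise the first coordinate is frozen and the
    induction hypothesis applies to the slice. *)
Lemma cintegral_partial0 n (g : 'rV[R]_n -> R) (i : 'I_n) (N : nat) :
  continuous ('D_(delta_mx ord0 i) g) ->
  (forall x, derivable g x (delta_mx ord0 i)) ->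
  (forall x, ~ cbox (const_mx (- N%:R)) (const_mx N%:R) x -> g x = 0) ->
  cintegral (lebesgue_rV R n) setT (fun x => ('D_(delta_mx ord0 i) g x)%:C%C) = 0.
Proof.
elim: n g i => [|n IH] g i cg dg g0; first by case: i cg dg.
have ig : cintegrable (lebesgue_rV R n.+1) setT (fun x => ('D_(delta_mx ord0 i) g x)%:C%C).
  split; last exact: integrable0.
  have cK := @compact_cbox R n.+1 (const_mx (- N%:R)) (const_mx N%:R).
  have D0 x : ~ cbox (const_mx (- N%:R)) (const_mx N%:R) x -> 'D_(delta_mx ord0 i) g x = 0.
    by apply: derive_near0 g0; exact: closed_cbox.
  have : compact ('D_(delta_mx ord0 i) g @` cbox (const_mx (- N%:R)) (const_mx N%:R)).
    by apply: continuous_compact => //; exact: continuous_subspaceT.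
  move=> /compact_bounded[M [_ hM]].
  apply: (@integrable_compact_supp _ _ _ _ (`|M| + 1) cK) => //.
    exact: continuous_measurable_rV.
  move=> x /=; have [xK|/D0 ->] := pselect (cbox (const_mx (- N%:R)) (const_mx N%:R) x).
    apply: (hM (`|M| + 1)); last by exists x.
    by rewrite (le_lt_trans (ler_norm _))// ltrDl.
  by rewrite normr0 addr_ge0.
have [j Ei|Ei] := unliftP ord0 i.
- rewrite (cintegral_rVS12 ig) (_ : (fun x => _) = fun=> 0); last first.
    apply/funext => x; pose gx (v : 'rV[R]_n) := g (rV_cons (x, v)).
    have E v : (fun h : R => h^-1 *: (g (h *: delta_mx ord0 i + rV_cons (x, v)) - g (rV_cons (x, v)))) =
        (fun h : R => h^-1 *: (gx (h *: delta_mx ord0 j + v) - gx v)).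
      by apply/funext => h; rewrite Ei rV_cons_addS.
    have dEv v : 'D_(delta_mx ord0 j) gx v = 'D_(delta_mx ord0 i) g (rV_cons (x, v)).
      by rewrite /derive E.
    have dE := funext dEv.
    rewrite -[RHS](IH gx j).
    + by apply: eq_cintegral => v _; rewrite dEv.
    + have cD : continuous (('D_(delta_mx ord0 i) g) \o (fun v => rV_cons (x, v))).
        move=> v; apply: continuous_comp; first exact: continuous_rV_cons2.
        exact: cg.
      by move: cD; rewrite /comp -dE.
    + by move=> v; have := dg (rV_cons (x, v)); rewrite /derivable E.
    + move=> v hv; apply: g0 => h; apply: hv => k; have := h (lift ord0 k).
      by rewrite rV_consS !mxE.
  by rewrite /cintegral /Rintegral !integral0.
- rewrite (cintegral_rVS21 ig) (_ : (fun x => _) = fun=> 0); last first.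
    apply/funext => v; pose gv (x : R) := g (rV_cons (x, v)).
    rewrite /cintegral/= {2}/Rintegral integral0; congr Complex.
    apply: (@Rintegral_deriv_line gv _ N).
    + move=> x; apply: (@continuous_comp _ _ _ (fun x => rV_cons (x, v))
        ('D_(delta_mx ord0 i) g) x); first exact: continuous_rV_cons1.
      exact: cg.
    + move=> t; have E : (fun h : R => h^-1 *: (g (h *: delta_mx ord0 i + rV_cons (t, v)) - g (rV_cons (t, v)))) =
          (fun h : R => h^-1 *: (gv (h%:A + t) - gv t)).
        by apply/funext => h; rewrite Ei rV_cons_add0 [h%:A]mulr1.
      apply: DeriveDef; last by rewrite /derive E.
      by have := dg (rV_cons (t, v)); rewrite /derivable E.
    + move=> t ht; apply: g0 => h; move: ht; apply/negP; rewrite -leNgt ler_norml.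
      by have := h ord0; rewrite rV_cons0 !mxE.
  by rewrite /cintegral /Rintegral !integral0.
Qed.

End integral_of_partial.

Section fourier_test_fun.
Context {R : realType} {d : nat}.
Local Notation Rd := 'rV[R]_d.
Local Notation leb := (lebesgue_rV R d).
Local Notation C := R[i].
Local Notation ei i := (delta_mx ord0 i : Rd).
Local Notation D := (@test_fun R d setT).
Implicit Types (chi g : Rd -> C) (s : R).

Lemma cintegral_cpartial0 i chi : D chi -> cintegral leb setT (cpartials [:: i] chi) = 0.
Proof.
move=> tc; have [N hN] := test_fun_cbox tc; have [[s1 s2] _ _] := tc.
have hR := @cintegral_partial0 R d (Re \o chi) i N (smooth_cts (@smooth_D _ _ _ i s1))
  (fun x => @smooth_derivable _ _ _ i x s1) (fun x h => congr1 Re (hN x h)).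
have hI := @cintegral_partial0 R d (Im \o chi) i N (smooth_cts (@smooth_D _ _ _ i s2))
  (fun x => @smooth_derivable _ _ _ i x s2) (fun x h => congr1 Im (hN x h)).
by apply: complex_ext; [have := congr1 Re hR|have := congr1 Re hI].
Qed.

Lemma is_derive_trig (A B p q t : R) : is_derive t (1 : R)
  (fun t => A * cos (p * t + q) + B * sin (p * t + q))
  (p * (B * cos (p * t + q) - A * sin (p * t + q))).
Proof.
have dl : is_derive t (1 : R) (fun t => p * t + q) p.
  have := is_deriveD (is_derive_mull p t) (is_derive_cst q t (1 : R)).
  by apply: is_derive_conv; rewrite addr0.
have dC : is_derive t (1 : R) (fun t => cos (p * t + q)) (- sin (p * t + q) * p).
  exact: (@is_derive1_comp R cos (fun t => p * t + q) t _ _ _ dl).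
have dS : is_derive t (1 : R) (fun t => sin (p * t + q)) (cos (p * t + q) * p).
  exact: (@is_derive1_comp R sin (fun t => p * t + q) t _ _ _ dl).
have := is_deriveD (@is_deriveZ _ _ _ _ A _ _ _ dC) (@is_deriveZ _ _ _ _ B _ _ _ dS).
by apply: is_derive_conv; rewrite /GRing.scale/=; ring.
Qed.

Lemma dotp_add (i : 'I_d) (t : R) (x y : Rd) :
  dotp (t *: ei i + x) y = y ord0 i * t + dotp x y.
Proof.
rewrite /dotp; under eq_bigr do rewrite !mxE eqxx/= mulrDl.
rewrite big_split/=; congr (_ + _); rewrite (bigD1 i)//= eqxx mulr1 big1 ?addr0.
  exact: mulrC.
by move=> j ji; rewrite (negbTE ji) mulr0 mul0r.
Qed.

Lemma normcN (z : C) : normc (- z) = normc z.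
Proof. by rewrite !normc_sqrt cReN cImN !sqrrN. Qed.

Lemma oscE s (x y : Rd) : osc s x y = Complex (cos (s * dotp x y)) (sin (s * dotp x y)) :> C.
Proof. by rewrite /osc /cexp/= expR0 !mul1r. Qed.

Lemma is_derive_osc (A B s : R) (i : 'I_d) (x y : Rd) : is_derive x (ei i)
  (fun x => A * cos (s * dotp x y) + B * sin (s * dotp x y))
  (s * y ord0 i * (B * cos (s * dotp x y) - A * sin (s * dotp x y))).
Proof.
apply: is_derive_along.
have := is_derive_trig A B (s * y ord0 i) (s * dotp x y) 0.
rewrite mulr0 add0r; congr is_derive; apply/funext => t.
by rewrite dotp_add mulrDr mulrA.
Qed.

Lemma smooth_dotp (x : Rd) : smooth (fun y : Rd => dotp y x).
Proof.
rewrite /dotp; elim: (index_enum _) => [|i r IH].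
  by under eq_fun do rewrite big_nil; exact: smooth_cst.
under eq_fun do rewrite big_cons.
apply: smoothD IH; apply: smoothM; [exact: smooth_coord|exact: smooth_cst].
Qed.

(** Combinations of cosine and sine are stable under partial derivatives: the pair (A, B) becomes s
    x_i (B, -A). *)
Lemma smooth_osc (A B s : R) (x : Rd) :
  smooth (fun y : Rd => A * cos (s * dotp y x) + B * sin (s * dotp y x)).
Proof.
pose P (g : Rd -> R) := exists A B : R,
  g = fun y => A * cos (s * dotp y x) + B * sin (s * dotp y x).
apply: (@smooth_coind R d P); last by exists A, B.
move=> _ [{}A [{}B ->]]; split=> [y|i y|i].
- have cd := smooth_cts (smoothZ s (smooth_dotp x)).
  have cphi : continuous (fun u : R => A * cos u + B * sin u).
    move=> u; apply: cvgD; apply: cvgMl_tmp; [exact: continuous_cos|exact: continuous_sin].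
  exact: (continuous_comp (cd y) (cphi _)).
- exact: (@ex_derive _ _ _ _ _ _ _ (is_derive_osc A B s i y x)).
- exists (s * x ord0 i * B), (- (s * x ord0 i * A)); apply/funext => y.
  by rewrite (@derive_val _ _ _ _ _ _ _ (is_derive_osc A B s i y x)); ring.
Qed.

Lemma smooth_cos_dotp s (x : Rd) : smooth (fun y : Rd => cos (s * dotp y x)).
Proof.
have := smooth_osc 1 0 s x; congr smooth; apply/funext => y.
by rewrite mul1r mul0r addr0.
Qed.

Lemma smooth_sin_dotp s (x : Rd) : smooth (fun y : Rd => sin (s * dotp y x)).
Proof.
have := smooth_osc 0 1 s x; congr smooth; apply/funext => y.
by rewrite mul1r mul0r add0r.
Qed.

Lemma test_fun_osc s (x : Rd) chi : D chi -> D (fun y => osc s x y * chi y).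
Proof.
move=> tc; apply: (test_fun_sub tc); last by move=> y /csupp_out ->; rewrite mulr0.
have [[s1 s2] _ _] := tc; have sC := smooth_cos_dotp s x; have sS := smooth_sin_dotp s x.
split.
- rewrite (_ : _ \o _ = fun y => cos (s * dotp y x) * (Re \o chi) y -
      sin (s * dotp y x) * (Im \o chi) y).
    by apply: smoothB; [exact: (smoothM sC s1)|exact: (smoothM sS s2)].
  by apply/funext => y /=; rewrite cReM oscC oscE.
- rewrite (_ : _ \o _ = fun y => cos (s * dotp y x) * (Im \o chi) y +
      sin (s * dotp y x) * (Re \o chi) y).
    by apply: smoothD; [exact: (smoothM sC s2)|exact: (smoothM sS s1)].
  by apply/funext => y /=; rewrite cImM oscC oscE.
Qed.

Lemma cpartial_osc s i (x : Rd) chi y : D chi ->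
  cpartials [:: i] (fun y => osc s x y * chi y) y =
  Complex 0 (s * x ord0 i) * (osc s x y * chi y) + osc s x y * cpartials [:: i] chi y.
Proof.
move=> [[s1 s2] _ _].
have dv (g : Rd -> R) : smooth g -> is_derive y (ei i) g ('D_(ei i) g y).
  by move=> sg; apply: DeriveDef => //; exact: smooth_derivable.
have dC : is_derive y (ei i) (fun y => cos (s * dotp y x)) (- (s * x ord0 i * sin (s * dotp y x))).
  have := is_derive_osc 1 0 s i y x; rewrite mul0r mul1r sub0r mulrN.
  by congr is_derive; apply/funext => z; rewrite mul1r mul0r addr0.
have dS : is_derive y (ei i) (fun y => sin (s * dotp y x)) (s * x ord0 i * cos (s * dotp y x)).
  have := is_derive_osc 0 1 s i y x; rewrite mul0r mul1r subr0.
  by congr is_derive; apply/funext => z; rewrite mul1r mul0r add0r.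
apply: complex_ext.
- rewrite /cpartials/= (_ : _ \o _ = (fun y => cos (s * dotp y x)) * (Re \o chi) -
    (fun y => sin (s * dotp y x)) * (Im \o chi)); last first.
    by apply/funext => z /=; rewrite cReM oscC oscE.
  have := is_deriveB (is_deriveM dC (dv _ s1)) (is_deriveM dS (dv _ s2)).
  move=> /(@derive_val _ _ _ _ _ _ _) ->.
  rewrite oscC oscE /GRing.scale /=; case: (chi y) => a b /=; ring.
- rewrite /cpartials/= (_ : _ \o _ = (fun y => cos (s * dotp y x)) * (Im \o chi) +
    (fun y => sin (s * dotp y x)) * (Re \o chi)); last first.
    by apply/funext => z /=; rewrite cImM oscC oscE.
  have := is_deriveD (is_deriveM dC (dv _ s2)) (is_deriveM dS (dv _ s1)).
  move=> /(@derive_val _ _ _ _ _ _ _) ->.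
  rewrite oscC oscE /GRing.scale /=; case: (chi y) => a b /=; ring.
Qed.

(** Integration by parts: the partial derivative of the oscillation times [chi] has integral 0, and
    the Leibniz rule splits it into the two sides. *)
Lemma FT_cpartial s i chi (x : Rd) : D chi ->
  Complex 0 (s * x ord0 i) * FT s chi x = - FT s (cpartials [:: i] chi) x.
Proof.
move=> tc; have i1 := cintegrable_test_fun (test_fun_osc s x tc).
have i2 := cintegrable_test_fun (test_fun_osc s x (test_fun_partial i tc)).
have := cintegral_cpartial0 i (test_fun_osc s x tc).
under eq_cintegral do rewrite cpartial_osc//.
rewrite cintegralD//; last exact: cintegrableZ.
rewrite cintegralZ// => /eqP; rewrite addr_eq0 => /eqP h.
by rewrite /FT mulrCA h mulrN.
Qed.

Lemma normc_FT_coord s i chi (x : Rd) : s ^+ 2 = 1 -> D chi ->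
  `|x ord0 i| * normc (FT s chi x) = normc (FT s (cpartials [:: i] chi) x).
Proof.
move=> s2 tc; rewrite -[RHS]normcN -FT_cpartial// [RHS]Normc.normcM.
congr (_ * _); rewrite normc_sqrt/= expr0n/= add0r exprMn s2 mul1r.
by rewrite sqrtr_sqr.
Qed.

Lemma enorm_le (x : Rd) : enorm x <= \sum_(i < d) `|x ord0 i|.
Proof.
rewrite /enorm -[leRHS]ger0_norm ?sumr_ge0// -sqrtr_sqr ler_wsqrtr//.
rewrite /dotp expr2 mulr_suml; apply: ler_sum => i _.
rewrite -expr2 -real_normK ?num_real// expr2 ler_wpM2l//.
by rewrite (bigD1 i)//= lerDl sumr_ge0.
Qed.

Lemma normc_FT_le s chi (x : Rd) : D chi -> normc (FT s chi x) <=
  normc (Fourier_cst (R := R) (d := d)) * (2 * \int[leb]_y normc (chi y)).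
Proof.
move=> tc; rewrite /FT Normc.normcM ler_wpM2l ?normc_ge0//.
have ic := cintegrable_test_fun tc; apply: le_normc_cintegral_le => //.
- exact: cintegrable_cmeasurable (cintegrable_osc s x ic).
- exact: cintegrable_normc.
- by move=> y _; rewrite Normc.normcM normc_osc mul1r.
Qed.

(** One factor |x| <= sum_i |x_i| at a time is traded for a derivative of [chi], which is again a
    test function. *)
Lemma FT_decay s chi (k : nat) : s ^+ 2 = 1 -> D chi ->
  exists M : R, forall x, enorm x ^+ k * normc (FT s chi x) <= M.
Proof.
move=> s2; elim: k chi => [|k IH] chi tc.
  by eexists => x; rewrite expr0 mul1r; exact: normc_FT_le.
have /choice[M hM] (i : 'I_d) := IH _ (test_fun_partial i tc).
exists (\sum_(i < d) M i) => x; rewrite exprS.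
rewrite (@le_trans _ _ (\sum_(i < d) `|x ord0 i| * (enorm x ^+ k * normc (FT s chi x))))//.
  rewrite -mulr_suml -mulrA ler_wpM2r ?enorm_le//.
  by rewrite mulr_ge0 ?normc_ge0// exprn_ge0// sqrtr_ge0.
apply: ler_sum => i _; rewrite mulrCA normc_FT_coord//; exact: hM.
Qed.

Lemma normr_cosB_le (a b : R) : `|cos a - cos b| <= `|a - b|.
Proof.
have [c [_ _ ->]] := @MVT_le R cos (fun x => - sin x) (Num.max `|a| `|b|) b a
  (fun x => is_derive_cos x) (ltac:(by rewrite le_max lexx orbT)) (ltac:(by rewrite le_max lexx)).
by rewrite normrM normrN ler_piMl// normr_sin_le1.
Qed.

Lemma normr_sinB_le (a b : R) : `|sin a - sin b| <= `|a - b|.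
Proof.
have [c [_ _ ->]] := @MVT_le R sin cos (Num.max `|a| `|b|) b a
  (fun x => is_derive_sin x) (ltac:(by rewrite le_max lexx orbT)) (ltac:(by rewrite le_max lexx)).
by rewrite normrM ler_piMl// normr_cos_le1.
Qed.

Lemma normc_oscB s (x x' y : Rd) (e : R) (N : nat) : s ^+ 2 = 1 ->
  (forall i, `|x ord0 i - x' ord0 i| <= e) -> (forall i, `|y ord0 i| <= N%:R) ->
  normc (osc s x y - osc s x' y) <= 2 * (d%:R * N%:R * e).
Proof.
move=> s2 hx hy; have s1 : `|s| = 1.
  by apply/eqP; rewrite -(@eqrXn2 _ 2)// ?expr1n// -normrX s2 normr1.
have hd : `|s * dotp x y - s * dotp x' y| <= d%:R * N%:R * e.
  rewrite -mulrBr normrM s1 mul1r /dotp -sumrB (le_trans (ler_norm_sum _ _ _))//.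
  rewrite (le_trans (ler_sum _ (G := fun=> e * N%:R) _))//.
    by move=> i _; rewrite -mulrBl normrM ler_pM.
  by rewrite sumr_const card_ord -mulr_natl; lra.
rewrite (le_trans (normc_le_ReIm _))// !ReIm_simp !oscE/= mulr_natl mulr2n lerD//.
  exact: le_trans (normr_cosB_le _ _) hd.
exact: le_trans (normr_sinB_le _ _) hd.
Qed.

(** The transform is Lipschitz, with a constant given by the support and the L^1 norm of [chi]: the
    oscillation changes by at most 2 d N e when x moves by e in the sup norm and all |y_i| <= N. *)
Lemma continuous_Re_FT s chi : s ^+ 2 = 1 -> D chi -> continuous (Re \o FT s chi).
Proof.
move=> s2 tc; have [N hN] := test_fun_cbox tc; have ic := cintegrable_test_fun tc.
have inc := cintegrable_normc measurableT ic.
pose I := \int[leb]_y normc (chi y).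
pose K := normc (Fourier_cst (R := R) (d := d)) * (2 * (2 * (d%:R * N%:R) * I)).
have I0 : 0 <= I by apply: Rintegral_ge0 => y _; exact: normc_ge0.
have K0 : 0 <= K by rewrite !mulr_ge0 ?normc_ge0.
have lip (x x' : Rd) e : 0 <= e -> (forall i, `|x ord0 i - x' ord0 i| <= e) ->
    `|Re (FT s chi x) - Re (FT s chi x')| <= K * e.
  move=> e0 hx; rewrite -cReN -cReD (le_trans (normr_Re_le _))//.
  have i1 := cintegrable_osc s x ic; have i2 := cintegrable_osc s x' ic.
  rewrite /FT -mulrBr -cintegralB// Normc.normcM /K -mulrA ler_wpM2l ?normc_ge0//.
  pose h y := 2 * (d%:R * N%:R * e) * normc (chi y).
  have ih : leb.-integrable setT (EFin \o h) by exact: integrable_scaleR.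
  have -> : 2 * (2 * (d%:R * N%:R) * I) * e = 2 * \int[leb]_y h y.
    by rewrite /h RintegralZl// -/I; ring.
  apply: le_normc_cintegral_le => //.
    apply: cmeasurableD; first exact: cintegrable_cmeasurable i1.
    exact: (cmeasurableN (cintegrable_cmeasurable i2)).
  move=> y _; rewrite -mulrBl Normc.normcM /h.
  have [->|yn0] := eqVneq (chi y) 0; first by rewrite Normc.normc0 !mulr0.
  rewrite ler_wpM2r ?normc_ge0//; apply: normc_oscB => // i.
  have : cbox (const_mx (- N%:R)) (const_mx N%:R) y.
    by apply: contrapT => /hN /eqP; rewrite (negbTE yn0).
  by move=> /(_ i); rewrite !mxE ler_norml.
move=> x A /nbhs_ballP[e /= e0 hA].
(* K + 1 instead of K avoids a zero denominator and makes the final inequality strict. *)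
pose e' := e / (K + 1); have e'0 : 0 < e' by rewrite divr_gt0// ltr_wpDl.
apply/nbhs_ballP; exists e' => //= x' h; apply: hA.
suff : `|Re (FT s chi x) - Re (FT s chi x')| < e by [].
rewrite (le_lt_trans (lip x x' e' (ltW e'0) _))//.
  by move=> i; apply: ltW; move: i; apply/ball_rVE.
by rewrite /e' mulrCA gtr_pMr// ltr_pdivrMr ?mul1r ?ltrDl// ltr_wpDl.
Qed.

Lemma is_derive_Re_osc s i (x : Rd) chi y (t : R) : is_derive t (1 : R)
  (fun t => Re (osc s (t *: ei i + x) y * chi y))
  (Re (osc s (t *: ei i + x) y * imul_coord s i chi y)).
Proof.
have := is_derive_trig (Re (chi y)) (- Im (chi y)) (s * y ord0 i) (s * dotp x y) t.
have E (u : R) : s * dotp (u *: ei i + x) y = s * y ord0 i * u + s * dotp x y.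
  by rewrite dotp_add mulrDr mulrA.
have -> : (fun t => Re (osc s (t *: ei i + x) y * chi y)) =
    (fun t => Re (chi y) * cos (s * y ord0 i * t + s * dotp x y) +
      - Im (chi y) * sin (s * y ord0 i * t + s * dotp x y)).
  by apply/funext => u; rewrite cReM oscE/= E; ring.
apply: is_derive_conv; rewrite cReM oscE /imul_coord cReM cImM/= E; ring.
Qed.

(** Differentiation under the integral sign along the line t e_i + x, for t in ]-1, 1[. The
    derivative of the integrand is dominated by |[imul_coord s i chi y]|, which does not depend on
    t. *)
Lemma is_derive_Re_FT s i chi (x : Rd) : D chi ->
  is_derive x (ei i) (Re \o FT s chi) (Re (FT s (imul_coord s i chi) x)).
Proof.
move=> tc; apply: is_derive_along.
pose f (t : R) (y : Rd) := Re (osc s (t *: ei i + x) y * chi y).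
have intf t : leb.-integrable setT (EFin \o f t).
  by have [] := cintegrable_osc s (t *: ei i + x) (cintegrable_test_fun tc).
have d1f t y : derive1 (f ^~ y) t = Re (osc s (t *: ei i + x) y * imul_coord s i chi y).
  by rewrite derive1E; exact: (@derive_val _ _ _ _ _ _ _ (is_derive_Re_osc s i x chi y t)).
have tm := test_fun_imul_coord s i tc.
have iG := cintegrable_normc measurableT (cintegrable_test_fun tm).
have G0 y : 0 <= normc (imul_coord s i chi y) by exact: normc_ge0.
have I0 : `]-1, 1[%classic (0 : R) by rewrite /= in_itv/= ltrN10 ltr01.
have df (t : R) (y : Rd) : `]-1, 1[%classic t -> setT y -> derivable (f^~ y) t 1.
  by move=> _ _; exact: (@ex_derive _ _ _ _ _ _ _ (is_derive_Re_osc s i x chi y t)).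
have Gub (t : R) (y : Rd) : `]-1, 1[%classic t -> setT y ->
    `|partial1of2 f t y| <= normc (imul_coord s i chi y).
  move=> _ _; rewrite /partial1of2 d1f (le_trans (normr_Re_le _))//.
  by rewrite Normc.normcM normc_osc mul1r.
have dF := derivable_under_integral measurableT I0 (fun t _ => intf t) df G0 iG Gub.
have vF := differentiation_under_integral measurableT I0 (fun t _ => intf t) df G0 iG Gub.
have dI : is_derive (0 : R) (1 : R) (fun t => \int[leb]_y f t y)
    (\int[leb]_y Re (osc s x y * imul_coord s i chi y)).
  apply: DeriveDef; first exact: dF.
  rewrite -derive1E vF; apply: eq_Rintegral => y _.
  by rewrite /partial1of2 d1f scale0r add0r.
have := @is_deriveZ _ _ _ _ (Re (Fourier_cst (R := R) (d := d))) _ _ _ dI.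
have -> : (fun t : R => (Re \o FT s chi) (t *: ei i + x)) =
    (Re (Fourier_cst (R := R) (d := d)) \*: (fun t => \int[leb]_y f t y)).
  by apply/funext => t /=; rewrite mul0r subr0.
by apply: is_derive_conv; rewrite /FT cReM/= mul0r subr0.
Qed.

Lemma smooth_Re_FT s chi : s ^+ 2 = 1 -> D chi -> smooth (Re \o FT s chi).
Proof.
move=> s2 tc; pose P (g : Rd -> R) := exists2 chi, D chi & g = Re \o FT s chi.
apply: (@smooth_coind R d P); last by exists chi.
move=> _ [g tg ->]; split=> [|i x|i]; first exact: continuous_Re_FT.
- exact: (@ex_derive _ _ _ _ _ _ _ (is_derive_Re_FT s i x tg)).
- exists (imul_coord s i g); first exact: test_fun_imul_coord.
  by apply/funext => x; rewrite (@derive_val _ _ _ _ _ _ _ (is_derive_Re_FT s i x tg)).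
Qed.

Lemma FTZ s (c : C) g x : cintegrable leb setT g ->
  FT s (fun y => c * g y) x = c * FT s g x.
Proof.
move=> ig; rewrite /FT; under eq_cintegral do rewrite mulrCA.
by rewrite cintegralZ//; [exact: mulrCA|exact: cintegrable_osc].
Qed.

Lemma FTD s f g x : cintegrable leb setT f -> cintegrable leb setT g ->
  FT s (fun y => f y + g y) x = FT s f x + FT s g x.
Proof.
move=> jf ig; rewrite /FT; under eq_cintegral do rewrite mulrDr.
by rewrite cintegralD ?mulrDr//; exact: cintegrable_osc.
Qed.

(** Im z = Re(-i z), and -i [chi] is again a test function; smoothness thus has to be proved for
    real parts only. *)
Lemma Im_FT s chi : D chi -> Im \o FT s chi = Re \o FT s (fun y => Complex 0 (-1) * chi y).
Proof.
move=> tc; apply/funext => x; transitivity (Re (Complex 0 (-1) * FT s chi x)).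
  by rewrite /comp; case: (FT s chi x) => a b /=; ring.
by rewrite -FTZ//; exact: cintegrable_test_fun.
Qed.

Lemma csmooth_FT s chi : s ^+ 2 = 1 -> D chi -> csmooth (FT s chi).
Proof.
move=> s2 tc; split; first exact: smooth_Re_FT.
by rewrite Im_FT//; apply: smooth_Re_FT => //; exact: test_funZ.
Qed.

(** Induction from the right end of the list: the derivative that acts first only replaces [chi] by
    [imul_coord s i chi]. *)
Lemma cpartials_FT s (l : seq 'I_d) chi : s ^+ 2 = 1 -> D chi ->
  exists2 chi', D chi' & cpartials l (FT s chi) = FT s chi'.
Proof.
move=> s2; elim/last_ind: l chi => [|l i IH] chi tc.
  by exists chi => //; apply/funext => x; apply: complex_ext.
have [chi' t' E] := IH _ (test_fun_imul_coord s i tc); exists chi' => //.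
rewrite -E; apply/funext => x; rewrite /cpartials /partials !foldr_rcons.
have tz : D (fun y => Complex 0 (-1) * chi y) by exact: test_funZ.
have tm := test_fun_imul_coord s i tc.
congr Complex; congr (foldr _ _ l x); apply/funext => y.
  by rewrite (@derive_val _ _ _ _ _ _ _ (is_derive_Re_FT s i y tc)).
rewrite Im_FT// (@derive_val _ _ _ _ _ _ _ (is_derive_Re_FT s i y tz)) Im_FT//.
congr (Re (FT s _ y)); apply/funext => z.
by rewrite /imul_coord mulrCA.
Qed.

Lemma schwartz_FT s chi : s ^+ 2 = 1 -> D chi -> schwartz (FT s chi).
Proof.
move=> s2 tc; split; first exact: csmooth_FT.
move=> l k; have [chi' t' ->] := cpartials_FT l s2 tc; exact: FT_decay.
Qed.

Lemma cpartials0 (f : Rd -> C) x : cpartials [::] f x = f x.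
Proof. exact: complex_ext. Qed.

Lemma schwartz_bounded (phi : Rd -> C) : schwartz phi ->
  exists M, forall x, normc (phi x) <= M.
Proof.
move=> [_ /(_ [::] 0%N)[M hM]]; exists M => x; have := hM x.
by rewrite expr0 mul1r cpartials0.
Qed.

(** The comparison function is the kernel [pkd 1 0], that is prod_i 1 / (pi (1 + x_i^2)). Its
    reciprocal is at most pi^d 2^d (1 + |x|^(2d)), so the Schwartz bounds with weights of degree 0
    and 2d give the constant. *)
Lemma schwartz_integrable (phi : Rd -> C) : schwartz phi -> cintegrable leb setT phi.
Proof.
move=> [sphi dec]; have [M0 h0] := dec [::] 0%N; have [M1 h1] := dec [::] (d.*2)%N.
have ik := integrable_scaleR measurableT (2 ^+ d * pi ^+ d * (M0 + M1))
  (@integrable_pkd R d 1 0 ltr01).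
apply: (cintegrable_le _ _ ik) => //; first exact: csmooth_cmeasurable.
move=> x _; have := h0 x; have := h1 x; rewrite cpartials0 expr0 mul1r => hx1 hx0.
set p := normc (phi x) in hx1 hx0 *; have p0 : 0 <= p by exact: normc_ge0.
have e0 : 0 <= enorm x by exact: sqrtr_ge0.
pose q := \prod_(i < d) (1 + x ord0 i ^+ 2).
have q0 : 0 < q by apply: prodr_gt0 => i _; rewrite ltr_wpDr// sqr_ge0.
have -> : pkd 1 0 x = (pi ^+ d * q)^-1.
  rewrite /pkd /q -[d in _ ^+ d]card_ord -prodr_const -big_split/= -prodfV.
  by apply: eq_bigr => i _; rewrite /pk mxE subr0 expr1n div1r.
have q1 : q <= 2 ^+ d * (1 + enorm x ^+ d.*2).
  have xe i : x ord0 i ^+ 2 <= enorm x ^+ 2.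
    rewrite /enorm sqr_sqrtr /dotp; last by apply: sumr_ge0 => j _; exact: sqr_ge0.
    by rewrite (bigD1 i)//= -expr2 lerDl sumr_ge0// => j _; exact: sqr_ge0.
  have qe : q <= (1 + enorm x ^+ 2) ^+ d.
    rewrite -[d in _ ^+ d]card_ord -prodr_const; apply: ler_prod => i _.
    by rewrite addr_ge0 ?sqr_ge0//= lerD2l.
  apply: (le_trans qe); rewrite -muln2 mulnC exprM.
  have : 0 <= enorm x ^+ 2 by exact: sqr_ge0.
  (* (1 + u)^d <= 2^d (1 + u^d), because 1 + u is at most 2 or at most 2 u. *)
  move: (enorm x ^+ 2) => u u0; have [u1|u1] := lerP u 1.
    rewrite (@le_trans _ _ (2 ^+ d))//; first by rewrite lerXn2r ?nnegrE//; lra.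
    by rewrite ler_peMr// lerDl exprn_ge0.
  rewrite (@le_trans _ _ ((2 * u) ^+ d))//; first by rewrite lerXn2r ?nnegrE//; lra.
  by rewrite exprMn ler_wpM2l// lerDr.
have pi0 : 0 < pi ^+ d :> R by rewrite exprn_gt0 ?pi_gt0.
rewrite ler_pdivlMr ?mulr_gt0// mulrA [p * _]mulrC -!mulrA (mulrCA _ (pi ^+ d)) ler_wpM2l//.
  exact: ltW.
rewrite (le_trans (ler_wpM2l p0 q1))// mulrCA ler_wpM2l// mulrDr mulr1.
by rewrite lerD// mulrC.
Qed.

(** This allows the Fourier transform of an element of F^-1 D to be prescribed, in particular as a
    bump function. *)
Lemma invF_test_FT1 chi : D chi -> invF_test (invFourier chi) /\
  Fourier (invFourier chi) = chi.
Proof.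
move=> tc; have s1 : (1 : R) ^+ 2 = 1 by rewrite expr1n.
have sc : schwartz (invFourier chi) by rewrite invFourierE; exact: schwartz_FT.
have E : Fourier (invFourier chi) = chi.
  have [[c1 c2] _ _] := tc; have [M _ hM] := test_fun_bounded tc.
  rewrite FourierE invFourierE; apply/funext => x.
  apply: (Fourier_inversion (M := M)) => //; [exact: smooth_cts|exact: smooth_cts| |].
    exact: cintegrable_test_fun.
  by rewrite -invFourierE; exact: schwartz_integrable.
by split => //; split => //; rewrite E.
Qed.

Lemma invFourierK (phi : Rd -> C) : invF_test phi -> invFourier (Fourier phi) = phi.
Proof.
move=> [sphi tF]; rewrite FourierE invFourierE; apply/funext => x.
have [M hM] := schwartz_bounded sphi; have [[c1 c2] _] := sphi.
rewrite -{1}[1 in LHS]opprK.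
apply: (Fourier_inversion (M := M)) => //.
- by rewrite sqrrN expr1n.
- exact: smooth_cts.
- exact: smooth_cts.
- exact: schwartz_integrable.
- by rewrite -FourierE; exact: cintegrable_test_fun.
Qed.

Lemma Fourier_lin (a : C) (phi chi : Rd -> C) : invF_test phi -> invF_test chi ->
  Fourier (fun x => a * phi x + chi x) = (fun x => a * Fourier phi x + Fourier chi x).
Proof.
move=> [/schwartz_integrable i1 _] [/schwartz_integrable i2 _].
rewrite !FourierE; apply/funext => x; rewrite FTD//; last exact: cintegrableZ.
by rewrite FTZ.
Qed.

(** Proved on the Fourier side, where D is visibly closed under linear combinations; the Schwartz
    bounds are then supplied by [invF_test_FT1]. *)
Lemma invF_test_lin (a : C) (phi chi : Rd -> C) : invF_test phi -> invF_test chi ->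
  invF_test (fun x => a * phi x + chi x).
Proof.
move=> h1 h2; have t1 := h1.2; have t2 := h2.2.
have tl : D (fun x => a * Fourier phi x + Fourier chi x).
  by apply: test_funD => //; exact: test_funZ.
have [h _] := invF_test_FT1 tl; congr invF_test: h; apply/funext => x.
rewrite invFourierE FTD; [|exact/cintegrableZ/cintegrable_test_fun|exact: cintegrable_test_fun].
rewrite FTZ; last exact: cintegrable_test_fun.
by rewrite -!invFourierE !invFourierK.
Qed.

End fourier_test_fun.

(** * Weak* topology and functionals with a density *)

Section parameter_integral.
Context {R : realType} {d1 d2} {X : measurableType d1} {Y : measurableType d2}.
Variables (m1 : {sigma_finite_measure set X -> \bar R})
  (m2 : {sigma_finite_measure set Y -> \bar R}).

(** Integrability of F is not assumed: the positive and negative parts have measurable integrals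
    with values in [0, +oo], and extended subtraction and [fine] preserve measurability. *)
Lemma measurable_Rintegral_param (F : X * Y -> R) : measurable_fun setT F ->
  measurable_fun setT (fun x => \int[m2]_y F (x, y)).
Proof.
move=> mF; have mEF : measurable_fun setT (EFin \o F) by exact/measurable_EFinP.
have h1 : measurable_fun setT (fubini_F m2 (EFin \o F)^\+%E).
  by apply: measurable_fun_fubini_tonelli_F => //; exact: measurable_funepos.
have h2 : measurable_fun setT (fubini_F m2 (EFin \o F)^\-%E).
  by apply: measurable_fun_fubini_tonelli_F => //; exact: measurable_funeneg.
apply: (measurableT_comp (fine_measurable measurableT) _).
rewrite (_ : (fun x => _) = (fun x => fubini_F m2 (EFin \o F)^\+ x -
  fubini_F m2 (EFin \o F)^\- x)%E); first exact: emeasurable_funB h1 h2.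
apply/funext => x; rewrite [LHS]integralE /fubini_F; congr (_ - _)%E;
  apply: eq_integral => y _; rewrite ?funeposE ?funenegE//.
Qed.

Lemma cmeasurable_cintegral_param (F : X * Y -> R[i]) : cmeasurable_fun setT F ->
  cmeasurable_fun setT (fun x => cintegral m2 setT (fun y => F (x, y))).
Proof.
by move=> [mR mI]; split; [exact: (measurable_Rintegral_param mR)|
  exact: (measurable_Rintegral_param mI)].
Qed.

Lemma cmeasurable_section1 (F : X * Y -> R[i]) y : cmeasurable_fun setT F ->
  cmeasurable_fun setT (fun x => F (x, y)).
Proof.
move=> mF; apply: (@cmeasurable_comp _ _ _ _ _ setT setT F (fun x => (x, y))) => //.
Qed.

Lemma cmeasurable_section2 (F : X * Y -> R[i]) x : cmeasurable_fun setT F ->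
  cmeasurable_fun setT (fun y => F (x, y)).
Proof.
move=> mF; apply: (@cmeasurable_comp _ _ _ _ _ setT setT F (fun y => (x, y))) => //.
exact: measurable_pair1.
Qed.

(** By Tonelli, both statements say that the double integral of |F| is 0. *)
Lemma ae_eq0_swap (F : X * Y -> R[i]) : cmeasurable_fun setT F ->
  {ae m1, forall x, {ae m2, forall y, F (x, y) = 0}} ->
  {ae m2, forall y, {ae m1, forall x, F (x, y) = 0}}.
Proof.
move=> mF h; pose f z := (normc (F z))%:E.
have mf : measurable_fun setT f by apply/measurable_EFinP; exact: measurable_normc.
have f0 z : (0 <= f z)%E by rewrite lee_fin normc_ge0.
have mx x : measurable_fun setT (fun y => f (x, y)).
  by apply/measurable_EFinP; apply: measurable_normc => //; exact: cmeasurable_section2.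
have my y : measurable_fun setT (fun x => f (x, y)).
  by apply/measurable_EFinP; apply: measurable_normc => //; exact: cmeasurable_section1.
have E : (\int[m1]_x \int[m2]_y f (x, y) = 0)%E.
  rewrite (ae_eq_integral (cst 0%E)) ?integral_cst ?mul0e//.
  - exact: measurable_fun_fubini_tonelli_F.
  - apply: filterS h => x hx _.
    rewrite (ae_eq_integral (cst 0%E)) ?integral_cst ?mul0e//.
    by apply: filterS hx => y hy _; rewrite /f hy Normc.normc0.
have mG : measurable_fun setT (fun y => \int[m1]_x f (x, y))%E.
  exact: measurable_fun_fubini_tonelli_G.
have E2 : (\int[m2]_y `|\int[m1]_x f (x, y)| = 0)%E.
  rewrite -[RHS]E fubini_tonelli//; apply: eq_integral => y _.
  by rewrite gee0_abs// integral_ge0.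
have := (ae_eq_integral_abs m2 measurableT mG).1 E2.
apply: filterS => y /(_ I) hy.
have E3 : (\int[m1]_x `|f (x, y)| = 0)%E.
  by under eq_integral do rewrite gee0_abs//.
have := (ae_eq_integral_abs m1 measurableT (my y)).1 E3.
apply: filterS => x /(_ I) [] /eqP; rewrite normc_eq0 => /eqP; exact.
Qed.

End parameter_integral.

Section weak_star.
Import finmap.
Context {R : realType} {d : nat}.
Local Notation V := (invF_dual R d).

Lemma weak_star_openP (A : set V) (u : V) : open A -> A u ->
  exists s : seq (set V), [/\ forall B, B \in s -> weak_star_subbase B,
    forall B, B \in s -> B u & forall v, (forall B, B \in s -> B v) -> A v].
Proof.
move=> [F sF <-] [B FB Bu]; have [D' sD' E] := sF _ FB; exists (enum_fset D'); split.
- by move=> B' /sD'/set_mem.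
- by move: Bu; rewrite -E => Bu B' B'D; exact: Bu.
- move=> v hv; exists B => //.
  have h : (\bigcap_(i in [set` D']) (i : set V)) v by move=> B' B'D; exact: hv.
  exact: (eq_ind _ (fun S : set V => S v) h _ E).
Qed.

Lemma weak_star_subbase_open (B : set V) : weak_star_subbase B -> open B.
Proof.
move=> sB; exists [set B]; last by rewrite bigcup_set1.
move=> _ ->; exists ([fset B]%fset).
  by move=> B'; rewrite inE => /eqP ->; apply/mem_set.
apply/seteqP; split=> [x /(_ B)|x Bx B' /=].
  by apply; rewrite /= inE.
by rewrite inE => /eqP ->.
Qed.

(** A basic weak* neighbourhood involves only finitely many test functions, so continuity of each
    pairing is enough. *)
Lemma weak_star_continuous {X : topologicalType} (u : X -> V) (t : X) :
  (forall phi, invF_test phi -> forall e, 0 < e ->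
    \forall t' \near t, normc (u t' phi - u t phi) < e) ->
  forall A, open A -> A (u t) -> nbhs t (u @^-1` A).
Proof.
move=> cu A oA At; have [s [sb su sA]] := weak_star_openP oA At.
suff : nbhs t [set t' | forall B, B \in s -> B (u t')].
  by apply: filterS => t' h; exact: sA.
have hB B : B \in s -> nbhs t (u @^-1` B).
  move=> Bs; have [phi [z [e [tphi e0 BE]]]] := sb _ Bs.
  have := su _ Bs; rewrite BE => /= ut.
  have e'0 : 0 < e - normc (u t phi - z) by rewrite subr_gt0.
  apply: filterS (cu _ tphi _ e'0) => t' /= h.
  rewrite (_ : _ - z = (u t' phi - u t phi) + (u t phi - z)); last by rewrite addrA subrK.
  by rewrite (le_lt_trans (le_normcD _ _))// -ltrBrDr.
elim: s {sb su sA} hB => [|B s IH] hB; first by apply: filterS filterT => t' _ B.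
have h1 := hB B (mem_head _ _).
have h2 : nbhs t [set t' | forall B, B \in s -> B (u t')].
  by apply: IH => B' B's; apply: hB; rewrite inE B's orbT.
apply: filterS (filterI h1 h2) => t' [Bt' st'] B'.
by rewrite inE => /orP[/eqP ->//|/st'].
Qed.

(** Openness of A is expressed with [normc] discs, from which the subbase of the weak* topology is
    made. *)
Lemma open_evaluation (phi : 'rV[R]_d -> R[i]) (A : set R[i]) : invF_test phi ->
  (forall z, A z -> exists2 e, 0 < e & forall w, normc (w - z) < e -> A w) ->
  open [set u : V | A (u phi)].
Proof.
move=> tphi hA; rewrite (_ : [set u : V | A (u phi)] =
    \bigcup_(B in [set B : set V | open B /\ B `<=` [set u : V | A (u phi)]]) B).
  by apply: bigcup_open => B [].
apply/seteqP; split=> [u Au|u [B [_ sB] /sB]//].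
have [e e0 he] := hA _ Au.
exists [set v : V | normc (v phi - u phi) < e]; last by rewrite /= subrr Normc.normc0.
split; last by move=> v /he.
by apply: weak_star_subbase_open; exists phi, (u phi), e.
Qed.

(** Gives measurability of s |-> <f(s), phi>: the half-planes Re > a and Im > a pull back under
    evaluation to weak* open sets. *)
Lemma cmeasurable_evaluation {disp} {X : measurableType disp} (D : set X)
    (u : X -> V) phi : measurable D ->
  measurable_fun D (u : X -> g_sigma_algebraType (@open V)) ->
  invF_test phi -> cmeasurable_fun D (fun x => u x phi).
Proof.
move=> mD mu tphi.
have oE (A : set R[i]) : (forall z, A z -> exists2 e, 0 < e & forall w, normc (w - z) < e -> A w) ->
    measurable (D `&` [set x | A (u x phi)]).
  move=> hA; apply: (mu mD [set v : V | A (v phi)]).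
  by apply: sub_sigma_algebra; exact: open_evaluation.
have h (z w : R[i]) (e : R) : normc (w - z) < e -> `|Re w - Re z| < e /\ `|Im w - Im z| < e.
  move=> lt; split; apply: le_lt_trans lt.
    by rewrite -cReN -cReD; exact: normr_Re_le.
  by rewrite -cImN -cImD; exact: normr_Im_le.
split; apply: (measurability _ (RGenOInfty.measurableE R)) => //.
- move=> _ [_ [a ->] <-]; suff : measurable (D `&` [set x | a < Re (u x phi)]).
    by congr measurable; congr (_ `&` _); apply/seteqP; split=> x; rewrite /= in_itv/= andbT.
  apply: (oE [set z | a < Re z]) => z /= az.
  exists (Re z - a) => /=; first by rewrite subr_gt0.
  by move=> w /h[+ _]; rewrite ltr_distl => /andP[+ _]; apply: le_lt_trans; lra.
- move=> _ [_ [a ->] <-]; suff : measurable (D `&` [set x | a < Im (u x phi)]).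
    by congr measurable; congr (_ `&` _); apply/seteqP; split=> x; rewrite /= in_itv/= andbT.
  apply: (oE [set z | a < Im z]) => z /= az.
  exists (Im z - a) => /=; first by rewrite subr_gt0.
  by move=> w /h[_ +]; rewrite ltr_distl => /andP[+ _]; apply: le_lt_trans; lra.
Qed.

End weak_star.

Section locally_integrable.
Context {R : realType} {d : nat}.
Local Notation Rd := 'rV[R]_d.
Local Notation leb := (lebesgue_rV R d).
Local Notation C := R[i].
Local Notation D := (@test_fun R d setT).

Lemma measurable_eball r : measurable (eball r : set Rd).
Proof.
rewrite (_ : eball r = setT `&` (fun x : Rd => Num.sqrt (dotp x x)) @^-1` `]-oo, r[%classic).
  apply: (_ : measurable_fun setT (fun x : Rd => Num.sqrt (dotp x x))) => //.
  apply: measurableT_comp; last exact: measurable_dotp.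
  by apply: continuous_measurable_fun; exact: sqrt_continuous.
by apply/seteqP; split=> x; rewrite /eball/= /enorm in_itv/=; [|case].
Qed.

Lemma normr_coord_le (x : Rd) i : `|x ord0 i| <= enorm x.
Proof.
rewrite /enorm -sqrtr_sqr ler_wsqrtr// /dotp (bigD1 i)//= -expr2 lerDl.
by apply: sumr_ge0 => j _; exact: sqr_ge0.
Qed.

Lemma eball_sub_cbox r : eball r `<=` cbox (const_mx (- r)) (const_mx r : Rd).
Proof.
move=> x xr i; rewrite !mxE -ler_norml (le_trans (normr_coord_le x i))//.
exact: ltW.
Qed.

Lemma compact_sub_eball (K : set Rd) : compact K -> exists n : nat, K `<=` eball n%:R.
Proof.
move=> cK; have [n Kn] := compact_sub_cbox cK; exists (d * n).+1 => x /Kn xn.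
rewrite /eball/= (le_lt_trans (enorm_le x))//.
rewrite (@le_lt_trans _ _ (\sum_(i < d) n%:R))//.
  by apply: ler_sum => i _; have := xn i; rewrite !mxE ler_norml.
by rewrite sumr_const card_ord -mulrnA ltr_nat mulnC.
Qed.

Lemma eballS r r' : r <= r' -> eball r `<=` (eball r' : set Rd).
Proof. by move=> rr' x; rewrite /eball/= => h; exact: lt_le_trans rr'. Qed.

Lemma cintegrable_eball r v : clocally_integrable setT v -> cintegrable leb (eball r) v.
Proof.
move=> lv; apply: (@cintegrableS _ _ _ leb _ (cbox (const_mx (- r)) (const_mx r)) v).
- exact: measurable_eball.
- exact: measurable_cbox.
- exact: eball_sub_cbox.
- by apply: (clocally_integrableW lv) => //; exact: compact_cbox.
Qed.

Lemma clocally_integrableP (v : Rd -> C) : cmeasurable_fun setT v ->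
  (forall n : nat, (\int[leb]_(x in eball n%:R) (normc (v x))%:E < +oo)%E) ->
  clocally_integrable setT v.
Proof.
move=> mv hv; split=> [| |K cK _]; [exact: openT|exact: mv|].
have [n Kn] := compact_sub_eball cK; apply: le_lt_trans (hv n).
apply: ge0_subset_integral => //; first exact: compact_measurable_rV.
- exact: measurable_eball.
- by apply/measurable_EFinP/measurable_normc; [exact: measurable_eball|
    apply: cmeasurableS mv].
- by move=> x _; rewrite lee_fin normc_ge0.
Qed.

Lemma test_fun_eball chi : D chi -> exists n : nat,
  forall x, ~ eball n%:R x -> chi x = 0.
Proof.
move=> [_ cK _]; have [n Kn] := compact_sub_eball cK; exists n => x xn.
by apply: csupp_out => /Kn.
Qed.

Section functional.
Variable v : Rd -> C.
Hypothesis lv : clocally_integrable setT v.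

Definition pair_act (phi : Rd -> C) : C :=
  if pselect (invF_test phi) then
    cintegral leb setT (fun xi => v xi * conjc (Fourier phi xi)) else 0.

Lemma pair_actE phi : invF_test phi ->
  pair_act phi = cintegral leb setT (fun xi => v xi * conjc (Fourier phi xi)).
Proof. by rewrite /pair_act; case: pselect. Qed.

Lemma pair_act_out phi : ~ invF_test phi -> pair_act phi = 0.
Proof. by rewrite /pair_act; case: pselect. Qed.

Lemma pair_act_conjlinear (a : C) phi chi : invF_test phi -> invF_test chi ->
  pair_act (fun x => a * phi x + chi x) = conjc a * pair_act phi + pair_act chi.
Proof.
move=> h1 h2; have h3 := invF_test_lin a h1 h2.
rewrite !pair_actE// Fourier_lin//.
have i1 := cintegrable_pairing lv h1.2; have i2 := cintegrable_pairing lv h2.2.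
rewrite -cintegralZ// -cintegralD//; last exact: cintegrableZ.
apply: eq_cintegral => xi _; rewrite rmorphD rmorphM /= mulrDr; congr (_ + _).
exact: mulrCA.
Qed.

(** A locally integrable density is a distribution of order 0, whence N = 0 and A = 2 int_K |v|; the
    2 is that of [le_normc_cintegral_le]. *)
Lemma pair_act_cont (K : set Rd) : compact K ->
  exists (N : nat) (A : R), forall phi, invF_test phi ->
    csupp (Fourier phi) `<=` K -> forall M : R,
    (forall s xi, (size s <= N)%N -> normc (cpartials s (Fourier phi) xi) <= M) ->
    normc (pair_act phi) <= A * M.
Proof.
move=> cK; have mK := compact_measurable_rV cK.
have ivK := clocally_integrableW lv cK (@subsetT _ _).
have inK := cintegrable_normc mK ivK.
exists 0%N, (2 * \int[leb]_(x in K) normc (v x)) => phi tphi sK M hM.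
have hb xi : normc (Fourier phi xi) <= M.
  by have := hM [::] xi (leqnn _); rewrite cpartials0.
rewrite pair_actE// (@eq_cintegral_supp _ _ K); [|by []|]; last first.
  move=> xi xK; rewrite (csupp_out (chi := Fourier phi)) ?rmorph0 ?mulr0//.
  by move=> /sK.
have ih : leb.-integrable K (EFin \o (fun x => M * normc (v x))).
  exact: integrable_scaleR.
have -> : 2 * \int[leb]_(x in K) normc (v x) * M = 2 * \int[leb]_(x in K) (M * normc (v x)).
  by rewrite RintegralZl//; ring.
apply: le_normc_cintegral_le => //.
  apply: cmeasurableM; first exact: cintegrable_cmeasurable ivK.
  apply: cmeasurable_conj; apply: cmeasurableS (csmooth_cmeasurable _) => //.
  by case: tphi.2.
move=> x _; rewrite Normc.normcM normc_conj mulrC ler_wpM2r ?normc_ge0//.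
Qed.

Definition of_loc : invF_dual R d :=
  InvFDual pair_act_out pair_act_conjlinear pair_act_cont.

Lemma of_locE phi : invF_test phi ->
  of_loc phi = cintegral leb setT (fun xi => v xi * conjc (Fourier phi xi)).
Proof. exact: pair_actE. Qed.

Lemma realization_of_loc : realization setT of_loc v.
Proof.
split=> // chi tc; have [h1 h2] := invF_test_FT1 tc.
by rewrite of_locE// h2.
Qed.

End functional.

(** A realization is tested with inverse transforms of functions in D; inversion presents phi as one
    of them. *)
Lemma realizationE (u : invF_dual R d) v phi : realization setT u v -> invF_test phi ->
  u phi = cintegral leb setT (fun xi => v xi * conjc (Fourier phi xi)).
Proof. by move=> [_ hu] tphi; rewrite -{1}(invFourierK tphi); exact: hu tphi.2. Qed.

(** Functionals vanish off F^-1 D by [act_out], and the other fields are propositions. This yields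
    the Leibniz equality of functionals in the uniqueness claim. *)
Lemma invF_dual_ext (u u' : invF_dual R d) :
  (forall phi, invF_test phi -> u phi = u' phi) -> u = u'.
Proof.
move=> h; have E : act u = act u'.
  apply/funext => phi; have [/h//|n] := pselect (invF_test phi).
  by rewrite !act_out.
case: u u' E {h} => a1 p1 q1 r1 [a2 p2 q2 r2] /= E; subst a2.
by congr InvFDual; exact: Prop_irrelevance.
Qed.

End locally_integrable.

(** * Time-dependent locally integrable densities *)

(* [filterS] itself does not unify through the [{ae _, _}] notation here: the
   carrier of the measure has to be fixed first. *)
Lemma aeS {R : realType} {disp} {X : measurableType disp}
    (m : {measure set X -> \bar R}) (P Q : X -> Prop) :
  (forall x, P x -> Q x) -> {ae m, forall x, P x} -> {ae m, forall x, Q x}.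
Proof. exact: filterS. Qed.

Lemma aeS2 {R : realType} {disp} {X : measurableType disp}
    (m : {measure set X -> \bar R}) (P P' Q : X -> Prop) :
  (forall x, P x -> P' x -> Q x) ->
  {ae m, forall x, P x} -> {ae m, forall x, P' x} -> {ae m, forall x, Q x}.
Proof. exact: filterS2. Qed.

Section time_space.
Context {R : realType} {d : nat}.
Variable T : \bar R.
Local Notation tau := (measurableTypeR R).
Local Notation mu := (@lebesgue_measure R).
Local Notation Rd := 'rV[R]_d.
Local Notation leb := (lebesgue_rV R d).
Local Notation C := R[i].
Local Notation D := (@test_fun R d setT).
Implicit Types (g : R -> Rd -> C) (t s : R).

Lemma measurable_time : measurable (time_itv T : set tau).
Proof.
case: T => [r| |].
- rewrite (_ : time_itv _ = `]0, r[%classic); first exact: measurable_itv.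
  apply/seteqP; split=> t; rewrite /time_itv/= in_itv/= lte_fin; first by move=> [-> ->].
  by move=> /andP[].
- rewrite (_ : time_itv _ = `]0, +oo[%classic); first exact: measurable_itv.
  by apply/seteqP; split=> t; rewrite /time_itv/= in_itv/= andbT ltry; [move=> []|].
- by rewrite (_ : time_itv _ = set0)//; apply/seteqP; split=> t // [_]; rewrite ltNge leNye.
Qed.

Lemma time_le t s : time_itv T t -> 0 < s -> s <= t -> time_itv T s.
Proof. by move=> [t0 tT] s0 st; split => //; apply: le_lt_trans tT; rewrite lee_fin. Qed.

Lemma time_sub t : time_itv T t -> `]0, t[%classic `<=` time_itv T.
Proof. by move=> tT s /=; rewrite in_itv/= => /andP[s0 /ltW]; exact: time_le. Qed.

(** Rational times are cofinal in (0, T), so a property inherited by shorter intervals needs only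
    countably many null sets. *)
Lemma time_rat t : time_itv T t -> exists2 q : rat, time_itv T (ratr q) & t < ratr q.
Proof.
move=> [t0 tT]; have [r tr rT] : exists2 r : R, t < r & (r%:E <= T)%E.
  move: tT; case: T => [r| |]; rewrite ?lte_fin.
  - by move=> tr; exists r.
  - by move=> _; exists (t + 1); rewrite ?ltrDl ?leey.
  - by rewrite ltNge leNye.
have [q] := rat_in_itvoo tr; rewrite in_itv/= => /andP[tq qr]; exists q => //.
split; first exact: lt_trans tq.
by apply: lt_le_trans rT; rewrite lte_fin.
Qed.

(** The data are measurable on (0, T) x R^d only; extension by 0 in time makes them measurable on
    the whole product, where Fubini is stated. *)
Definition tcut g t : Rd -> C := if pselect (time_itv T t) then g t else fun=> 0.

Lemma tcutE g t : time_itv T t -> tcut g t = g t.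
Proof. by rewrite /tcut; case: pselect. Qed.

Definition jmeas g := cmeasurable_fun [set: tau * Rd] (fun p => g p.1 p.2).

Lemma jmeas_tcut g : cmeasurable_fun (time_itv T `*` setT) (fun p : tau * Rd => g p.1 p.2) ->
  jmeas (tcut g).
Proof.
have mD : measurable (time_itv T `*` setT : set (tau * Rd)).
  by apply: measurableX => //; exact: measurable_time.
move=> /(cmeasurable_patch _ mD); congr cmeasurable_fun; apply/funext => -[t xi].
rewrite /patch in_setX/= in_setT andbT /tcut; case: pselect => h.
  by rewrite mem_set.
by rewrite memNset.
Qed.

Lemma jmeasS g : jmeas g ->
  cmeasurable_fun (time_itv T `*` setT) (fun p : tau * Rd => g p.1 p.2).
Proof. exact: cmeasurableS. Qed.

Lemma jmeasD g h : jmeas g -> jmeas h -> jmeas (fun t xi => g t xi + h t xi).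
Proof. exact: cmeasurableD. Qed.

Lemma jmeasM g h : jmeas g -> jmeas h -> jmeas (fun t xi => g t xi * h t xi).
Proof. exact: cmeasurableM. Qed.

Lemma jmeas_space (v : Rd -> C) : cmeasurable_fun setT v -> jmeas (fun=> v).
Proof.
move=> mv; apply: (@cmeasurable_comp _ _ _ _ _ setT setT v (fun p : tau * Rd => p.2)) => //.
exact: measurable_snd.
Qed.

Lemma jmeas_t g t : jmeas g -> cmeasurable_fun setT (g t).
Proof. by move=> jg; exact: (cmeasurable_section2 t jg). Qed.

Lemma jmeas_xi g xi : jmeas g -> cmeasurable_fun [set: tau] (g ^~ xi).
Proof. by move=> jg; exact: (cmeasurable_section1 xi jg). Qed.

Lemma measurable_between {disp} {X : measurableType disp} (a b c : X -> R) :
  measurable_fun setT a -> measurable_fun setT b -> measurable_fun setT c ->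
  measurable [set x | a x < c x < b x].
Proof.
move=> ma mb mc; rewrite (_ : [set _ | _] =
    (setT `&` (fun x => c x - a x) @^-1` `]0, +oo[%classic) `&`
    (setT `&` (fun x => b x - c x) @^-1` `]0, +oo[%classic)).
  apply: measurableI.
  - by apply: (_ : measurable_fun setT (fun x => c x - a x)) => //; exact: measurable_funB.
  - by apply: (_ : measurable_fun setT (fun x => b x - c x)) => //; exact: measurable_funB.
apply/seteqP; split=> x; rewrite /= !in_itv/= !andbT !subr_gt0.
  by move=> /andP[].
by move=> [[_ ->] [_ ->]].
Qed.

(** The moving interval is absorbed into the indicator of a measurable set of pairs (x, s). *)
Lemma cmeasurable_itv_param {disp} {X : measurableType disp} (a b : X -> R)
    (F : X * tau -> C) :
  measurable_fun setT a -> measurable_fun setT b -> cmeasurable_fun setT F ->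
  cmeasurable_fun setT (fun x => cintegral mu `]a x, b x[ (fun s => F (x, s))).
Proof.
move=> ma mb mF; pose S := [set p : X * tau | a p.1 < p.2 < b p.1].
have mS : measurable S.
  apply: measurable_between; [exact: (measurableT_comp ma measurable_fst)|
    exact: (measurableT_comp mb measurable_fst)|exact: measurable_snd].
have mP : cmeasurable_fun setT (patch (fun=> 0) S F).
  by apply/(cmeasurable_patch _ mS); exact: cmeasurableS mF.
have := cmeasurable_cintegral_param mu mP; congr cmeasurable_fun; apply/funext => x.
rewrite [RHS]cintegral_mkcond; congr cintegral; apply/funext => s; rewrite /patch.
Qed.

Lemma jmeas_prim g : jmeas g ->
  jmeas (fun t xi => cintegral mu `]0, t[ (g ^~ xi)).
Proof.
move=> jg; apply: (@cmeasurable_itv_param _ (tau * Rd)%type (fun=> 0) fst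
  (fun p => g p.2 p.1.2)) => //.
apply: (@cmeasurable_comp _ _ _ _ _ setT setT (fun p : tau * Rd => g p.1 p.2)
  (fun p : (tau * Rd) * tau => (p.2, p.1.2))) => //.
by apply: measurable_fun_pair; [exact: measurable_snd|
  exact: (measurableT_comp measurable_snd measurable_fst)].
Qed.

(** The condition of X_{1,1}(1) read on the density, with integer radii so that only countably many
    balls occur. *)
Definition locint g := jmeas g /\ forall t (n : nat), time_itv T t ->
  (\int[mu]_(s in `]0%R, t[) \int[leb]_(xi in eball n%:R) (normc (g s xi))%:E < +oo)%E.

Section locint_theory.
Variable g : R -> Rd -> C.
Hypothesis lg : locint g.

(** Truncation to (0, t) x B_n, on which g is integrable for the product measure and Fubini
    applies. *)
Let P t (n : nat) : tau * Rd -> C :=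
  patch (fun=> 0) (`]0, t[%classic `*` eball n%:R) (fun p => g p.1 p.2).

Let PE t n s xi : P t n (s, xi) =
  if (0 < s < t) && (xi \in eball n%:R) then g s xi else 0.
Proof.
rewrite /P /patch in_setX/=; congr (if _ && _ then _ else _).
by apply/idP/idP => [/set_mem|h]; [rewrite /= in_itv|apply/mem_set; rewrite /= in_itv].
Qed.

Let mP t n : cmeasurable_fun setT (P t n).
Proof.
have mS : measurable (`]0, t[%classic `*` eball n%:R : set (tau * Rd)).
  by apply: measurableX; [exact: measurable_itv|exact: measurable_eball].
by apply/(cmeasurable_patch _ mS); apply: cmeasurableS lg.1.
Qed.

Let iP t n : time_itv T t -> cintegrable (mu \x leb)%E setT (P t n).
Proof.
move=> tT; apply: cintegrable_prod; first exact: mP.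
apply: le_lt_trans (lg.2 t n tT); rewrite [leRHS]integral_mkcond.
rewrite le_eqVlt; apply/orP; left; apply/eqP; apply: eq_integral => s _.
rewrite /patch; case: ifPn => [/set_mem|/negP sI].
  rewrite /= in_itv/= => s0; rewrite [RHS]integral_mkcond.
  by apply: eq_integral => xi _; rewrite PE s0/= /patch; case: ifP => //; rewrite Normc.normc0.
rewrite integral0_eq// => xi _; rewrite PE; case: ifP; last by rewrite Normc.normc0.
by move=> /andP[h _]; exfalso; apply: sI; apply/mem_set; rewrite /= in_itv.
Qed.

(** The null set of frequencies is common to all t: it is the union of those for rational times and
    integer radii. *)
Lemma locint_ae_xi : {ae leb, forall xi, forall t, time_itv T t ->
  cintegrable mu `]0, t[ (g ^~ xi)}.
Proof.
have h (qn : rat * nat) : {ae leb, forall xi, time_itv T (ratr qn.1) ->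
    eball qn.2%:R xi -> cintegrable mu `]0, ratr qn.1[ (g ^~ xi)}.
  have [tq|tq] := pselect (time_itv T (ratr qn.1)); last exact: aeW.
  apply: filterS (ae_cintegrable2 (iP qn.2 tq)) => xi h _ xin.
  apply/(cintegrable_mkcond mu _ (measurable_itv _)); move: h.
  congr cintegrable; apply/funext => s; rewrite PE (mem_set xin) andbT /patch.
  by congr (if _ then _ else _); apply/idP/idP => [h|/set_mem]; [apply/mem_set; rewrite /= in_itv|rewrite /= in_itv].
apply: filterS (ae_countable h) => xi hxi t tT.
have [q tq /ltW lq] := time_rat tT.
have xin : eball (Num.truncn (enorm xi)).+1%:R xi by exact: truncnS_gt.
apply: cintegrableS (hxi (q, _) tq xin) => //.
by apply: itvoo_sub.
Qed.

Lemma locint_ae_t : {ae mu, forall t, time_itv T t -> clocally_integrable setT (g t)}.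
Proof.
have h (qn : rat * nat) : {ae mu, forall t, time_itv T (ratr qn.1) ->
    0 < t < ratr qn.1 -> cintegrable leb (eball qn.2%:R) (g t)}.
  have [tq|tq] := pselect (time_itv T (ratr qn.1)); last exact: aeW.
  apply: filterS (ae_cintegrable1 (iP qn.2 tq)) => t h _ tin.
  apply/(cintegrable_mkcond leb _ (measurable_eball _)); move: h.
  by congr cintegrable; apply/funext => xi; rewrite PE tin.
apply: filterS (ae_countable h) => t ht tT; have [q tq lq] := time_rat tT.
apply: clocally_integrableP; first exact: jmeas_t lg.1.
move=> n; have /(_ tq) := ht (q, n); rewrite tT.1 lq => /(_ isT).
by move=> /(cintegrableP leb _ (measurable_eball _))[].
Qed.

Let v t xi := cintegral mu `]0, t[ (g ^~ xi).

Let intP t n xi : cintegral mu setT (fun s => P t n (s, xi)) = patch (fun=> 0) (eball n%:R) (v t) xi.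
Proof.
rewrite /v /patch; case: ifPn => xin.
  rewrite [RHS]cintegral_mkcond; congr cintegral; apply/funext => s.
  rewrite PE xin andbT /patch; congr (if _ then _ else _).
  by apply/idP/idP => [h|/set_mem]; [apply/mem_set; rewrite /= in_itv|rewrite /= in_itv].
rewrite (_ : (fun s => _) = fun=> 0); last by apply/funext => s; rewrite PE (negbTE xin) andbF.
by rewrite /cintegral /Rintegral !integral0.
Qed.

Lemma locint_prim t : time_itv T t -> clocally_integrable setT (v t).
Proof.
move=> tT; apply: clocally_integrableP; first exact: (jmeas_t t (jmeas_prim lg.1)).
move=> n; suff /(cintegrableP leb _ (measurable_eball _))[] : cintegrable leb (eball n%:R) (v t) by [].
apply/(cintegrable_mkcond leb _ (measurable_eball _)).
by have := cintegrable_section2 (iP n tT); congr cintegrable; apply/funext => xi; exact: intP.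
Qed.

(** Fubini on a truncation: [chi] is bounded and vanishes outside some B_n, so the integrand is
    dominated by a multiple of the truncated |g|. *)
Lemma locint_pairing t chi : time_itv T t -> D chi ->
  cintegrable mu `]0, t[ (fun s => cintegral leb setT (fun xi => g s xi * conjc (chi xi))) /\
  cintegral mu `]0, t[ (fun s => cintegral leb setT (fun xi => g s xi * conjc (chi xi))) =
  cintegral leb setT (fun xi => v t xi * conjc (chi xi)).
Proof.
move=> tT tc; have [n chin] := test_fun_eball tc; have [M M0 hM] := test_fun_bounded tc.
pose F (p : tau * Rd) := P t n p * conjc (chi p.2).
have mchi : cmeasurable_fun setT chi by case: tc => sc _ _; exact: csmooth_cmeasurable.
have mF : cmeasurable_fun setT F.
  apply: cmeasurableM; first exact: mP.
  exact/cmeasurable_conj/jmeas_space.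
have iF : cintegrable (mu \x leb)%E setT F.
  have inP := integrable_scaleR measurableT M (cintegrable_normc measurableT (iP n tT)).
  apply: (cintegrable_le _ mF inP) => // -[s xi] _ /=.
  by rewrite Normc.normcM normc_conj mulrC ler_wpM2r ?normc_ge0.
have E1 : (fun s => cintegral leb setT (fun xi => F (s, xi))) = patch (fun=> 0) `]0, t[%classic
    (fun s => cintegral leb setT (fun xi => g s xi * conjc (chi xi))).
  apply/funext => s; rewrite /patch; case: ifPn => [/set_mem|/negP sI].
    rewrite /= in_itv/= => s0; apply: eq_cintegral => xi _; rewrite /F PE s0/=.
    case: ifPn => // /negP xin; rewrite chin ?rmorph0 ?mulr0//.
    by move=> h; apply: xin; exact: mem_set.
  rewrite (_ : (fun xi => _) = fun=> 0); last first.
    apply/funext => xi; rewrite /F PE; case: ifP; last by rewrite mul0r.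
    by move=> /andP[h _]; exfalso; apply: sI; apply/mem_set; rewrite /= in_itv.
  by rewrite /cintegral /Rintegral !integral0.
split.
  apply/(cintegrable_mkcond mu _ (measurable_itv _)).
  by rewrite -E1; exact: cintegrable_section1 iF.
rewrite [LHS]cintegral_mkcond -E1 (cFubini iF).
apply: ae_eq_cintegral => //.
- exact: cintegrable_cmeasurable (cintegrable_section2 iF).
- apply: cmeasurableM; last exact: cmeasurable_conj.
  exact: (jmeas_t t (jmeas_prim lg.1)).
apply: filterS (ae_cintegrable2 (iP n tT)) => xi ix _.
rewrite /F/=; under eq_cintegral do rewrite mulrC.
rewrite cintegralZ// intP mulrC /patch; case: ifPn => // /negP xin.
by rewrite chin ?rmorph0 ?mulr0// => h; apply: xin; exact: mem_set.
Qed.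

End locint_theory.

Lemma eq_locint g h : jmeas h ->
  {ae mu, forall t, time_itv T t -> {ae leb, forall xi, g t xi = h t xi}} ->
  locint g -> locint h.
Proof.
move=> jh gh [jg lg]; split=> // t n tT; apply: le_lt_trans (lg t n tT).
have mN (k : R -> Rd -> C) : jmeas k -> measurable_fun [set: tau * Rd]
    (fun p => (normc (k p.1 p.2))%:E).
  by move=> jk; apply/measurable_EFinP; exact: measurable_normc.
have mI (k : R -> Rd -> C) : jmeas k ->
    measurable_fun `]0, t[ (fun s : tau => \int[leb]_(xi in eball n%:R) (normc (k s xi))%:E)%E.
  move=> jk; apply: measurable_funTS.
  have := @measurable_fun_fubini_tonelli_F _ _ tau Rd R leb
    (fun p => (normc (k p.1 p.2) * \1_(eball n%:R) p.2)%:E).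
  rewrite /fubini_F => h1; rewrite [X in measurable_fun _ X](_ : _ =
      (fun s : tau => \int[leb]_xi (normc (k s xi) * \1_(eball n%:R) xi)%:E)%E).
    apply: h1; last by move=> p; rewrite lee_fin mulr_ge0 ?normc_ge0.
    apply/measurable_EFinP; apply: measurable_funM; first exact: measurable_normc.
    have mi : measurable_fun setT (\1_(eball n%:R) : Rd -> R).
      by apply: measurable_indic; exact: measurable_eball.
    exact: (measurableT_comp mi measurable_snd).
  apply/funext => s; rewrite integral_mkcond; apply: eq_integral => xi _.
  by rewrite /patch indicE; case: (xi \in _); rewrite ?mulr1 ?mulr0.
rewrite le_eqVlt; apply/orP; left; apply/eqP.
apply: ae_eq_integral => //; [exact: mI|exact: mI|].
apply: aeS gh => s gs sI; have := gs (time_sub tT sI).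
move=> gxi; apply: ae_eq_integral => //; first exact: measurable_eball.
- apply: measurable_funTS; apply/measurable_EFinP; exact: measurable_normc (jmeas_t s jh).
- apply: measurable_funTS; apply/measurable_EFinP; exact: measurable_normc (jmeas_t s jg).
- by apply: filterS gxi => xi -> _.
Qed.

Lemma mixed_norm11 t r g : mixed_norm 1 1 t r g =
  (\int[mu]_(s in `]0%R, t[) \int[leb]_(xi in eball r) (normc (g s xi))%:E)%E.
Proof.
rewrite /mixed_norm Lnorm1 [RHS]integral_mkcond; apply: eq_integral => s _.
rewrite /patch; case: ifP => _; last by rewrite abse0.
rewrite Lnorm1 gee0_abs; last by apply: integral_ge0 => xi _; exact: abse_ge0.
rewrite [RHS](integral_mkcond (eball r)).
apply: eq_integral => xi _; rewrite /patch; case: ifP => _; last by rewrite abse0.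
by rewrite gee0_abs// lee_fin normc_ge0.
Qed.

(** For m = 1 the closed support of m is the whole space, which forces U to be everything. *)
Lemma mul_Fourier_realization (u : R -> invF_dual R d) g :
  mul_Fourier T (fun _ _ => 1) u g ->
  {ae mu, forall t, time_itv T t -> realization setT (u t) (g t)}.
Proof.
move=> [_]; apply: aeS => t h tT; have [U [v [UT rv ->]]] := h tT.
have -> : zero_ext U (fun xi => 1%:C%C * v xi) = v.
  apply/funext => xi; rewrite /zero_ext /patch mem_set ?mul1r//; apply: UT.
  by apply: subset_closure; rewrite /= oner_eq0.
rewrite (_ : setT = U)//; apply/seteqP; split=> // xi _; apply: UT.
by apply: subset_closure; rewrite /= oner_eq0.
Qed.

(** The version g' with finite norms may differ from the given g; both realize F[u(t)], so they
    agree at almost every time for almost every frequency. *)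
Lemma Xspace11_locint (u : R -> invF_dual R d) g :
  Xspace T 1%E 1%E (fun _ _ => 1) u -> mul_Fourier T (fun _ _ => 1) u g ->
  locint (tcut g).
Proof.
move=> [_ [g' [mg' ng']]] mg.
have r1 := mul_Fourier_realization mg; have r2 := mul_Fourier_realization mg'.
have l' : locint (tcut g').
  split; first exact: jmeas_tcut mg'.1.
  move=> t n tT.
  have [->|n0] := posnP n.
    rewrite (eq_integral (cst 0%E)) ?integral0// => s _.
    rewrite (_ : eball _ = set0) ?integral_set0//.
    by apply/seteqP; split=> // x; rewrite /eball/= ltNge sqrtr_ge0.
  apply: le_lt_trans (ng' t n%:R tT _); last by rewrite ltr0n.
  rewrite mixed_norm11 le_eqVlt; apply/orP; left; apply/eqP; apply: eq_integral => s.
  by move=> /set_mem/(time_sub tT) sT; rewrite tcutE.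
apply: eq_locint l'; first exact: jmeas_tcut mg.1.
apply: aeS2 r1 r2 => t h1 h2 tT; rewrite !tcutE//.
have := realization_unique (@subset_refl _ _) (h2 tT) (h1 tT).
by apply: filterS => xi; apply.
Qed.

End time_space.

(** * The solution on the Fourier side *)

Section restricted_tonelli.
Context {R : realType} {d1 d2} {X : measurableType d1} {Y : measurableType d2}.
Variables (m1 : {sigma_finite_measure set X -> \bar R})
  (m2 : {sigma_finite_measure set Y -> \bar R}).
Variables (A : set X) (B : set Y) (F : X * Y -> \bar R).
Hypotheses (mA : measurable A) (mB : measurable B) (mF : measurable_fun setT F)
  (F0 : forall z, (0 <= F z)%E).
Local Open Scope ereal_scope.

Let G := F \_ (A `*` B).

Let mG : measurable_fun setT G.
Proof.
apply/(measurable_restrictT _ _).1; first exact: measurableX.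
exact: measurable_funTS.
Qed.

Let G0 z : 0 <= G z.
Proof. by rewrite /G /patch; case: ifP. Qed.

Lemma measurable_integral_snd : measurable_fun A (fun x => \int[m2]_(y in B) F (x, y)).
Proof.
apply/(measurable_restrictT _ mA).2.
have := @measurable_fun_fubini_tonelli_F _ _ _ _ _ m2 _ mG G0; congr measurable_fun.
apply/funext => x; rewrite /fubini_F /patch; case: ifPn => xA.
  rewrite [RHS]integral_mkcond; apply: eq_integral => y _.
  by rewrite /G /patch in_setX/= xA.
by apply: integral0_eq => y _; rewrite /G /patch in_setX/= (negbTE xA).
Qed.

Lemma measurable_integral_fst : measurable_fun B (fun y => \int[m1]_(x in A) F (x, y)).
Proof.
apply/(measurable_restrictT _ mB).2.
have := @measurable_fun_fubini_tonelli_G _ _ _ _ _ m1 _ mG G0; congr measurable_fun.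
apply/funext => y; rewrite /fubini_G /patch; case: ifPn => yB.
  rewrite [RHS]integral_mkcond; apply: eq_integral => x _.
  by rewrite /G /patch in_setX/= yB andbT.
by apply: integral0_eq => x _; rewrite /G /patch in_setX/= (negbTE yB) andbF.
Qed.

Lemma tonelli_restrict : \int[m1]_(x in A) \int[m2]_(y in B) F (x, y) =
  \int[m2]_(y in B) \int[m1]_(x in A) F (x, y).
Proof.
rewrite integral_mkcond [RHS]integral_mkcond; transitivity (\int[m1]_x \int[m2]_y G (x, y)).
  apply: eq_integral => x _; rewrite /patch; case: ifPn => xA.
    rewrite integral_mkcond; apply: eq_integral => y _.
    by rewrite /G /patch in_setX/= xA.
  by apply/esym/integral0_eq => y _; rewrite /G /patch in_setX/= (negbTE xA).
rewrite fubini_tonelli//; apply: eq_integral => y _; rewrite /patch; case: ifPn => yB.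
  rewrite [RHS]integral_mkcond; apply: eq_integral => x _.
  by rewrite /G /patch in_setX/= yB andbT.
by apply: integral0_eq => x _; rewrite /G /patch in_setX/= (negbTE yB) andbF.
Qed.

End restricted_tonelli.

Lemma emeasurable_itv_param {R : realType} {disp} {X : measurableType disp}
    (a b : X -> R) (F : X * measurableTypeR R -> \bar R) :
  measurable_fun setT a -> measurable_fun setT b -> measurable_fun setT F ->
  (forall z, 0 <= F z)%E ->
  measurable_fun setT (fun x => \int[lebesgue_measure]_(s in `]a x, b x[) F (x, s))%E.
Proof.
move=> ma mb mF F0; pose S := [set p : X * measurableTypeR R | a p.1 < p.2 < b p.1].
have mS : measurable S.
  apply: measurable_between; [exact: (measurableT_comp ma measurable_fst)|
    exact: (measurableT_comp mb measurable_fst)|exact: measurable_snd].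
have mG : measurable_fun setT (F \_ S).
  exact: (@measurable_restrictT _ _ _ _ S F mS).1 (measurable_funTS mF).
have G0 z : (0 <= (F \_ S) z)%E by rewrite /patch; case: ifP.
have := @measurable_fun_fubini_tonelli_F _ _ _ _ _ (@lebesgue_measure R) _ mG G0.
congr measurable_fun; apply/funext => x; rewrite /fubini_F [RHS]integral_mkcond.
by apply: eq_integral => s _; rewrite /patch; congr (if _ then _ else _).
Qed.

Section locally_integrable_closure.
Context {R : realType} {d : nat}.
Local Notation Rd := 'rV[R]_d.
Local Notation leb := (lebesgue_rV R d).
Implicit Types v w : Rd -> R[i].

Lemma clocally_integrableD v w : clocally_integrable setT v ->
  clocally_integrable setT w -> clocally_integrable setT (fun x => v x + w x).
Proof.
move=> lv lw; have [_ mv _] := lv; have [_ mw _] := lw.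
split=> [| |K cK KT]; [exact: openT|exact: cmeasurableD|].
have mK := compact_measurable_rV cK.
have := cintegrableD mK (clocally_integrableW lv cK KT) (clocally_integrableW lw cK KT).
by move=> /(cintegrableP leb _ mK)[].
Qed.

Lemma clocally_integrableZ (c : R[i]) v : clocally_integrable setT v ->
  clocally_integrable setT (fun x => c * v x).
Proof.
move=> lv; have [_ mv _] := lv.
split=> [| |K cK KT]; [exact: openT|exact: cmeasurableM (cmeasurable_cst _ _) mv|].
have mK := compact_measurable_rV cK.
have := cintegrableZ c mK (clocally_integrableW lv cK KT).
by move=> /(cintegrableP leb _ mK)[].
Qed.

Lemma ae_eq_clocally_integrable v w : cmeasurable_fun setT w ->
  {ae leb, forall x, v x = w x} -> clocally_integrable setT v ->
  clocally_integrable setT w.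
Proof.
move=> mw vw lv; split=> [| |K cK KT]; [exact: openT|exact: mw|].
have mK := compact_measurable_rV cK.
have : cintegrable leb K w.
  apply: (ae_eq_cintegrable mK _ _ (clocally_integrableW lv cK KT)).
    exact: cmeasurableS mw.
  by apply: aeS vw.
by move=> /(cintegrableP leb _ mK)[].
Qed.

End locally_integrable_closure.

Section fourier_side_solution.
Context {R : realType} {d : nat}.
Variable T : \bar R.
Local Notation tau := (measurableTypeR R).
Local Notation mu := (@lebesgue_measure R).
Local Notation Rd := 'rV[R]_d.
Local Notation leb := (lebesgue_rV R d).
Local Notation C := R[i].
Variables (psi fh : R -> Rd -> C) (u0h : Rd -> C).
Hypothesis jpsi : jmeas psi.
Hypothesis lf : locint T fh.
Hypothesis l0 : clocally_integrable setT u0h.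
Hypothesis hpsi : forall t, time_itv T t -> {ae leb, forall xi,
  (\int[mu]_(r in `]0%R, t[) (normc (psi r xi))%:E < +oo)%E}.

(** The frequencies at which the scalar equation makes sense on all (0, t) at once. *)
Definition good xi := forall t, time_itv T t ->
  cintegrable mu `]0, t[ (psi ^~ xi) /\ cintegrable mu `]0, t[ (fh ^~ xi).

Lemma ae_good : {ae leb, forall xi, good xi}.
Proof.
have h (q : rat) : {ae leb, forall xi, time_itv T (ratr q) ->
    (\int[mu]_(r in `]0%R, ratr q[) (normc (psi r xi))%:E < +oo)%E}.
  have [tq|tq] := pselect (time_itv T (ratr q)); last exact: aeW.
  by apply: aeS (hpsi tq).
apply: aeS2 (ae_countable h) (locint_ae_xi lf) => xi h1 h2 t tT; split; last exact: h2.
have [q tq /ltW lq] := time_rat tT.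
have iq : cintegrable mu `]0, ratr q[ (psi ^~ xi).
  apply/(cintegrableP mu _ (measurable_itv _)); split; last exact: h1.
  by apply: cmeasurableS (jmeas_xi xi jpsi).
apply: cintegrableS iq => //; exact: itvoo_sub.
Qed.

Definition sol t xi := duhamel (psi ^~ xi) (fh ^~ xi) (u0h xi) t.

Lemma jmeas_cexp g : jmeas g -> jmeas (fun t (xi : Rd) => cexp (g t xi)).
Proof. exact: cmeasurable_cexp. Qed.

Lemma jmeas_sol : jmeas sol.
Proof.
apply: jmeasM; first exact/jmeas_cexp/jmeas_prim.
apply: jmeasD; first by apply: jmeas_space; case: l0.
apply: jmeas_prim; apply: jmeasM; last exact: lf.1.
apply: jmeas_cexp; apply: cmeasurableN; exact: jmeas_prim.
Qed.

Lemma sol_eq xi t : good xi -> time_itv T t ->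
  cintegrable mu `]0, t[ (fun s => psi s xi * sol s xi) /\
  sol t xi = u0h xi + cintegral mu `]0, t[ (fun s => psi s xi * sol s xi) +
    cintegral mu `]0, t[ (fh ^~ xi).
Proof.
move=> gxi tT; have [ip jf] := gxi t tT; have t0 : 0 <= t by exact: ltW tT.1.
have /cprimP[i1 /(_ t)] := cprim_duhamel t0 (u0h xi) ip jf.
rewrite duhamel0 t0 lexx => /(_ isT) E.
have i2 : cintegrable mu `]0, t[ (fun s => psi s xi * sol s xi).
  have mI : measurable (`]0, t[%classic : set tau) by exact: measurable_itv.
  have := cintegrableD mI i1 (cintegrableN mI jf).
  by congr cintegrable; apply/funext => s; rewrite addrK.
split=> //; rewrite -addrA -cintegralD//; exact: measurable_itv.
Qed.

Lemma sol_exp xi t : good xi -> time_itv T t ->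
  sol t xi = exp_int psi 0 t xi * u0h xi +
    cintegral mu `]0, t[ (fun s => exp_int psi s t xi * fh s xi).
Proof.
move=> gxi tT; have [ip jf] := gxi t tT; have t0 : 0 <= t by exact: ltW tT.1.
by apply: (duhamelE t0); rewrite // t0 lexx.
Qed.

Lemma normc_exp_int s t xi : normc (exp_int psi s t xi) = exp_Re_int psi s t xi.
Proof. exact: normc_cexp. Qed.

Lemma integrable_exp_fh xi t : good xi -> time_itv T t ->
  mu.-integrable `]0, t[ (EFin \o (fun s => exp_Re_int psi s t xi * normc (fh s xi))).
Proof.
move=> gxi tT; have [ip jf] := gxi t tT; have t0 : 0 <= t by exact: ltW tT.1.
have tt : 0 <= t <= t by rewrite t0 lexx.
have mI : measurable (`]0, t[%classic : set tau) by exact: measurable_itv.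
have := cintegrable_normc mI (cintegrable_duhamel t0 ip jf tt).
congr (_.-integrable _ (EFin \o _)); apply/funext => s.
by rewrite Normc.normcM normc_cexp.
Qed.

Lemma le_normc_sol xi t : good xi -> time_itv T t ->
  normc (sol t xi) <= exp_Re_int psi 0 t xi * normc (u0h xi) +
    2 * \int[mu]_(s in `]0, t[) (exp_Re_int psi s t xi * normc (fh s xi)).
Proof.
move=> gxi tT; rewrite sol_exp// (le_trans (le_normcD _ _))// lerD//.
  by rewrite Normc.normcM normc_exp_int.
have [ip jf] := gxi t tT; have t0 : 0 <= t by exact: ltW tT.1.
have tt : 0 <= t <= t by rewrite t0 lexx.
have i1 := cintegrable_duhamel t0 ip jf tt.
apply: le_normc_cintegral_le => //; first exact: cintegrable_cmeasurable i1.
  exact: integrable_exp_fh.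
by move=> s _; rewrite Normc.normcM normc_exp_int.
Qed.

Lemma cmeasurable_exp_int {disp} {X : measurableType disp} (a b : X -> R) (c : X -> Rd) :
  measurable_fun setT a -> measurable_fun setT b -> measurable_fun setT c ->
  cmeasurable_fun setT (fun x => exp_int psi (a x) (b x) (c x)).
Proof.
move=> ma mb mc; have mP : cmeasurable_fun setT (fun p : X * tau => psi p.2 (c p.1)).
  apply: (@cmeasurable_comp _ _ _ _ _ setT setT (fun p : tau * Rd => psi p.1 p.2)
    (fun p : X * tau => (p.2, c p.1))) => //.
  by apply: measurable_fun_pair; [exact: measurable_snd|
    exact: (measurableT_comp mc measurable_fst)].
exact/cmeasurable_cexp/(cmeasurable_itv_param ma mb mP).
Qed.

Lemma measurable_exp_Re_int {disp} {X : measurableType disp} (a b : X -> R) (c : X -> Rd) :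
  measurable_fun setT a -> measurable_fun setT b -> measurable_fun setT c ->
  measurable_fun setT (fun x => exp_Re_int psi (a x) (b x) (c x)).
Proof.
move=> ma mb mc; have := measurable_normc measurableT (cmeasurable_exp_int ma mb mc).
by congr measurable_fun; apply/funext => x; exact: normc_exp_int.
Qed.

Lemma cmeasurable_duhamel t : cmeasurable_fun setT
  (fun xi => cintegral mu `]0, t[ (fun s => exp_int psi s t xi * fh s xi)).
Proof.
apply: (@cmeasurable_itv_param _ _ _ (fun=> 0) (fun=> t)
  (fun p : Rd * tau => exp_int psi p.2 t p.1 * fh p.2 p.1)) => //.
apply: cmeasurableM.
  by apply: cmeasurable_exp_int; [exact: measurable_snd|exact: measurable_cst|exact: measurable_fst].
apply: (@cmeasurable_comp _ _ _ _ _ setT setT (fun p : tau * Rd => fh p.1 p.2)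
  (fun p : Rd * tau => (p.2, p.1))) => //; first exact: lf.1.
by apply: measurable_fun_pair; [exact: measurable_snd|exact: measurable_fst].
Qed.

Local Open Scope ereal_scope.

Let a (p : tau * Rd) := (normc (psi p.1 p.2) * exp_Re_int psi 0 p.1 p.2 * normc (u0h p.2))%:E.
Let b0 (p : tau * Rd) := \int[mu]_(s in `]0%R, p.1[)
  (exp_Re_int psi s p.1 p.2 * normc (fh s p.2))%:E.
Let b (p : tau * Rd) := (normc (psi p.1 p.2))%:E * b0 p.

Hypothesis hint : forall t (n : nat), time_itv T t ->
  \int[leb]_(xi in eball n%:R) \int[mu]_(rho in `]0%R, t[) a (rho, xi)
  + \int[leb]_(xi in eball n%:R) \int[mu]_(rho in `]0%R, t[) b (rho, xi) < +oo.

Let mnpsi : measurable_fun [set: tau * Rd] (fun p => normc (psi p.1 p.2)).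
Proof. exact: measurable_normc. Qed.

Let ma : measurable_fun setT a.
Proof.
apply/measurable_EFinP; apply: measurable_funM; last first.
  by apply: measurable_normc => //; apply: jmeas_space; case: l0.
apply: measurable_funM; first exact: mnpsi.
apply: measurable_exp_Re_int; [exact: measurable_cst|exact: measurable_fst|exact: measurable_snd].
Qed.

Let mb0 : measurable_fun setT b0.
Proof.
pose F (p : (tau * Rd) * tau) := (exp_Re_int psi p.2 p.1.1 p.1.2 * normc (fh p.2 p.1.2))%:E.
have mF : measurable_fun setT F.
  apply/measurable_EFinP; apply: measurable_funM.
    apply: measurable_exp_Re_int; first exact: measurable_snd.
      exact: (measurableT_comp measurable_fst measurable_fst).
    exact: (measurableT_comp measurable_snd measurable_fst).
  apply: measurable_normc => //.
  apply: (@cmeasurable_comp _ _ _ _ _ setT setT (fun p : tau * Rd => fh p.1 p.2)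
    (fun p : (tau * Rd) * tau => (p.2, p.1.2))) => //; first exact: lf.1.
  by apply: measurable_fun_pair; [exact: measurable_snd|
    exact: (measurableT_comp measurable_snd measurable_fst)].
apply: (@emeasurable_itv_param _ _ _ (fun=> 0%R) fst F) => //.
by move=> p; rewrite lee_fin mulr_ge0 ?expR_ge0 ?normc_ge0.
Qed.

Let mb : measurable_fun setT b.
Proof.
have mN : measurable_fun [set: tau * Rd] (fun p => (normc (psi p.1 p.2))%:E).
  exact/measurable_EFinP.
exact: emeasurable_funM mN mb0.
Qed.

Let a0 p : 0 <= a p.
Proof. by rewrite lee_fin !mulr_ge0 ?normc_ge0 ?expR_ge0. Qed.

Let b00 p : 0 <= b0 p.
Proof. by apply: integral_ge0 => s _; rewrite lee_fin mulr_ge0 ?normc_ge0 ?expR_ge0. Qed.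

Let bb0 p : 0 <= b p.
Proof. by apply: mule_ge0 => //; rewrite lee_fin normc_ge0. Qed.

Lemma jmeas_psi_sol : jmeas (fun t xi => (psi t xi * sol t xi)%R).
Proof. by apply: jmeasM => //; exact: jmeas_sol. Qed.

(** At good frequencies |psi sol| <= a + 2 b, where a and b are the integrands of the hypothesis
    with the factor |psi|. Tonelli first puts the frequency integral outside, because the estimate
    fails only on a null set of frequencies. *)
Lemma locint_psi_sol : locint T (fun t xi => (psi t xi * sol t xi)%R).
Proof.
split; first exact: jmeas_psi_sol.
move=> t n tT; set I := `]0%R, t[%classic; set E := eball n%:R.
have mI : measurable (I : set tau) by exact: measurable_itv.
have mE : measurable (E : set Rd) by exact: measurable_eball.
have mN : measurable_fun [set: tau * Rd] (fun p => (normc (psi p.1 p.2 * sol p.1 p.2))%:E).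
  by apply/measurable_EFinP; apply: measurable_normc => //; exact: jmeas_psi_sol.
have N0 (p : tau * Rd) : 0 <= (normc (psi p.1 p.2 * sol p.1 p.2))%:E.
  by rewrite lee_fin normc_ge0.
rewrite (tonelli_restrict mu leb mI mE mN N0)/=.
have mAx := measurable_integral_fst mu mI mE ma a0.
have mBx := measurable_integral_fst mu mI mE mb bb0.
have A0 xi : 0 <= \int[mu]_(rho in I) a (rho, xi) by exact: integral_ge0.
have B0 xi : 0 <= \int[mu]_(rho in I) b (rho, xi) by exact: integral_ge0.
apply: (@le_lt_trans _ _ (\int[leb]_(xi in E) (\int[mu]_(rho in I) a (rho, xi) +
    2%:E * \int[mu]_(rho in I) b (rho, xi)))).
  apply: ae_ge0_le_integral => //.
  - by move=> xi _; apply: integral_ge0 => s _; exact: (N0 (s, xi)).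
  - exact: (measurable_integral_fst mu mI mE mN N0).
  - by move=> xi _; rewrite adde_ge0// mule_ge0.
  - by apply: emeasurable_funD => //; apply: emeasurable_funM.
  apply: aeS ae_good => xi gxi xiE.
  have msec (F : tau * Rd -> \bar R) : measurable_fun setT F ->
      measurable_fun I (fun s : tau => F (s, xi)).
    move=> mF; apply: measurable_funTS; apply: (measurableT_comp mF).
    exact: measurable_pair2.
  rewrite -ge0_integralZl//; [|exact: msec mb].
  rewrite -ge0_integralD//; [|exact: msec ma| |]; last 2 first.
  - by move=> s _; rewrite mule_ge0.
  - by apply: emeasurable_funM => //; exact: msec mb.
  apply: ge0_le_integral => //.
  - by move=> s _; exact: (N0 (s, xi)).
  - exact: (msec _ mN).
  - apply: emeasurable_funD; first exact: msec ma.
    by apply: emeasurable_funM => //; exact: msec mb.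
  move=> s sI; have sT := time_sub tT sI; rewrite /a /b /b0/=.
  (* At a good frequency the inner integral [b0] is finite, so that the comparison can be carried
     out in R. *)
  have := integrable_exp_fh gxi sT => /integrable_fin_num-/(_ (measurable_itv _)) fn.
  rewrite -[X in _ * (_ * X)]fineK// -!EFinM -EFinD lee_fin.
  rewrite Normc.normcM -mulrA [(2 * _)%R]mulrCA -mulrDr ler_wpM2l ?normc_ge0//.
  exact: le_normc_sol.
have := hint n tT; rewrite -/E -/I => hlt.
rewrite ge0_integralD//; last 2 first.
- by move=> xi _; rewrite mule_ge0.
- exact: emeasurable_funM.
rewrite ge0_integralZl//.
have fA : \int[leb]_(xi in E) \int[mu]_(rho in I) a (rho, xi) < +oo.
  by apply: le_lt_trans hlt; rewrite leeDl// integral_ge0.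
have fB : \int[leb]_(xi in E) \int[mu]_(rho in I) b (rho, xi) < +oo.
  by apply: le_lt_trans hlt; rewrite leeDr// integral_ge0.
by rewrite lte_add_pinfty// lte_mul_pinfty.
Qed.

Local Close Scope ereal_scope.

Lemma ae_sol_eq t : time_itv T t -> {ae leb, forall xi,
  (u0h xi + cintegral mu `]0, t[ (fun s => psi s xi * sol s xi)) +
    cintegral mu `]0, t[ (fh ^~ xi) = sol t xi}.
Proof. by move=> tT; apply: aeS ae_good => xi /sol_eq-/(_ _ tT)[]. Qed.

End fourier_side_solution.

(** * Existence *)

Lemma Lnorm_oo {R : realType} {disp} {X : measurableType disp}
    (m : {measure set X -> \bar R}) (f : X -> \bar R) :
  Lnorm m +oo%E f = if (0 < m setT)%E then ess_sup m (abse \o f) else 0%E.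
Proof. by rewrite unlock. Qed.

(** * Mixed norms in time and frequency *)

Section mixed_norms.
Context {R : realType} {d : nat}.
Variable T : \bar R.
Local Notation tau := (measurableTypeR R).
Local Notation mu := (@lebesgue_measure R).
Local Notation Rd := 'rV[R]_d.
Local Notation leb := (lebesgue_rV R d).
Implicit Types g : R -> Rd -> R[i].

Lemma eball0 : eball 0 = set0 :> set Rd.
Proof. by apply/seteqP; split=> // x; rewrite /eball/= ltNge sqrtr_ge0. Qed.

Lemma measurable_eball_norm g r : jmeas g ->
  measurable_fun setT (fun s : tau => \int[leb]_(xi in eball r) (normc (g s xi))%:E)%E.
Proof.
move=> jg; have mN : measurable_fun [set: tau * Rd] (fun p => (normc (g p.1 p.2))%:E).
  by apply/measurable_EFinP; exact: measurable_normc.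
have N0 (p : tau * Rd) : (0 <= (normc (g p.1 p.2))%:E)%E by rewrite lee_fin normc_ge0.
exact: (measurable_integral_snd leb measurableT (measurable_eball r) mN N0).
Qed.

Lemma mixed11_locint g : cmeasurable_fun (time_itv T `*` setT) (fun p : R * Rd => g p.1 p.2) ->
  (forall t r, time_itv T t -> 0 < r -> (mixed_norm 1 1 t r g < +oo)%E) ->
  locint T (tcut T g).
Proof.
move=> mg ng; split; first exact: jmeas_tcut mg.
move=> t n tT; have [->|n0] := posnP n.
  rewrite (eq_integral (cst 0%E)) ?integral0// => s _.
  by rewrite eball0 integral_set0.
apply: le_lt_trans (ng t n%:R tT _); last by rewrite ltr0n.
rewrite mixed_norm11 le_eqVlt; apply/orP; left; apply/eqP; apply: eq_integral => s.
by move=> /set_mem/(time_sub tT) sT; rewrite tcutE.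
Qed.

Lemma eball_sub_nat r : exists n : nat, eball r `<=` (eball n%:R : set Rd).
Proof.
exists (Num.truncn `|r|).+1; apply: eballS.
by rewrite (le_trans (ler_norm r))// ltW// truncnS_gt.
Qed.

Lemma locint_mixed11 g t r : locint T g -> time_itv T t ->
  (mixed_norm 1 1 t r g < +oo)%E.
Proof.
move=> lg tT; have [n rn] := eball_sub_nat r; rewrite mixed_norm11.
apply: le_lt_trans (lg.2 t n tT).
have mI : measurable (`]0, t[%classic : set tau) by exact: measurable_itv.
apply: ge0_le_integral => //.
- by move=> s _; apply: integral_ge0 => xi _; rewrite lee_fin normc_ge0.
- by apply: measurable_funTS; apply: measurable_eball_norm; case: lg.
- by apply: measurable_funTS; apply: measurable_eball_norm; case: lg.
move=> s _; apply: ge0_subset_integral => //; try exact: measurable_eball.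
  apply: measurable_funTS; apply/measurable_EFinP.
  exact: measurable_normc (jmeas_t s lg.1).
by move=> xi _; rewrite lee_fin normc_ge0.
Qed.

Lemma locint_normc g h : jmeas h -> (forall t xi, normc (h t xi) = normc (g t xi)) ->
  locint T g -> locint T h.
Proof.
move=> jh hg [_ lg]; split=> // t n tT.
by under eq_integral do under eq_integral do rewrite hg; exact: lg.
Qed.

Lemma mixed_norm_oo1_bound g t r (B : R) : 
  (forall s, `]0, t[%classic s ->
    (\int[leb]_(xi in eball r) (normc (g s xi))%:E <= B%:E)%E) ->
  0 <= B -> (mixed_norm +oo 1 t r g < +oo)%E.
Proof.
move=> hB B0; rewrite /mixed_norm Lnorm_oo; case: ifP => _; last by rewrite ltry.
apply: (@le_lt_trans _ _ B%:E); last exact: ltry.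
apply/ess_supP; apply: aeW => s; rewrite /= /patch; case: ifPn => [/set_mem sI|_].
  rewrite Lnorm1 gee0_abs; last by apply: integral_ge0 => xi _; exact: abse_ge0.
  apply: le_trans (hB s sI); rewrite [leRHS]integral_mkcond le_eqVlt.
  apply/orP; left; apply/eqP; apply: eq_integral => xi _; rewrite /patch.
  by case: ifP => _; rewrite ?abse0// gee0_abs// lee_fin normc_ge0.
by rewrite abse0 lee_fin.
Qed.

Lemma mixed_norm_oo1_ae g t r : (mixed_norm +oo 1 t r g < +oo)%E ->
  exists2 B : R, 0 <= B & {ae mu, forall s, `]0, t[%classic s ->
    (\int[leb]_(xi in eball r) (normc (g s xi))%:E <= B%:E)%E}.
Proof.
rewrite /mixed_norm Lnorm_oo.
(* The sup norm is 0 by convention over a space of measure zero; the unit interval rules this case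
   out. *)
have -> : (0 < mu [set: tau])%E.
  apply: (@lt_le_trans _ _ (mu `[0%R, 1%R]%classic)).
    by rewrite lebesgue_measure_itv/= lte_fin ltr01 oppr0 adde0 lte_fin ltr01.
  by apply: le_measure; rewrite ?inE//; exact: measurable_itv.
set e := ess_sup _ _ => e_lt.
have [B B0 eB] : exists2 B : R, 0 <= B & (e <= B%:E)%E.
  move: e_lt; case: e => [r'| |] // _.
  - by exists `|r'| => //; rewrite lee_fin ler_norm.
  - by exists 0; rewrite ?leNye.
exists B => //; have /ess_supP := eB; apply: aeS => s; rewrite /= /patch => h sI.
move: h; rewrite mem_set// Lnorm1 gee0_abs; last by apply: integral_ge0 => xi _; exact: abse_ge0.
apply: le_trans; rewrite [leLHS]integral_mkcond le_eqVlt.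
apply/orP; left; apply/eqP; apply: eq_integral => xi _; rewrite /patch.
by case: ifP => _; rewrite ?abse0// gee0_abs// lee_fin normc_ge0.
Qed.

(** An essential bound B in time integrates to at most t B over the bounded interval (0, t). *)
Lemma mixed_oo1_locint g : cmeasurable_fun (time_itv T `*` setT) (fun p : R * Rd => g p.1 p.2) ->
  (forall t r, time_itv T t -> 0 < r -> (mixed_norm +oo 1 t r g < +oo)%E) ->
  locint T (tcut T g).
Proof.
move=> mg ng; split; first exact: jmeas_tcut mg.
move=> t n tT; have [->|n0] := posnP n.
  rewrite (eq_integral (cst 0%E)) ?integral0// => s _.
  by rewrite eball0 integral_set0.
have n0' : 0 < n%:R :> R by rewrite ltr0n.
have [B B0 hB] := mixed_norm_oo1_ae (ng t _ tT n0').
have mI : measurable (`]0, t[%classic : set tau) by exact: measurable_itv.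
apply: (@le_lt_trans _ _ (\int[mu]_(s in `]0%R, t[) B%:E)%E).
  apply: ae_ge0_le_integral => //.
  - by move=> s _; apply: integral_ge0 => xi _; rewrite lee_fin normc_ge0.
  - by apply: measurable_funTS; apply: measurable_eball_norm; exact: jmeas_tcut mg.
  apply: aeS hB => s h sI; have := h sI.
  by rewrite tcutE//; exact: (time_sub tT sI).
rewrite integral_cst// [X in (_ * X)%E](_ : _ = t%:E) -?EFinM ?ltry//.
have := lebesgue_measure_itv (`]0, t[ : interval R).
by rewrite /= lte_fin tT.1 oppr0 adde0 => <-.
Qed.

End mixed_norms.

(** * Weak* measurability from continuity in time *)

Section weak_star_measurability.
Context {R : realType} {d : nat}.
Variable T : \bar R.
Local Notation tau := (measurableTypeR R).
Local Notation mu := (@lebesgue_measure R).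
Local Notation Rd := 'rV[R]_d.
Local Notation leb := (lebesgue_rV R d).
Local Notation C := R[i].
Local Notation V := (invF_dual R d).
Local Notation D := (@test_fun R d setT).

Lemma open_time : open (time_itv T).
Proof.
case: T => [r| |].
- rewrite (_ : time_itv _ = `]0, r[%classic); first exact: interval_open.
  apply/seteqP; split=> t; rewrite /time_itv/= in_itv/= lte_fin; first by move=> [-> ->].
  by move=> /andP[].
- rewrite (_ : time_itv _ = `]0, +oo[%classic); first exact: interval_open.
  by apply/seteqP; split=> t; rewrite /time_itv/= in_itv/= andbT ltry; [move=> []|].
- rewrite (_ : time_itv _ = set0); first exact: open0.
  by apply/seteqP; split=> t // [_]; rewrite ltNge leNye.
Qed.

Lemma L0_continuous (u : R -> V) :
  (forall phi, invF_test phi -> forall t, time_itv T t -> forall e, 0 < e ->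
    \forall t' \near t, normc (u t' phi - u t phi) < e) -> L0 T u.
Proof.
move=> cu; apply: (@measurability _ _ tau (g_sigma_algebraType (@open V)) _ _ (@open V)) => //.
move=> _ [A oA <-]; apply: open_measurable.
rewrite openE => t [tT At]; apply: filterI.
  by apply: open_nbhs_nbhs; split => //; exact: open_time.
apply: weak_star_continuous oA At => phi tphi e e0; exact: cu.
Qed.

Lemma near_itv_time t : time_itv T t -> exists2 t1, time_itv T t1 & 0 < t < t1.
Proof. by move=> tT; have [q qT tq] := time_rat tT; exists (ratr q); rewrite ?tT.1. Qed.

Lemma continuous_cprim (k F : R -> C) : 
  (forall t1, time_itv T t1 -> cprim t1 k F) ->
  forall t, time_itv T t -> forall e, 0 < e -> \forall t' \near t, normc (F t' - F t) < e.
Proof.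
move=> pF t tT e e0; have [t1 t1T /andP[t0 tt1]] := near_itv_time tT.
have [pR pI] := pF t1 t1T; have t10 : 0 <= t1 by exact: ltW t1T.1.
have cont (f G : R -> R) : prim t1 f G -> {for t, continuous G}.
  move=> pG; have := prim_continuous t10 pG.
  have sub : (`]0, t1[%classic : set R) `<=` `[0, t1]%classic.
    by move=> x; rewrite /= !in_itv/= => /andP[/ltW -> /ltW ->].
  move=> /(continuous_subspaceW sub).
  rewrite continuous_open_subspace; last exact: interval_open.
  by apply; rewrite inE/= in_itv/= t0.
have e20 : 0 < e / 2 by rewrite divr_gt0.
have /cvgrPdist_lt/(_ _ e20) h1 := cont _ _ pR; have /cvgrPdist_lt/(_ _ e20) h2 := cont _ _ pI.
apply: filterS2 h1 h2 => t' /= h1 h2; rewrite (le_lt_trans (normc_le_ReIm _))//.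
by rewrite cReD cImD cReN cImN (splitr e) ltrD// distrC.
Qed.

End weak_star_measurability.

Section existence.
Context {R : realType} {d : nat}.
Variable T : \bar R.
Local Notation tau := (measurableTypeR R).
Local Notation mu := (@lebesgue_measure R).
Local Notation Rd := 'rV[R]_d.
Local Notation leb := (lebesgue_rV R d).
Local Notation C := R[i].
Local Notation V := (invF_dual R d).
Variables (psi fh y : R -> Rd -> C) (u0h : Rd -> C) (u0 : V) (f : R -> V).
Hypothesis jy : jmeas y.
Hypothesis lf : locint T fh.
Hypothesis lpy : locint T (fun t xi => psi t xi * y t xi).
Hypothesis r0 : realization setT u0 u0h.
Hypothesis Lf : L0 T f.
Hypothesis rf : {ae mu, forall t, time_itv T t -> realization setT (f t) (fh t)}.
Hypothesis y_eq : forall t, time_itv T t -> {ae leb, forall xi,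
  (u0h xi + cintegral mu `]0, t[ (fun s => psi s xi * y s xi)) +
    cintegral mu `]0, t[ (fh ^~ xi) = y t xi}.

Lemma clocally_integrable_y t : time_itv T t -> clocally_integrable setT (y t).
Proof.
move=> tT; apply: ae_eq_clocally_integrable (y_eq tT) _; first exact: jmeas_t jy.
apply: clocally_integrableD; last exact: (locint_prim lf tT).
by apply: clocally_integrableD; [case: r0|exact: (locint_prim lpy tT)].
Qed.

(** Total in v, with the zero functional [point] as default, because a solution is a function of
    every real t, including those where its density is not locally integrable. *)
Definition dual_of (v : Rd -> C) : V :=
  if pselect (clocally_integrable setT v) is left h then of_loc h else point.

Lemma realization_dual_of v : clocally_integrable setT v -> realization setT (dual_of v) v.
Proof. by rewrite /dual_of; case: pselect => // h _; exact: realization_of_loc. Qed.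

(** Local integrability of psi y at time s, phrased with countably many balls so that the set of
    such times is measurable. *)
Definition loc_times : set R :=
  [set s | forall n : nat, (\int[leb]_(xi in eball n%:R) (normc (psi s xi * y s xi))%:E < +oo)%E].

Lemma measurable_loc_times : measurable (loc_times : set tau).
Proof.
rewrite (_ : loc_times = \bigcap_(n in setT) (setT `&`
    (fun s : tau => \int[leb]_(xi in eball n%:R) (normc (psi s xi * y s xi))%:E)%E @^-1` [set~ +oo%E])).
  apply: bigcapT_measurable => n.
  apply: (measurable_eball_norm (n%:R) lpy.1) => //.
  by apply: measurableC; exact: emeasurable_set1.
apply/seteqP; split=> [s hs n _|s hs n].
  by split => //= E; have := hs n; rewrite E.
by have [_ /= /eqP] := hs n I; rewrite -ltey.
Qed.

(* [psi y], set to 0 at the (negligible set of) times at which it is not locally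
   integrable, so that its pairing with any test function is measurable. *)
Definition wh s : Rd -> C := if pselect (loc_times s) then fun xi => psi s xi * y s xi else fun=> 0.

Lemma jmeas_wh : jmeas wh.
Proof.
have mD : measurable (loc_times `*` setT : set (tau * Rd)).
  by apply: measurableX => //; exact: measurable_loc_times.
have := (cmeasurable_patch (fun p : tau * Rd => psi p.1 p.2 * y p.1 p.2) mD).1.
move=> /(_ (cmeasurableS _ _ lpy.1)) h; have := h measurableT (@subsetT _ _).
congr cmeasurable_fun; apply/funext => -[t xi].
rewrite /patch in_setX/= in_setT andbT /wh; case: pselect => tl.
  by rewrite mem_set.
by rewrite memNset.
Qed.

Lemma ae_wh : {ae mu, forall s, time_itv T s -> wh s = fun xi => psi s xi * y s xi}.
Proof.
apply: aeS (locint_ae_t lpy) => s h sT; rewrite /wh; case: pselect => // nl.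
exfalso; apply: nl => n; have := cintegrable_eball n%:R (h sT).
by move=> /(cintegrableP leb _ (measurable_eball _))[].
Qed.

Lemma locint_wh : locint T wh.
Proof.
apply: (eq_locint jmeas_wh _ lpy).
by apply: aeS ae_wh => s h sT; apply: aeW => xi; rewrite h.
Qed.

Lemma clocally_integrable_wh s : clocally_integrable setT (wh s).
Proof.
apply: clocally_integrableP; first exact: jmeas_t jmeas_wh.
move=> n; rewrite /wh; case: pselect => [h|h]; first exact: h.
by rewrite (eq_integral (cst 0%E)) ?integral0// => xi _; rewrite Normc.normc0.
Qed.

Let u t := dual_of (y t).
Let w s := dual_of (wh s).

Lemma realization_u t : time_itv T t -> realization setT (u t) (y t).
Proof. by move=> tT; apply: realization_dual_of; exact: clocally_integrable_y. Qed.

(** Measurability of the pairing comes from [Lf], integrability from the density [fh], by which the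
    pairing is given at almost every time. *)
Lemma cintegrable_f phi t : invF_test phi -> time_itv T t ->
  cintegrable mu `]0, t[ (fun s => f s phi) /\
  cintegral mu `]0, t[ (fun s => f s phi) =
  cintegral leb setT (fun xi => cintegral mu `]0, t[ (fh ^~ xi) * conjc (Fourier phi xi)).
Proof.
move=> tphi tT; have [i1 E1] := locint_pairing lf tT tphi.2.
have mI : measurable (`]0, t[%classic : set tau) by exact: measurable_itv.
have mf : cmeasurable_fun (`]0, t[%classic : set tau) (fun s => f s phi).
  apply: (cmeasurableS (measurable_time T) (time_sub tT)).
  by apply: cmeasurable_evaluation tphi => //; exact: measurable_time.
have ae : {ae mu, forall s, `]0, t[%classic s ->
    cintegral leb setT (fun xi => fh s xi * conjc (Fourier phi xi)) = f s phi}.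
  by apply: aeS rf => s h sI; rewrite -(realizationE (h (time_sub tT sI)) tphi).
split; first exact: ae_eq_cintegrable mI mf ae i1.
rewrite -E1; apply/esym/ae_eq_cintegral => //; exact: cintegrable_cmeasurable i1.
Qed.

Lemma cintegrable_w phi t : invF_test phi -> time_itv T t ->
  cintegrable mu `]0, t[ (fun s => w s phi) /\
  cintegral mu `]0, t[ (fun s => w s phi) =
  cintegral leb setT (fun xi => cintegral mu `]0, t[ (fun s => psi s xi * y s xi) *
    conjc (Fourier phi xi)).
Proof.
move=> tphi tT; have [i1 E1] := locint_pairing locint_wh tT tphi.2.
have [i2 E2] := locint_pairing lpy tT tphi.2.
have mI : measurable (`]0, t[%classic : set tau) by exact: measurable_itv.
have wE : (fun s => w s phi) =
    (fun s => cintegral leb setT (fun xi => wh s xi * conjc (Fourier phi xi))).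
  apply/funext => s; apply: realizationE => //; apply: realization_dual_of.
  exact: clocally_integrable_wh.
rewrite wE; split; [exact: i1|rewrite -E2]; apply: ae_eq_cintegral => //.
- exact: cintegrable_cmeasurable i1.
- exact: cintegrable_cmeasurable i2.
by apply: aeS ae_wh => s h sI; rewrite h//; exact: (time_sub tT sI).
Qed.

Lemma weak_formula phi t : invF_test phi -> time_itv T t ->
  u t phi = u0 phi + cintegral mu `]0, t[ (fun s => w s phi) +
    cintegral mu `]0, t[ (fun s => f s phi).
Proof.
move=> tphi tT; rewrite (cintegrable_w tphi tT).2 (cintegrable_f tphi tT).2.
rewrite (realizationE r0 tphi) (realizationE (realization_u tT) tphi).
have p0 := cintegrable_pairing r0.1 tphi.2.
have p1 := cintegrable_pairing (locint_prim lpy tT) tphi.2.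
have p2 := cintegrable_pairing (locint_prim lf tT) tphi.2.
rewrite -cintegralD// -cintegralD//; last exact: cintegrableD.
have mF : cmeasurable_fun setT (fun xi => conjc (Fourier phi xi)).
  by apply: cmeasurable_conj; apply: csmooth_cmeasurable; case: tphi.2.
apply: ae_eq_cintegral => //.
- by apply: cmeasurableM => //; exact: jmeas_t jy.
- exact: (cintegrable_cmeasurable (cintegrableD measurableT (cintegrableD measurableT p0 p1) p2)).
by apply: aeS (y_eq tT) => xi <- _; rewrite !mulrDl.
Qed.

(** The weak formula holds at every t in (0, T), so each pairing is a constant plus an indefinite
    integral, hence continuous. *)
Lemma L0_u : L0 T u.
Proof.
apply: L0_continuous => phi tphi t tT e e0.
pose F t := u0 phi + cintegral mu `]0, t[ (fun s => w s phi + f s phi).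
have uF t' : time_itv T t' -> u t' phi = F t'.
  move=> t'T; rewrite weak_formula// /F cintegralD//.
  - by rewrite addrA.
  - exact: (cintegrable_w tphi t'T).1.
  - exact: (cintegrable_f tphi t'T).1.
have pF t1 : time_itv T t1 -> cprim t1 (fun s => w s phi + f s phi) F.
  move=> t1T; apply: cprim_integral.
  apply: cintegrableD; first exact: measurable_itv.
  - exact: (cintegrable_w tphi t1T).1.
  - exact: (cintegrable_f tphi t1T).1.
have nt : \forall t' \near t, time_itv T t'.
  by apply: open_nbhs_nbhs; split => //; exact: open_time.
apply: filterS2 nt (continuous_cprim pF tT e0) => t' t'T.
by rewrite !uF.
Qed.

Lemma weak_solution_u : Fourier_weak_solution T psi u0 f u.
Proof.
split; first exact: L0_u.
exists w; split.
  apply: aeS ae_wh => s h sT; exists setT, (y s); split => //.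
  - exact: realization_u.
  - rewrite (_ : zero_ext _ _ = wh s); first exact: clocally_integrable_wh.
    by rewrite h//; apply/funext => xi; rewrite /zero_ext /patch in_setT.
  - move=> phi tphi; rewrite (realizationE (v := wh s)) //.
      by apply: eq_cintegral => xi _; rewrite h// /zero_ext /patch in_setT.
    exact/realization_dual_of/clocally_integrable_wh.
move=> phi tphi; split.
  by move=> t tT; split; [exact: (cintegrable_w tphi tT).1|exact: (cintegrable_f tphi tT).1].
by apply: aeW => t tT; exact: weak_formula.
Qed.

Lemma zero_extT (v : Rd -> C) : zero_ext setT v = v.
Proof. by apply/funext => xi; rewrite /zero_ext /patch in_setT. Qed.

(** For t in (0, t1) the integral equation bounds |y t| by |u0h| + 2 int_0^t1 |psi y| + 2 int_0^t1
    |fh|, a locally integrable function of xi that does not depend on t. *)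
Lemma Xspace_oo1_u : Xspace T +oo%E 1%E (fun _ _ => 1) u.
Proof.
split; first exact: L0_u.
exists y; split.
  split; first exact: jmeasS.
  apply: aeW => t tT; exists setT, (y t); split => //; first exact: realization_u.
  by rewrite zero_extT; apply/funext => xi; rewrite mul1r.
move=> t1 r t1T r0'.
(* The time integrals of the moduli are written as complex integrals in order to apply
   [locint_prim]. *)
pose v1 xi := cintegral mu `]0, t1[ (fun s => (normc (psi s xi * y s xi))%:C%C).
pose v2 xi := cintegral mu `]0, t1[ (fun s => (normc (fh s xi))%:C%C).
have ln (g : R -> Rd -> C) : locint T g -> locint T (fun t xi => (normc (g t xi))%:C%C).
  move=> lg; apply: (locint_normc _ _ lg).
    by apply: cmeasurable_real; apply: measurable_normc => //; case: lg.
  by move=> t xi; rewrite normc_real ger0_norm// normc_ge0.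
have l1 : clocally_integrable setT v1 := locint_prim (ln _ lpy) t1T.
have l2 : clocally_integrable setT v2 := locint_prim (ln _ lf) t1T.
have mE := @measurable_eball R d r.
pose z xi := normc (u0h xi) + (2 * normc (v1 xi) + 2 * normc (v2 xi)).
have iz : leb.-integrable (eball r) (EFin \o z).
  apply: integrable_addR => //; first exact: cintegrable_normc (cintegrable_eball r r0.1).
  by apply: integrable_addR => //; apply: integrable_scaleR => //;
    apply: cintegrable_normc => //; exact: cintegrable_eball.
have z0 xi : 0 <= z xi by rewrite !addr_ge0 ?mulr_ge0 ?normc_ge0.
have prim_le (g : R -> Rd -> C) xi t : 0 <= t <= t1 -> cintegrable mu `]0, t1[ (g ^~ xi) ->
    normc (cintegral mu `]0, t[ (g ^~ xi)) <=
    2 * normc (cintegral mu `]0, t1[ (fun s => (normc (g s xi))%:C%C)).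
  move=> /andP[t0 tt1] ig; have t10 : 0 <= t1 by exact: le_trans tt1.
  have mI (a : R) : measurable (`]0, a[%classic : set tau) by exact: measurable_itv.
  have ing := cintegrable_normc (mI t1) ig.
  have igt : cintegrable mu `]0, t[ (g ^~ xi).
    by apply: cintegrableS ig => //; apply: itvoo_sub.
  rewrite (le_trans (le_normc_cintegral (mI t) igt))// ler_wpM2l//.
  rewrite (le_trans (Rintegral_itvoo_le (fun s => normc_ge0 (g s xi)) t0 tt1 (lexx t1) ing))//.
  by rewrite (le_trans _ (normr_Re_le _))//= ler_norm.
apply: (@mixed_norm_oo1_bound _ _ _ _ _ (\int[leb]_(xi in eball r) z xi)); last first.
  by apply: Rintegral_ge0 => xi _; exact: z0.
move=> t tI; have tT := time_sub t1T tI.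
have tt1 : 0 <= t <= t1 by move: tI; rewrite /= in_itv/= => /andP[/ltW -> /ltW ->].
rewrite /Rintegral fineK; last exact: integrable_fin_num.
apply: ae_ge0_le_integral => //.
- by move=> xi _; rewrite lee_fin normc_ge0.
- by apply: measurable_funTS; apply/measurable_EFinP; exact: measurable_normc (jmeas_t t jy).
- by move=> xi _; rewrite lee_fin z0.
- by case/integrableP: iz.
(* Three almost-everywhere statements are combined; two of them are indexed by a boolean so that
   [ae_countable] merges them. *)
apply: aeS2 (y_eq tT) (ae_countable (fun b : bool => if b as b return
   {ae leb, forall xi, cintegrable mu `]0, t1[ (if b then (fun s => psi s xi * y s xi) else fh ^~ xi)}
   then aeS (fun xi h => h t1 t1T) (locint_ae_xi lpy)
   else aeS (fun xi h => h t1 t1T) (locint_ae_xi lf))) => xi <- ib _.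
rewrite lee_fin (le_trans (le_normcD _ _))// /z addrA lerD//; last first.
  exact: prim_le (ib false).
rewrite (le_trans (le_normcD _ _))// lerD//.
exact: (prim_le (fun s xi => psi s xi * y s xi) _ _ tt1 (ib true)).
Qed.

Hypothesis jpsi : jmeas psi.

Lemma Xspace_11_u : Xspace T 1%E 1%E (fun t xi => normc (psi t xi)) u.
Proof.
split; first exact: L0_u.
have jm : jmeas (fun t xi => (normc (psi t xi))%:C%C * y t xi).
  by apply: jmeasM jy; apply: cmeasurable_real; exact: measurable_normc.
exists (fun t xi => (normc (psi t xi))%:C%C * y t xi); split.
  split; first exact: (@jmeasS _ _ T _ jm).
  apply: aeW => t tT; exists setT, (y t); split => //; first exact: realization_u.
  by rewrite zero_extT.
move=> t1 r t1T r0'; apply: (@locint_mixed11 _ _ T _ t1 r _ t1T).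
apply: (locint_normc jm _ lpy) => t xi.
by rewrite !Normc.normcM normc_real ger0_norm ?normc_ge0.
Qed.

End existence.

(** * Uniqueness *)

Section uniqueness.
Context {R : realType} {d : nat}.
Variable T : \bar R.
Local Notation tau := (measurableTypeR R).
Local Notation mu := (@lebesgue_measure R).
Local Notation Rd := 'rV[R]_d.
Local Notation leb := (lebesgue_rV R d).
Local Notation C := R[i].
Local Notation V := (invF_dual R d).
Local Notation Qbox := ('rV[rat]_d * 'rV[rat]_d)%type.
Variables (psi fh : R -> Rd -> C) (u0h : Rd -> C) (u0 : V) (f u : R -> V).
Hypothesis jpsi : jmeas psi.
Hypothesis lf : locint T fh.
Hypothesis r0 : realization setT u0 u0h.
Hypothesis rf : {ae mu, forall t, time_itv T t -> realization setT (f t) (fh t)}.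
Hypothesis hpsi : forall t, time_itv T t -> {ae leb, forall xi,
  (\int[mu]_(r in `]0%R, t[) (normc (psi r xi))%:E < +oo)%E}.
Hypothesis u_sol : Fourier_weak_solution T psi u0 f u.
Hypothesis u_oo1 : Xspace T +oo%E 1%E (fun _ _ => 1) u.
Hypothesis u_11 : Xspace T 1%E 1%E (fun t xi => normc (psi t xi)) u.

Lemma u_realized : exists2 h : R -> Rd -> C, locint T h &
  {ae mu, forall t, time_itv T t -> realization setT (u t) (h t)}.
Proof.
have [_ [g [mg ng]]] := u_oo1; exists (tcut T g).
  exact: mixed_oo1_locint mg.1 ng.
by apply: aeS (mul_Fourier_realization mg) => t h tT; rewrite tcutE//; exact: h.
Qed.

Section realized.
Variable h : R -> Rd -> C.
Hypothesis lh : locint T h.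
Hypothesis rh : {ae mu, forall t, time_itv T t -> realization setT (u t) (h t)}.

Let psih t xi := psi t xi * h t xi.

(** X_{1,1}(|psi|) provides a realization on an open set containing the support of psi. There it
    agrees with h almost everywhere, and elsewhere psi is 0. *)
Lemma locint_psih : locint T psih.
Proof.
have jph : jmeas psih by apply: jmeasM => //; case: lh.
have [_ [g [mg ng]]] := u_11.
have lg := mixed11_locint mg.1 ng.
have jn (k : R -> Rd -> C) : jmeas k -> jmeas (fun t xi => (normc (k t xi))%:C%C).
  by move=> jk; apply: cmeasurable_real; exact: measurable_normc.
have ln : locint T (fun t xi => (normc (tcut T g t xi))%:C%C).
  apply: (locint_normc _ _ lg); first by apply: jn; case: lg.
  by move=> t xi; rewrite normc_real ger0_norm// normc_ge0.
have lp : locint T (fun t xi => (normc (psih t xi))%:C%C).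
  apply: (eq_locint (jn _ jph) _ ln).
  apply: aeS2 mg.2 rh => t h1 h2 tT; have [U [v [pU rv gE]]] := h1 tT.
  apply: aeS (realization_unique (@subsetT _ U) rv (h2 tT)) => xi hv.
  rewrite tcutE// gE /zero_ext /patch /psih; case: ifPn => [/set_mem xU|/negP xU].
    by rewrite hv// !Normc.normcM normc_real ger0_norm// normc_ge0.
  suff -> : psi t xi = 0 by rewrite mul0r Normc.normc0.
  apply/eqP/negPn/negP => p0; apply: xU; apply: mem_set; apply: pU.
  by apply: subset_closure; rewrite /= normc_eq0.
apply: (locint_normc jph _ lp) => t xi.
by rewrite normc_real ger0_norm// normc_ge0.
Qed.

Let v t xi := u0h xi + cintegral mu `]0, t[ (fun s => psih s xi) + cintegral mu `]0, t[ (fh ^~ xi).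

Let jv : jmeas v.
Proof.
apply: jmeasD; last by apply: jmeas_prim; case: lf.
apply: jmeasD; first by apply: jmeas_space; case: r0 => -[].
by apply: jmeas_prim; case: locint_psih.
Qed.

Let lv t : time_itv T t -> clocally_integrable setT (v t).
Proof.
move=> tT; apply: clocally_integrableD; last exact: (locint_prim lf tT).
by apply: clocally_integrableD; [case: r0|exact: (locint_prim locint_psih tT)].
Qed.

(** The null set of times depends on phi. The multiplier term is identified with psi h by comparing
    realizations on the support of psi, and [locint_pairing] moves the time integrals inside the
    pairing. *)
Lemma u_pairing phi : invF_test phi -> {ae mu, forall t, time_itv T t ->
  cintegral leb setT (fun xi => h t xi * conjc (Fourier phi xi)) =
  cintegral leb setT (fun xi => v t xi * conjc (Fourier phi xi))}.
Proof.
move=> tphi; have [_ [w [hw /(_ phi tphi)[iw uw]]]] := u_sol.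
have mF : cmeasurable_fun setT (fun xi => conjc (Fourier phi xi)).
  by apply: cmeasurable_conj; apply: csmooth_cmeasurable; case: tphi.2.
have wE : {ae mu, forall s, time_itv T s ->
    w s phi = cintegral leb setT (fun xi => psih s xi * conjc (Fourier phi xi))}.
  apply: aeS2 hw rh => s h1 h2 sT; have [U [k [pU rk lk ->//]]] := h1 sT.
  have [_ mk _] := lk.
  apply: ae_eq_cintegral => //.
  - exact: cmeasurableM.
  - by apply: cmeasurableM => //; apply: (jmeas_t s); case: locint_psih.
  apply: aeS (realization_unique (@subsetT _ U) rk (h2 sT)) => xi hk _.
  congr (_ * _); rewrite /zero_ext /patch /psih; case: ifPn => [/set_mem xU|/negP xU].
    by rewrite hk.
  suff -> : psi s xi = 0 by rewrite mul0r.
  by apply: csupp_out => /pU xU'; apply: xU; exact: mem_set.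
have fE : {ae mu, forall s, time_itv T s ->
    f s phi = cintegral leb setT (fun xi => fh s xi * conjc (Fourier phi xi))}.
  by apply: aeS rf => s h1 sT; exact: realizationE (h1 sT) tphi.
apply: aeS2 uw rh => t h1 h2 tT.
rewrite -(realizationE (h2 tT) tphi) h1//.
have mI : measurable (`]0, t[%classic : set tau) by exact: measurable_itv.
have [i1 i2] := iw t tT.
have [j1 E1] := locint_pairing locint_psih tT tphi.2.
have [j2 E2] := locint_pairing lf tT tphi.2.
have -> : cintegral mu `]0, t[ (fun s => w s phi) =
    cintegral mu `]0, t[ (fun s => cintegral leb setT (fun xi => psih s xi * conjc (Fourier phi xi))).
  apply: ae_eq_cintegral => //.
  - exact: cintegrable_cmeasurable i1.
  - exact: cintegrable_cmeasurable j1.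
  by apply: aeS wE => s hs sI; apply: hs; exact: (time_sub tT sI).
have -> : cintegral mu `]0, t[ (fun s => f s phi) =
    cintegral mu `]0, t[ (fun s => cintegral leb setT (fun xi => fh s xi * conjc (Fourier phi xi))).
  apply: ae_eq_cintegral => //.
  - exact: cintegrable_cmeasurable i2.
  - exact: cintegrable_cmeasurable j2.
  by apply: aeS fE => s hs sI; apply: hs; exact: (time_sub tT sI).
rewrite E1 E2 (realizationE r0 tphi).
have p0 := cintegrable_pairing r0.1 tphi.2.
have p1 := cintegrable_pairing (locint_prim locint_psih tT) tphi.2.
have p2 := cintegrable_pairing (locint_prim lf tT) tphi.2.
rewrite -cintegralD// -cintegralD//; last exact: cintegrableD.
by apply: eq_cintegral => xi _; rewrite /v !mulrDl.
Qed.

(** Every bump is the transform of an element of F^-1 D. Merging the null sets of countably many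
    bumps leaves almost every time at which the fundamental lemma applies to h - v. *)
Lemma h_integral_eq : {ae mu, forall t, time_itv T t ->
  {ae leb, forall xi, h t xi = v t xi}}.
Proof.
pose bump (qn : Qbox * nat) (x : Rd) : C := (rbump qn.1 qn.2 x)%:C%C.
have tb qn : test_fun setT (bump qn).
  exact: (test_fun_rbump (U := setT) qn.2 (@subset_refl _ (rbox R qn.1)) (@subsetT _ _)).
have H : {ae mu, forall t, forall qn, time_itv T t ->
    cintegral leb setT (fun xi => h t xi * bump qn xi) =
    cintegral leb setT (fun xi => v t xi * bump qn xi)}.
  apply: ae_countable => qn; have [t1 t2] := invF_test_FT1 (tb qn).
  apply: aeS (u_pairing t1) => t ht tT; have := ht tT; rewrite t2.
  by under eq_cintegral do rewrite conjc_real; under [in RHS]eq_cintegral do rewrite conjc_real.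
apply: aeS2 H (locint_ae_t lh) => t h1 h2 tT.
have lht := h2 tT; have lvt := lv tT.
have ld : clocally_integrable setT (fun xi => h t xi + - 1 * v t xi).
  by apply: clocally_integrableD => //; exact: clocally_integrableZ.
have : {ae leb, forall x, setT x -> h t x + - 1 * v t x = 0}.
  apply: du_Bois_Reymond_rbump => // q n tq.
  have i1 := cintegrable_pairing lht tq; have i2 := cintegrable_pairing lvt tq.
  have {}i1 : cintegrable leb setT (fun xi => h t xi * bump (q, n) xi).
    by move: i1; congr cintegrable; apply/funext => xi; rewrite conjc_real.
  have {}i2 : cintegrable leb setT (fun xi => v t xi * bump (q, n) xi).
    by move: i2; congr cintegrable; apply/funext => xi; rewrite conjc_real.
  rewrite -[RHS](subrr (cintegral leb setT (fun xi => v t xi * bump (q, n) xi))).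
  rewrite -{1}(h1 (q, n) tT) -cintegralB//; apply: eq_cintegral => xi _.
  by rewrite mulrDl mulN1r mulNr.
by apply: aeS => xi /(_ Logic.I) /eqP; rewrite mulN1r subr_eq0 => /eqP.
Qed.

(** h satisfies the integral equation only almost everywhere, so the scalar argument is run on v: at
    almost every xi, v is a genuine primitive, and psi v = psi h for almost every t, so that v
    satisfies the equation at every t and equals the Duhamel formula. The exchanges of null sets
    lead to fixed xi and back to fixed t. *)
Lemma h_sol : {ae mu, forall t, time_itv T t ->
  {ae leb, forall xi, h t xi = sol psi fh u0h t xi}}.
Proof.
have [_ mu0 _] := r0.1.
have jsol : jmeas (sol psi fh u0h) by exact: (jmeas_sol jpsi lf r0.1).
have jcut (k : R -> Rd -> C) : jmeas k -> jmeas (tcut T k).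
  by move=> jk; apply: jmeas_tcut; exact: cmeasurableS jk.
have jsub (k k' : R -> Rd -> C) : jmeas k -> jmeas k' -> jmeas (tcut T (fun t xi => k t xi - k' t xi)).
  move=> jk jk'; apply: jcut; exact: (cmeasurableD jk (cmeasurableN jk')).
have swap1 : {ae leb, forall xi, {ae mu, forall t, tcut T (fun t xi => h t xi - v t xi) t xi = 0}}.
  apply: (@ae_eq0_swap _ _ _ tau Rd mu leb
    (fun p => tcut T (fun t xi => h t xi - v t xi) p.1 p.2)).
    by apply: jsub jv; case: lh.
  apply: aeS h_integral_eq => t ht; have [tT|tT] := pselect (time_itv T t).
    by apply: aeS (ht tT) => xi E; rewrite /= tcutE// E subrr.
  by apply: aeW => xi; rewrite /= /tcut; case: pselect.
have main : {ae leb, forall xi, {ae mu, forall t,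
    tcut T (fun t xi => h t xi - sol psi fh u0h t xi) t xi = 0}}.
  apply: aeS2 (ae_good jpsi lf hpsi) (ae_countable (fun b : bool => if b as b return
      {ae leb, forall xi, if b then {ae mu, forall t, tcut T (fun t xi => h t xi - v t xi) t xi = 0}
        else forall t, time_itv T t -> cintegrable mu `]0, t[ (psih ^~ xi)}
      then swap1 else locint_ae_xi locint_psih)) => xi gxi hb.
  have ae_hv := hb true; have ipsih := hb false.
  have v_sol t : time_itv T t -> v t xi = sol psi fh u0h t xi.
    move=> tT; have [ip jf] := gxi t tT; have ig := ipsih t tT.
    have t0 : 0 <= t by exact: ltW tT.1.
    have mI : measurable (`]0, t[%classic : set tau) by exact: measurable_itv.
    have mI' (a : R) : measurable (`]0, a[%classic : set tau) by exact: measurable_itv.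
    have jpv : jmeas (fun t xi => psi t xi * v t xi + fh t xi).
      by apply: jmeasD; [exact: jmeasM|case: lf].
    have vh : {ae mu, forall s, `]0, t[%classic s ->
        psih s xi + fh s xi = psi s xi * v s xi + fh s xi}.
      apply: aeS ae_hv => s hs sI; move: hs; rewrite tcutE; last exact: (time_sub tT sI).
      by move=> /eqP; rewrite subr_eq0 => /eqP hs; rewrite /psih hs.
    have isum := cintegrableD mI ig jf.
    have ipv : cintegrable mu `]0, t[ (fun s => psi s xi * v s xi + fh s xi).
      apply: (ae_eq_cintegrable mI _ vh isum).
      by apply: cmeasurableS (jmeas_xi xi jpv).
    apply: (duhamel_unique t0 ip (y := fun s => v s xi)); last by rewrite t0 lexx.
      rewrite /v set_itvoo0.
      have z0 (k : R -> C) : cintegral mu set0 k = 0.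
        by apply: complex_ext; rewrite /= Rintegral_set0.
      by rewrite !z0 !addr0.
    apply/cprimP; split=> // s st.
    rewrite [in RHS]/v set_itvoo0.
    have z0 (k : R -> C) : cintegral mu set0 k = 0.
      by apply: complex_ext; rewrite /= Rintegral_set0.
    rewrite !z0 !addr0.
    have sub : (`]0, s[%classic : set R) `<=` `]0, t[%classic.
      by apply: itvoo_sub => //; case/andP: st.
    have ig' := cintegrableS (mI' s) mI sub ig; have jf' := cintegrableS (mI' s) mI sub jf.
    rewrite /v -addrA -cintegralD//; congr (_ + _).
    apply: ae_eq_cintegral => //.
    - exact: (cintegrable_cmeasurable (cintegrableD (mI' s) ig' jf')).
    - exact: (cintegrable_cmeasurable (cintegrableS (mI' s) mI sub ipv)).
    by apply: aeS vh => r hr rs; apply: hr; exact: sub.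
  apply: aeS ae_hv => t; have [tT|tT] := pselect (time_itv T t).
    by rewrite !tcutE// v_sol.
  by rewrite /tcut; case: pselect.
have : {ae mu, forall t, {ae leb, forall xi, tcut T (fun t xi => h t xi - sol psi fh u0h t xi) t xi = 0}}.
  have mk : cmeasurable_fun [set: Rd * tau]
      (fun p => tcut T (fun t xi => h t xi - sol psi fh u0h t xi) p.2 p.1).
    apply: (@cmeasurable_comp _ _ _ _ _ setT setT
      (fun p : tau * Rd => tcut T (fun t xi => h t xi - sol psi fh u0h t xi) p.1 p.2)
      (fun p : Rd * tau => (p.2, p.1))) => //.
      by apply: jsub => //; case: lh.
    by apply: measurable_fun_pair; [exact: measurable_snd|exact: measurable_fst].
  exact: (@ae_eq0_swap _ _ _ Rd tau leb mu _ mk main).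
apply: aeS => t ht tT; apply: aeS ht => xi; rewrite tcutE//.
by move=> /eqP; rewrite subr_eq0 => /eqP.
Qed.

End realized.

Lemma weak_solution_unique : {ae mu, forall t, time_itv T t ->
  forall phi, invF_test phi ->
    u t phi = cintegral leb setT (fun xi => sol psi fh u0h t xi * conjc (Fourier phi xi))}.
Proof.
have [h lh rh] := u_realized; apply: aeS2 rh (h_sol lh rh) => t h1 h2 tT phi tphi.
rewrite (realizationE (h1 tT) tphi).
have mF : cmeasurable_fun setT (fun xi => conjc (Fourier phi xi)).
  by apply: cmeasurable_conj; apply: csmooth_cmeasurable; case: tphi.2.
apply: ae_eq_cintegral => //.
- by apply: cmeasurableM => //; apply: (jmeas_t t); case: lh.
- by apply: cmeasurableM => //; apply: (jmeas_t t); exact: (jmeas_sol jpsi lf r0.1).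
by apply: aeS (h2 tT) => xi -> _.
Qed.

End uniqueness.

(** * Values outside (0, T), and the theorem *)

Section time_restriction.
Context {R : realType} {d : nat}.
Variable T : \bar R.
Local Notation mu := (@lebesgue_measure R).
Local Notation Rd := 'rV[R]_d.
Local Notation V := (invF_dual R d).
Implicit Types psi : R -> Rd -> R[i].

Lemma weak_solution_tcut psi (u0 : V) (f u : R -> V) :
  Fourier_weak_solution T (tcut T psi) u0 f u <-> Fourier_weak_solution T psi u0 f u.
Proof.
by split=> -[Lu [w [hw h]]]; split=> //; exists w; split=> //; move: hw;
  apply: aeS => s hs sT; have := hs sT; rewrite tcutE.
Qed.

Lemma Xspace_tcut (p q : \bar R) psi (u : R -> V) :
  Xspace T p q (fun t xi => normc (tcut T psi t xi)) u <->
  Xspace T p q (fun t xi => normc (psi t xi)) u.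
Proof.
by split=> -[Lu [g [[mg hg] ng]]]; split=> //; exists g; split=> //; split=> //;
  move: hg; apply: aeS => t ht tT; have := ht tT; rewrite tcutE.
Qed.

Lemma eq_itv_tcut psi s t xi r : 0 <= s -> time_itv T t -> `]s, t[%classic r ->
  tcut T psi r xi = psi r xi.
Proof.
move=> s0 tT; rewrite /= in_itv/= => /andP[sr rt]; rewrite tcutE//.
by apply: time_le tT _ (ltW rt); exact: le_lt_trans sr.
Qed.

Lemma exp_Re_int_tcut psi s t xi : 0 <= s -> time_itv T t ->
  exp_Re_int (tcut T psi) s t xi = exp_Re_int psi s t xi.
Proof.
move=> s0 tT; rewrite /exp_Re_int; congr expR; apply: eq_Rintegral => r /set_mem rI.
by rewrite (eq_itv_tcut _ _ s0 tT rI).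
Qed.

Lemma exp_int_tcut psi s t xi : 0 <= s -> time_itv T t ->
  exp_int (tcut T psi) s t xi = exp_int psi s t xi.
Proof.
move=> s0 tT; rewrite /exp_int; congr cexp; apply: eq_cintegral => r /set_mem rI.
exact: (eq_itv_tcut _ _ s0 tT rI).
Qed.

End time_restriction.

Theorem theorem2p21 (R : realType) (d : nat) (T : \bar R)
    (psi : R -> 'rV[R]_d -> R[i])
    (u0 : invF_dual R d) (f : R -> invF_dual R d)
    (u0h : 'rV[R]_d -> R[i]) (fh : R -> 'rV[R]_d -> R[i]) :
  (0 < T)%E ->
  cmeasurable_fun (time_itv T `*` setT) (fun p : R * 'rV[R]_d => psi p.1 p.2) ->
  (* F[u0] = u0h, a locally integrable function *)
  realization setT u0 u0h ->
  (* f belongs to X_{1,1}(1) and F[f] = fh *)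
  Xspace T 1%E 1%E (fun _ _ => 1) f ->
  mul_Fourier T (fun _ _ => 1) f fh ->
  (* the integrals of psi(r, xi) dr over (s, t) are well defined *)
  (forall t, time_itv T t ->
    {ae lebesgue_rV R d, forall xi,
      (\int[lebesgue_measure]_(r in `]0%R, t[) (Normc.normc (psi r xi))%:E
        < +oo)%E}) ->
  (forall t rad, time_itv T t -> 0 < rad ->
    (\int[lebesgue_rV R d]_(xi in eball rad)
        (exp_Re_int psi 0 t xi * Normc.normc (u0h xi))%R%:E
     + \int[lebesgue_rV R d]_(xi in eball rad)
        \int[lebesgue_measure]_(s in `]0%R, t[)
          (exp_Re_int psi s t xi * Normc.normc (fh s xi))%R%:E < +oo)%E) ->
  (forall t rad, time_itv T t -> 0 < rad ->
    (\int[lebesgue_rV R d]_(xi in eball rad)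
        \int[lebesgue_measure]_(rho in `]0%R, t[)
          (Normc.normc (psi rho xi) * exp_Re_int psi 0 rho xi
           * Normc.normc (u0h xi))%R%:E
     + \int[lebesgue_rV R d]_(xi in eball rad)
        \int[lebesgue_measure]_(rho in `]0%R, t[)
          ((Normc.normc (psi rho xi))%:E *
           \int[lebesgue_measure]_(s in `]0%R, rho[)
            (exp_Re_int psi s rho xi * Normc.normc (fh s xi))%R%:E) < +oo)%E) ->
  let solution (u : R -> invF_dual R d) :=
    [/\ Fourier_weak_solution T psi u0 f u,
        Xspace T +oo%E 1%E (fun _ _ => 1) u &
        Xspace T 1%E 1%E (fun t xi => Normc.normc (psi t xi)) u] in
  exists u : R -> invF_dual R d,
    [/\ solution u,
        forall u', solution u' ->
          {ae lebesgue_measure, forall t, time_itv T t -> u' t = u t} &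
        forall t, time_itv T t -> forall phi, invF_test phi ->
          u t phi =
            cintegral (lebesgue_rV R d) setT (fun xi =>
              exp_int psi 0 t xi * u0h xi * conjc (Fourier phi xi))
            + cintegral (lebesgue_rV R d) setT (fun xi =>
              cintegral lebesgue_measure `]0, t[ (fun s =>
                exp_int psi s t xi * fh s xi)
              * conjc (Fourier phi xi))].
Proof.
move=> T0 mpsi r0 Xf mf hpsi hexp hint solution.
pose psi1 := tcut T psi; pose fh1 := tcut T fh.
have jpsi : jmeas psi1 by exact: jmeas_tcut.
have lf : locint T fh1 by exact: Xspace11_locint Xf mf.
have rf : {ae lebesgue_measure, forall t, time_itv T t -> realization setT (f t) (fh1 t)}.
  by apply: aeS (mul_Fourier_realization mf) => t h tT; rewrite /fh1 tcutE//; exact: h.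
have hpsi1 t : time_itv T t -> {ae lebesgue_rV R d, forall xi,
    (\int[lebesgue_measure]_(r in `]0%R, t[) (normc (psi1 r xi))%:E < +oo)%E}.
  move=> tT; apply: aeS (hpsi t tT) => xi; apply: le_lt_trans.
  rewrite le_eqVlt; apply/orP; left; apply/eqP; apply: eq_integral => r /set_mem rI.
  by rewrite /psi1 (eq_itv_tcut _ _ (lexx 0) tT rI).
have hint1 t (n : nat) : time_itv T t ->
  (\int[lebesgue_rV R d]_(xi in eball n%:R) \int[lebesgue_measure]_(rho in `]0%R, t[)
     (normc (psi1 rho xi) * exp_Re_int psi1 0 rho xi * normc (u0h xi))%:E
   + \int[lebesgue_rV R d]_(xi in eball n%:R) \int[lebesgue_measure]_(rho in `]0%R, t[)
     ((normc (psi1 rho xi))%:E * \int[lebesgue_measure]_(s in `]0%R, rho[)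
       (exp_Re_int psi1 s rho xi * normc (fh1 s xi))%:E) < +oo)%E.
  (* The hypothesis is stated for positive radii; the ball of radius 0 is empty. *)
  move=> tT; have [->|n0] := posnP n; first by rewrite eball0 !integral_set0 adde0 ltry.
  have n0' : 0 < n%:R :> R by rewrite ltr0n.
  have EA xi : (\int[lebesgue_measure]_(rho in `]0%R, t[)
      (normc (psi1 rho xi) * exp_Re_int psi1 0 rho xi * normc (u0h xi))%:E =
    \int[lebesgue_measure]_(rho in `]0%R, t[)
      (normc (psi rho xi) * exp_Re_int psi 0 rho xi * normc (u0h xi))%:E)%E.
    apply: eq_integral => rho /set_mem rI.
    rewrite /psi1 (eq_itv_tcut _ _ (lexx 0) tT rI) exp_Re_int_tcut//.
    exact: (time_sub tT rI).
  have EB xi : (\int[lebesgue_measure]_(rho in `]0%R, t[)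
      ((normc (psi1 rho xi))%:E * \int[lebesgue_measure]_(s in `]0%R, rho[)
        (exp_Re_int psi1 s rho xi * normc (fh1 s xi))%:E) =
    \int[lebesgue_measure]_(rho in `]0%R, t[)
      ((normc (psi rho xi))%:E * \int[lebesgue_measure]_(s in `]0%R, rho[)
        (exp_Re_int psi s rho xi * normc (fh s xi))%:E))%E.
    apply: eq_integral => rho /set_mem rI; have rT := time_sub tT rI.
    rewrite /psi1 (eq_itv_tcut _ _ (lexx 0) tT rI).
    apply: congr1; apply: eq_integral => s /set_mem sI.
    rewrite /fh1 (eq_itv_tcut _ _ (lexx 0) rT sI) exp_Re_int_tcut//.
    by move: sI; rewrite /= in_itv/= => /andP[/ltW].
  by under eq_integral do rewrite EA; under [X in (_ + X)%E]eq_integral do rewrite EB;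
    exact: hint.
pose y := sol psi1 fh1 u0h; have jy : jmeas y by exact: (jmeas_sol jpsi lf r0.1).
have lpy := locint_psi_sol jpsi lf r0.1 hpsi1 hint1.
have y_eq t := ae_sol_eq u0h jpsi lf hpsi1 (t := t).
pose u t := dual_of (y t); have Lf := Xf.1.
have ru t : time_itv T t -> realization setT (u t) (y t).
  exact: (realization_u jy lf lpy r0 y_eq).
exists u; split.
- split.
  + apply/weak_solution_tcut.
    exact: (weak_solution_u jy lf lpy r0 Lf rf y_eq).
  + exact: (Xspace_oo1_u jy lf lpy r0 Lf rf y_eq).
  + apply/Xspace_tcut.
    exact: (Xspace_11_u jy lf lpy r0 Lf rf y_eq jpsi).
- move=> u' [/weak_solution_tcut w1 w2 /Xspace_tcut w3].
  have := weak_solution_unique jpsi lf r0 rf hpsi1 w1 w2 w3.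
  apply: aeS => t ht tT; apply: invF_dual_ext => phi tphi.
  by rewrite (ht tT phi tphi) (realizationE (ru t tT) tphi).
move=> t tT phi tphi; rewrite (realizationE (ru t tT) tphi).
have mF : cmeasurable_fun setT (fun xi => conjc (Fourier phi xi)).
  by apply: cmeasurable_conj; apply: csmooth_cmeasurable; case: tphi.2.
pose aa xi := exp_int psi1 0 t xi * u0h xi.
pose bb xi := cintegral lebesgue_measure `]0, t[ (fun s => exp_int psi1 s t xi * fh1 s xi).
have maa : cmeasurable_fun setT aa.
  apply: cmeasurableM; last by case: r0 => -[].
  by apply: (cmeasurable_exp_int jpsi); [exact: measurable_cst|exact: measurable_cst|exact: measurable_id].
(* |exp(int psi)| = exp(int Re psi), so the first integrability hypothesis controls [aa] on
   balls. *)
have laa : clocally_integrable setT aa.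
  apply: clocally_integrableP maa _ => n.
  have [->|n0] := posnP n; first by rewrite eball0 integral_set0 ltry.
  have n0' : 0 < n%:R :> R by rewrite ltr0n.
  apply: le_lt_trans (hexp t _ tT n0').
  apply: (@le_trans _ _ (\int[lebesgue_rV R d]_(xi in eball n%:R)
    (exp_Re_int psi 0 t xi * normc (u0h xi))%:E)%E); last first.
    rewrite leeDl// integral_ge0// => xi _; apply: integral_ge0 => s _.
    by rewrite lee_fin mulr_ge0 ?normc_ge0 ?expR_ge0.
  rewrite le_eqVlt; apply/orP; left; apply/eqP; apply: eq_integral => xi _.
  by rewrite /aa Normc.normcM normc_exp_int exp_Re_int_tcut.
have mbb : cmeasurable_fun setT bb by exact: (cmeasurable_duhamel jpsi lf t).
have yab : {ae lebesgue_rV R d, forall xi, y t xi = aa xi + bb xi}.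
  by apply: aeS (ae_good jpsi lf hpsi1) => xi gxi; exact: (sol_exp u0h gxi tT).
(* The Duhamel term is almost everywhere the difference of the solution density and the homogeneous
   term, both locally integrable. *)
have lbb : clocally_integrable setT bb.
  apply: (@ae_eq_clocally_integrable _ _ (fun xi => y t xi + - 1 * aa xi)) => //.
    by apply: aeS yab => xi ->; rewrite mulN1r addrAC subrr add0r.
  apply: clocally_integrableD; first exact: (ru t tT).1.
  exact: clocally_integrableZ.
transitivity (cintegral (lebesgue_rV R d) setT (fun xi => aa xi * conjc (Fourier phi xi) +
    bb xi * conjc (Fourier phi xi))).
  apply: ae_eq_cintegral => //.
  - exact: cintegrable_cmeasurable (cintegrable_pairing (ru t tT).1 tphi.2).
  - by apply: cmeasurableD; exact: cmeasurableM.
  by apply: aeS yab => xi -> _; rewrite mulrDl.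
rewrite (cintegralD measurableT (cintegrable_pairing laa tphi.2)
  (cintegrable_pairing lbb tphi.2)).
have Ea : (fun xi => aa xi * conjc (Fourier phi xi)) =
    (fun xi => exp_int psi 0 t xi * u0h xi * conjc (Fourier phi xi)).
  by apply/funext => xi; rewrite /aa exp_int_tcut.
have Eb : bb = (fun xi => cintegral lebesgue_measure `]0, t[
    (fun s => exp_int psi s t xi * fh s xi)).
  apply/funext => xi; apply: eq_cintegral => s /set_mem sI.
  rewrite /fh1 (eq_itv_tcut _ _ (lexx 0) tT sI) exp_int_tcut//.
  by move: sI; rewrite /= in_itv/= => /andP[/ltW].
by rewrite Ea Eb.
Qed.
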